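(* Let $d>0$, $\alpha_0\in\mathbb R$, $c\in\mathbb R\setminus\{0\}$, $\omega\in(0,\pi)\setminus\{\pi/2\}$, $\phi\in[0,2\pi)$, $\gamma\in(\tfrac12,1]$, let $\{q_n\}_{n\in\mathbb N}\in\ell^1(\mathbb N)$ be real-valued, and let $\varkappa\in[0,\pi)$. Let $$\widetilde x_n=nd,\quad \widetilde\alpha_n=\alpha_0+\frac{c\sin(2\omega n+\phi)}{n^\gamma}+q_n;\qquad \widehat x_n=nd+\frac{c\sin(2\omega n+\phi)}{n^\gamma}+q_n,\quad \widehat\alpha_n=\alpha_0,\qquad n\in\mathbb N,$$ and let $\widetilde X=\{\widetilde x_n\}$, $\widetilde\alpha=\{\widetilde\alpha_n\}$, $\widehat X=\{\widehat x_n\}$, $\widehat\alpha=\{\widehat\alpha_n\}$, where it is assumed that $0<\widehat x_1<\widehat x_2<\dots$, $\inf_n|\widehat x_{n+1}-\widehat x_n|>0$ and $\sup_n|\widehat x_{n+1}-\widehat x_n|<\infty$. Then $$\sigma_{\rm ess}(H_{\varkappa,\widetilde X,\widetilde\alpha})=\sigma_{\rm ess}(H_{\varkappa,\widehat X,\widehat\alpha})=\{\lambda\in\mathbb R\colon L(\sqrt\lambda)\in[-1,1]\},$$ where $L(k)=\cos(kd)+\alpha_0\frac{\sin(kd)}{2k}$ and $L(0)=1+\frac{\alpha_0d}2$. In particular, the spectra of $H_{\varkappa,\widetilde X,\widetilde\alpha}$ and $H_{\varkappa,\widehat X,\widehat\alpha}$ are discrete in the set $\mathbb R\setminus\{\lambda\in\mathbb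 R\colon L(\sqrt\lambda)\in[-1,1]\}$.
   Context: For $\lambda\in\mathbb R$ the square root is chosen with $\operatorname{Im}\sqrt\lambda\ge0$ (for $\lambda<0$, $\sin(ix)=i\sinh x$, $\cos(ix)=\cosh x$). Let $X=\{x_n\colon n\in\mathbb N\}\subset\mathbb R_+=(0,\infty)$ with $0<x_1<x_2<\dots$, $\inf_n|x_{n+1}-x_n|>0$, $\sup_n|x_{n+1}-x_n|<\infty$, let $\alpha=\{\alpha_n\}_{n\in\mathbb N}$ be a real sequence, and let $\varkappa\in[0,\pi)$. Let $\mathcal S_{X,\alpha}$ be the set of functions $\psi$ on $\mathbb R_+$ such that $\psi,\psi'\in AC_{\rm loc}(\mathbb R_+\setminus X)$ and, for all $n\in\mathbb N$, $\psi(x_n+)=\psi(x_n-)=\psi(x_n)$ and $\psi'(x_n+)-\psi'(x_n-)=\alpha_n\psi(x_n)$. The operator $H_{\varkappa,X,\alpha}$ in $L^2(\mathbb R_+)$ is defined by $H_{\varkappa,X,\alpha}\psi=-\psi''$ on $$\operatorname{dom}H_{\varkappa,X,\alpha}=\{\psi\in\mathcal S_{X,\alpha}\colon \psi,\psi''\in L^2(\mathbb R_+),\ \psi(0)\cos\varkappa=\psi'(0)\sin\varkappa\}$$ (here $\psi''$ is taken on $\mathbb R_+\setminus X$); it is self-adjoint. *)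

(* Defs.v *)
From HB Require Import structures.
From mathcomp Require Import all_boot all_order all_algebra.
From mathcomp Require Import all_classical all_reals all_analysis.
From mathcomp Require Import complex.

Set Implicit Arguments.
Unset Strict Implicit.
Unset Printing Implicit Defensive.

Import Order.TTheory GRing.Theory Num.Theory.
Import numFieldNormedType.Exports.

Local Open Scope classical_set_scope.
Local Open Scope ring_scope.
Local Open Scope complex_scope.

(* Functions on (0, +oo) are total functions f : R -> R[i] whose values on
   (-oo, 0] are never inspected. *)

Section L2.
Context {R : realType}.
Implicit Types f g : R -> R[i].

Definition halfline : set R := `]0, +oo[.

Definition sqintegral f : \bar R :=
  (\int[lebesgue_measure]_(x in halfline) (Normc.normc (f x) ^+ 2)%:E)%E.

Definition inL2 f : Prop :=
  [/\ measurable_fun halfline (fun x => complex.Re (f x)),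
      measurable_fun halfline (fun x => complex.Im (f x))
    & (sqintegral f < +oo)%E].

Definition L2norm f : R := Num.sqrt (fine (sqintegral f)).

(* Equality in L^2(0, +oo). *)
Definition eqL2 f g : Prop :=
  {ae lebesgue_measure, forall x, halfline x -> f x = g x}.

End L2.

(* A linear operator in L^2(0, +oo) is represented by a set of pairs (f, h) of
   functions: f is a representative of an element of the domain and h is a
   representative of its image.  Equalities in L^2 are a.e. equalities. *)

Section SpectralTheory.
Context {R : realType}.
Implicit Types (T : set ((R -> R[i]) * (R -> R[i]))) (z : R[i]).

Definition shifted (f h : R -> R[i]) z : R -> R[i] := fun x => h x - z * f x.

Definition resolvent_set T : set R[i] := [set z |
  [/\ forall g, inL2 g -> exists f h, T (f, h) /\ eqL2 (shifted f h z) g,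
      forall f h, T (f, h) -> eqL2 (shifted f h z) (cst 0) -> eqL2 f (cst 0)
    & exists M : R, forall f h, T (f, h) ->
        L2norm f <= M * L2norm (shifted f h z)]].

Definition spectrum T : set R[i] := ~` resolvent_set T.

Definition eigenfunction T z (f : R -> R[i]) : Prop :=
  exists h, T (f, h) /\ eqL2 h (fun x => z * f x).

Definition eigenvalue T z : Prop :=
  exists2 f, eigenfunction T z f & ~ eqL2 f (cst 0).

Definition finite_multiplicity T z : Prop :=
  exists (m : nat) (e : 'I_m -> R -> R[i]), forall f, eigenfunction T z f ->
    exists a : 'I_m -> R[i], eqL2 f (fun x => \sum_(i < m) a i * e i x).

Definition discrete_spectrum T : set R[i] := [set z |
  [/\ isolated (spectrum T : set (R[i] : numFieldType)) z,
      eigenvalue T z & finite_multiplicity T z]].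

Definition essential_spectrum T : set R[i] :=
  spectrum T `\` discrete_spectrum T.

(* The part of the spectrum lying in G consists of isolated eigenvalues of
   finite multiplicity. *)
Definition discrete_in T (G : set R[i]) : Prop :=
  spectrum T `&` G `<=` discrete_spectrum T.

End SpectralTheory.

Section Hamiltonian.
Context {R : realType}.
Implicit Types (psi : R -> R[i]) (x alpha : nat -> R).

Definition cderive psi : R -> R[i] := fun t =>
  derive1 (fun s => complex.Re (psi s)) t
    +i* derive1 (fun s => complex.Im (psi s)) t.

Definition derivable_at psi (t : R) : Prop :=
  derivable (fun s => complex.Re (psi s)) t 1
  /\ derivable (fun s => complex.Im (psi s)) t 1.

Definition cvgC (F : set_system R) psi (l : R[i]) : Prop :=
  ((fun t => complex.Re (psi t)) @ F --> complex.Re l)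
  /\ ((fun t => complex.Im (psi t)) @ F --> complex.Im l).

Definition abs_continuous_on (a b : R) psi : Prop :=
  forall eps : R, 0 < eps -> exists2 delta : R, 0 < delta &
    forall (m : nat) (s t : 'I_m -> R),
      (forall i, a <= s i /\ s i <= t i /\ t i <= b) ->
      (forall i j, i != j -> t i <= s j \/ t j <= s i) ->
      \sum_(i < m) (t i - s i) < delta ->
      \sum_(i < m) Normc.normc (psi (t i) - psi (s i)) < eps.

Definition AC_loc (U : set R) psi : Prop :=
  forall a b : R, a <= b -> `[a, b] `<=` U -> abs_continuous_on a b psi.

(* Sequences indexed by N = {1, 2, ...} are functions on nat whose value at 0
   plays no role. *)
Definition points x : set R := [set x n | n in [set n | (1 <= n)%N]].

Definition gaps x : set R :=
  [set `|x n.+1 - x n| | n in [set n | (1 <= n)%N]].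

Definition admissible x : Prop :=
  [/\ 0 < x 1%N,
      forall n, (1 <= n)%N -> x n < x n.+1,
      0 < inf (gaps x)
    & has_ubound (gaps x)].

(* The class S_{X,alpha}, where X = {x n | n >= 1}. *)
Definition delta_class x alpha psi : Prop :=
  let U := halfline `\` points x in
  [/\ forall t, U t -> derivable_at psi t,
      AC_loc U psi,
      AC_loc U (cderive psi)
    & forall n, (1 <= n)%N ->
        [/\ cvgC (x n)^'+ psi (psi (x n)),
            cvgC (x n)^'- psi (psi (x n))
          & exists dr dl : R[i],
              [/\ cvgC (x n)^'+ (cderive psi) dr,
                  cvgC (x n)^'- (cderive psi) dl
                & dr - dl = (alpha n)%:C * psi (x n)]]].

(* psi(0) cos kappa = psi'(0) sin kappa, with psi(0), psi'(0) the limits at 0+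
   (which exist as soon as psi'' is square-integrable near 0). *)
Definition boundary_condition (kappa : R) psi : Prop :=
  exists v w : R[i],
    [/\ cvgC 0^'+ psi v, cvgC 0^'+ (cderive psi) w
      & v * (cos kappa)%:C = w * (sin kappa)%:C].

(* The operator H_{kappa,X,alpha}, h being a representative of - psi''; thus
   psi'' in L^2 is expressed by inL2 h. *)
Definition Hamiltonian (kappa : R) x alpha :
    set ((R -> R[i]) * (R -> R[i])) :=
  [set p | let: (psi, h) := p in
    [/\ delta_class x alpha psi,
        inL2 psi /\ inL2 h,
        {ae lebesgue_measure, forall t, (halfline `\` points x) t ->
          derivable_at (cderive psi) t /\ h t = - cderive (cderive psi) t}
      & boundary_condition kappa psi]].

End Hamiltonian.

Section Discriminant.
Context {R : realType}.
Implicit Types k z : R[i].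

Definition cexp z : R[i] :=
  let: a +i* b := z in (expR a * cos b) +i* (expR a * sin b).

Definition ccos z : R[i] := (cexp ('i * z) + cexp (- ('i * z))) / 2.

Definition csin z : R[i] := (cexp ('i * z) - cexp (- ('i * z))) / (2 * 'i).

Definition discriminant (d alpha0 : R) k : R[i] :=
  if k == 0 then (1 + alpha0 * d / 2)%:C
  else ccos (k * d%:C) + alpha0%:C * (csin (k * d%:C) / (2 * k)).

(* sqrtC is the square root with nonnegative imaginary part.  The order on
   R[i] satisfies u <= v iff v - u is real and nonnegative, so the condition
   states that the value is real and lies in [-1, 1]. *)
Definition bands (d alpha0 : R) : set R :=
  [set lam | -1 <= discriminant d alpha0 (sqrtC lam%:C) <= 1].

End Discriminant.

(* Main.v *)
(* Only the limits x_(n+1) - x_n -> d and alpha_n -> alpha0 matter.  A solution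
   f of - f'' - z f = g is determined on each cell by its data
   v_n = (f(x_n), f'(x_n+)), and v_(n+1) = T_n v_n + w_n, where T_n tends to the
   monodromy matrix M of the periodic problem, of determinant 1 and trace
   2 L(sqrt z), and |w_n|^2 is at most a multiple of the energy of g on the
   cell; moreover the L^2 norm of f and the l^2 norm of v control each other.

   Off the bands M has eigenvalues m and 1/m with |m| < 1.  A Lyapunov function
   then yields l^2 solutions of the recursion and an a priori bound, so that z
   is a resolvent point unless it is an eigenvalue.  Nonreal z lie off the bands
   and are not eigenvalues because the flux Im(f' conj(f)) is strictly monotone.
   A real eigenvalue z off the bands is isolated: by the a priori bound an
   eigenfunction for z' close to z would be close to the one for z, whereas the
   two are orthogonal.

   On the bands |m| = 1, and a solution which starts far away at an eigenvector
   of M, multiplied by a polynomial bump supported on a long window of cells, is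
   an approximate eigenfunction.  Finally the bands have no isolated point:
   where L = 1 or L = -1 the derivative of L along the real axis does not
   vanish, except for alpha0 = 0, when the band is [0, +oo), and at the energy
   0, where L has to be expanded. *)

Require Import Defs.
From HB Require Import structures.
From mathcomp Require Import all_boot all_order all_algebra.
From mathcomp Require Import all_classical all_reals all_analysis.
From mathcomp Require Import measurable_realfun complex.
From mathcomp Require Import ring lra zify.

Set Implicit Arguments.
Unset Strict Implicit.
Unset Printing Implicit Defensive.

Import Order.TTheory GRing.Theory Num.Theory.
Import numFieldNormedType.Exports.

Local Open Scope classical_set_scope.
Local Open Scope ring_scope.
Local Open Scope complex_scope.

(** * Complex-valued functions of a real variable *)

Section ComplexCalculus.
Context {R : realType}.
Implicit Types (F G : R -> R[i]) (f g : R -> R) (z w l : R[i]) (s t x e r : R).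
Local Notation normc := (@Normc.normc R).

(** Three obstacles shape the arguments. Membership in the domain gives only absolute continuity and
    derivatives almost everywhere. What is extracted from this is one inequality,
    [abs_continuous_increment_le]; Green's formula therefore enters as a bound on increments. Square
    norms are wanted, so the integral of |F'| is traded for k/2 times an energy plus a length over
    2k, with k free. Optimizing over k then plays the part of the Cauchy-Schwarz inequality, for
    functions and for sequences. The transfer matrices converge without a prescribed rate, so they
    are not multiplied out: the Lyapunov inequality only sees that T_n - M is eventually small, and
    the finitely many earlier steps are bounded crudely or run backwards, which determinant 1
    permits. Statements about energies z' near z use constants at z alone: a function belonging to
    z' is read as one for z with the additional right-hand side (z' - z) f. This separates
    eigenvalues from each other and also keeps z away from the bands, because the approximate
    eigenfunctions on the bands have zero data at 0 and would violate the a priori bound at z. *)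

Lemma normc_ge0 z : 0 <= normc z.
Proof. by case: z => a b; apply: sqrtr_ge0. Qed.

Lemma normcD z w : normc (z + w) <= normc z + normc w.
Proof. exact: le_normcD. Qed.

Lemma normcM z w : normc (z * w) = normc z * normc w.
Proof. exact: Normc.normcM. Qed.

Lemma normc0 : normc 0 = 0.
Proof. exact: Normc.normc0. Qed.

Lemma normcN z : normc (- z) = normc z.
Proof. exact: normcN. Qed.

Lemma normcBC z w : normc (z - w) = normc (w - z).
Proof. by rewrite -normcN opprB. Qed.

Lemma normcB z w : normc (z - w) <= normc z + normc w.
Proof. by rewrite -(normcN w); exact: normcD. Qed.

Lemma normc_eq0 z : (normc z == 0) = (z == 0).
Proof.
apply/eqP/eqP => [/Normc.eq0_normc //|->]; exact: normc0.
Qed.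

Lemma normc_gt0 z : (0 < normc z) = (z != 0).
Proof. by rewrite lt_def normc_ge0 andbT normc_eq0. Qed.

Lemma normcV z : normc z^-1 = (normc z)^-1.
Proof. exact: Normc.normcV. Qed.

Lemma normc_real x : normc x%:C = `|x|.
Proof. by rewrite /= expr0n addr0 sqrtr_sqr. Qed.

Lemma normc1 : normc 1 = 1.
Proof. exact: Normc.normc1. Qed.

Lemma normcXn z n : normc (z ^+ n) = normc z ^+ n.
Proof. by elim: n => [|n IH]; rewrite ?expr0 ?normc1// !exprS normcM IH. Qed.

Lemma sqr_normcE z : normc z ^+ 2 = complex.Re z ^+ 2 + complex.Im z ^+ 2.
Proof. by case: z => a b /=; rewrite sqr_sqrtr// addr_ge0 ?sqr_ge0. Qed.

Lemma Re_le_normc z : `|complex.Re z| <= normc z.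
Proof.
case: z => a b /=; rewrite -sqrtr_sqr ler_sqrt ?addr_ge0 ?sqr_ge0//.
by rewrite lerDl sqr_ge0.
Qed.

Lemma Im_le_normc z : `|complex.Im z| <= normc z.
Proof.
case: z => a b /=; rewrite -sqrtr_sqr ler_sqrt ?addr_ge0 ?sqr_ge0//.
by rewrite lerDr sqr_ge0.
Qed.

Lemma normc_le_ReIm z : normc z <= `|complex.Re z| + `|complex.Im z|.
Proof.
case: z => a b /=; rewrite -[leRHS]ger0_norm ?addr_ge0//.
rewrite -sqrtr_sqr ler_sqrt ?sqr_ge0// sqrrD !real_normK ?num_real//.
have : 0 <= `|a| * `|b| by rewrite mulr_ge0.
by rewrite -mulr_natr; lra.
Qed.

Lemma normc_abs z : `|z| = (normc z)%:C.
Proof. by []. Qed.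

Lemma normc_conj z : normc z^* = normc z.
Proof. by case: z => a b /=; rewrite sqrrN. Qed.

Lemma ReB z w : complex.Re (z - w) = complex.Re z - complex.Re w.
Proof. by case: z w => [a b] [c d]. Qed.
Lemma ImB z w : complex.Im (z - w) = complex.Im z - complex.Im w.
Proof. by case: z w => [a b] [c d]. Qed.
Lemma ReD z w : complex.Re (z + w) = complex.Re z + complex.Re w.
Proof. by case: z w => [a b] [c d]. Qed.
Lemma ImD z w : complex.Im (z + w) = complex.Im z + complex.Im w.
Proof. by case: z w => [a b] [c d]. Qed.
Lemma ReN z : complex.Re (- z) = - complex.Re z.
Proof. by case: z => [a b]. Qed.
Lemma ImN z : complex.Im (- z) = - complex.Im z.
Proof. by case: z => [a b]. Qed.
Lemma ReM z w :
  complex.Re (z * w) = complex.Re z * complex.Re w - complex.Im z * complex.Im w.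
Proof. by case: z w => [a b] [c d]. Qed.
Lemma ImM z w :
  complex.Im (z * w) = complex.Re z * complex.Im w + complex.Im z * complex.Re w.
Proof. by case: z w => [a b] [c d]. Qed.
Lemma complexP z w : complex.Re z = complex.Re w -> complex.Im z = complex.Im w ->
  z = w.
Proof. by case: z w => [a b] [c d] /= -> ->. Qed.

(** The error bound e |x - t| includes x = t, which makes the condition stable under sums and lets
    real and imaginary parts be merged into one estimate in [is_cder_epsP]. *)
Lemma is_derive_epsP f t (l : R) : is_derive t 1 f l <->
  forall e, 0 < e -> exists2 r, 0 < r &
    forall x, `|x - t| < r -> `|f x - f t - l * (x - t)| <= e * `|x - t|.
Proof.
have E h : h != 0 -> `|l - h^-1 *: (f (h *: (1:R) + t) - f t)| * `|h|
    = `|f (h + t) - f t - l * (h + t - t)|.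
  move=> h0; rewrite -normrM distrC mulrBl addrK; congr (`| _ - _ |).
  by rewrite /GRing.scale /= mulr1 mulrAC mulVf ?mul1r.
split=> [[df dl] e e0|H].
- have /cvgrPdist_le /(_ e e0) : h^-1 *: (f (h *: (1:R) + t) - f t) @[h --> (0:R)^'] --> l.
    by rewrite -dl; exact: df.
  rewrite near_withinE => /nbhs_ballP[r /= r0 Hr]; exists r => // x xr.
  have [->|xt] := eqVneq x t; first by rewrite !subrr mulr0 normr0 subrr normr0 mulr0.
  have h0 : x - t != 0 by rewrite subr_eq0.
  have := E _ h0; rewrite subrK => <-; apply: ler_wpM2r => //.
  by apply: Hr => //; rewrite /ball/= sub0r normrN.
- have C : h^-1 *: (f (h *: (1:R) + t) - f t) @[h --> (0:R)^'] --> l.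
    apply/cvgrPdist_le => e e0; have [r r0 Hr] := H e e0.
    rewrite near_withinE; apply/nbhs_ballP; exists r => //= h.
    rewrite /ball/= sub0r normrN => hr h0.
    rewrite -(@ler_pM2r _ `|h|) ?normr_gt0// E//.
    by rewrite -[in leRHS](addrK t h); apply: Hr; rewrite addrK.
  split; first by apply/cvg_ex; exists l.
  exact: (cvg_lim (@Rhausdorff R) C).
Qed.

(** Derivative in the real variable with its value as an argument: [cderive] is a total function and
    does not record that the derivative exists. *)
Definition is_cder F t l :=
  is_derive t 1 (fun x => complex.Re (F x)) (complex.Re l) /\
  is_derive t 1 (fun x => complex.Im (F x)) (complex.Im l).

Lemma is_cder_epsP F t l : is_cder F t l <->
  forall e, 0 < e -> exists2 r, 0 < r &
    forall x, `|x - t| < r ->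
      normc (F x - F t - l * (x - t)%:C) <= e * `|x - t|.
Proof.
split.
- move=> [/is_derive_epsP H1 /is_derive_epsP H2] e e0.
  have e20 : 0 < e / 2 by rewrite divr_gt0.
  have [r1 r10 H1'] := H1 _ e20; have [r2 r20 H2'] := H2 _ e20.
  exists (Num.min r1 r2); first by rewrite lt_min r10.
  move=> x; rewrite lt_min => /andP[x1 x2].
  apply: (le_trans (normc_le_ReIm _)).
  rewrite !(ReB,ImB,ReM,ImM)/= !mulr0 subr0 add0r.
  by move: (H1' _ x1) (H2' _ x2); lra.
- move=> H; split; apply/is_derive_epsP => e e0; have [r r0 Hr] := H e e0;
  exists r => // x xr; apply: le_trans (Hr _ xr).
    apply: le_trans (Re_le_normc _).
    by rewrite !(ReB,ImB,ReM,ImM)/= !mulr0 subr0.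
  apply: le_trans (Im_le_normc _).
  by rewrite !(ReB,ImB,ReM,ImM)/= !mulr0 add0r.
Qed.

Lemma is_cder_near F G t l r : 0 < r -> (forall x, `|x - t| < r -> F x = G x) ->
  is_cder F t l -> is_cder G t l.
Proof.
move=> r0 FG /is_cder_epsP H; apply/is_cder_epsP => e /H[r' r'0 H'].
exists (Num.min r r'); first by rewrite lt_min r0.
move=> x; rewrite lt_min => /andP[xr xr']; rewrite -FG// -FG ?H'//.
by rewrite subrr normr0.
Qed.

Lemma is_cder_ext F G t l : F =1 G -> is_cder F t l -> is_cder G t l.
Proof. by move=> FG; apply: (@is_cder_near _ _ _ _ 1) => // x _; rewrite FG. Qed.

Lemma is_cder_eq F t l l' : is_cder F t l -> l = l' -> is_cder F t l'.
Proof. by move=> H <-. Qed.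

Lemma is_cder_cst z t : is_cder (fun=> z) t 0.
Proof. by split; apply: is_derive_cst. Qed.

Lemma is_cder_id t : is_cder (fun x => x%:C) t 1.
Proof. by split; [exact: is_derive_id|exact: is_derive_cst]. Qed.

Lemma is_cderD F G t l l' : is_cder F t l -> is_cder G t l' ->
  is_cder (fun x => F x + G x) t (l + l').
Proof.
move=> [a b] [c d]; split; rewrite ?ReD ?ImD.
  have -> : (fun x => complex.Re (F x + G x)) =
    (fun x => complex.Re (F x)) + (fun x => complex.Re (G x)).
    by apply/funext => x; rewrite ReD.
  exact: is_deriveD.
have -> : (fun x => complex.Im (F x + G x)) =
  (fun x => complex.Im (F x)) + (fun x => complex.Im (G x)).
  by apply/funext => x; rewrite ImD.
exact: is_deriveD.
Qed.

Lemma is_cderM F G t l l' : is_cder F t l -> is_cder G t l' ->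
  is_cder (fun x => F x * G x) t (l * G t + F t * l').
Proof.
move=> [a b] [c d]; split; rewrite ?ReD ?ImD ?ReM ?ImM.
  have -> : (fun x => complex.Re (F x * G x)) =
    (fun x => complex.Re (F x)) * (fun x => complex.Re (G x)) -
    (fun x => complex.Im (F x)) * (fun x => complex.Im (G x)).
    by apply/funext => x; rewrite ReM.
  apply: is_derive_eq (is_deriveB (is_deriveM a c) (is_deriveM b d)) _.
  rewrite /GRing.scale /=; ring.
have -> : (fun x => complex.Im (F x * G x)) =
  (fun x => complex.Re (F x)) * (fun x => complex.Im (G x)) +
  (fun x => complex.Im (F x)) * (fun x => complex.Re (G x)).
  by apply/funext => x; rewrite ImM.
apply: is_derive_eq (is_deriveD (is_deriveM a d) (is_deriveM b c)) _.
rewrite /GRing.scale /=; ring.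
Qed.

Lemma is_cderZ z F t l : is_cder F t l -> is_cder (fun x => z * F x) t (z * l).
Proof.
by move=> H; have := is_cderM (is_cder_cst z t) H; rewrite mul0r add0r.
Qed.

Lemma is_cderN F t l : is_cder F t l -> is_cder (fun x => - F x) t (- l).
Proof.
move=> H; apply: is_cder_eq (is_cder_ext _ (is_cderZ (-1) H)) _; last by rewrite mulN1r.
by move=> x; rewrite mulN1r.
Qed.

Lemma is_cderB F G t l l' : is_cder F t l -> is_cder G t l' ->
  is_cder (fun x => F x - G x) t (l - l').
Proof. by move=> H H'; apply: is_cderD => //; exact: is_cderN. Qed.

Lemma is_cder_shift F s t l : is_cder F (t - s) l -> is_cder (fun x => F (x - s)) t l.
Proof.
move=> /is_cder_epsP H; apply/is_cder_epsP => e /H[r r0 H']; exists r => // x xr.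
have E : x - t = (x - s) - (t - s) by lra.
by rewrite E; apply: H'; rewrite -E.
Qed.

Lemma is_cder_conj F t l : is_cder F t l -> is_cder (fun x => (F x)^*) t l^*.
Proof.
move=> [a b]; split.
  have -> : (fun x => complex.Re (F x)^*) = (fun x => complex.Re (F x)).
    by apply/funext => x; case: (F x).
  by case: l a {b}.
have -> : (fun x => complex.Im (F x)^*) = - (fun x => complex.Im (F x)).
  by apply/funext => x; transitivity (- complex.Im (F x)) => //; case: (F x).
by case: l b {a} => u v /= b; exact: is_deriveN.
Qed.

Lemma is_cder_unique F t l l' : is_cder F t l -> is_cder F t l' -> l = l'.
Proof.
move=> [[_ a] [_ b]] [[_ c] [_ d]]; apply: complexP.
  by rewrite -a -c.
by rewrite -b -d.
Qed.

Lemma is_cderE F t l : is_cder F t l -> derivable_at F t /\ cderive F t = l.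
Proof.
move=> [[a b] [c d]]; split; first exact: conj a c.
by rewrite /cderive; rewrite -!derive1E in b d; rewrite b d; case: l {b d}.
Qed.

Lemma derivable_at_cder F t : derivable_at F t -> is_cder F t (cderive F t).
Proof.
by move=> [a b]; split; [have H := derivableP a|have H := derivableP b]; rewrite -derive1E in H; exact: H.
Qed.

(* Both endpoints may move: F' controls increments over intervals containing t. *)
Lemma is_cder_straddle F t l : is_cder F t l -> forall e, 0 < e ->
  exists2 r, 0 < r & forall u v, t - r < u -> u <= t -> t <= v -> v < t + r ->
    normc (F v - F u - l * (v - u)%:C) <= e * (v - u).
Proof.
move=> /is_cder_epsP H e /H[r r0 H']; exists r => // u v ru ut tv vr.
have -> : F v - F u - l * (v - u)%:C =
   (F v - F t - l * (v - t)%:C) - (F u - F t - l * (u - t)%:C).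
  by rewrite !rmorphB/=; ring.
apply: (le_trans (normcB _ _)).
have -> : e * (v - u) = e * (v - t) + e * (t - u) by ring.
apply: lerD.
  have := H' v; rewrite ger0_norm ?subr_ge0//; apply; lra.
have := H' u; rewrite ler0_norm ?subr_le0// opprB; apply; lra.
Qed.

(** * Limits of complex-valued functions *)

Lemma cvgC_epsP (A : set_system R) {FA : Filter A} F l : cvgC A F l <->
  forall e, 0 < e -> \forall x \near A, normc (F x - l) <= e.
Proof.
split.
- move=> [/cvgrPdist_le H1 /cvgrPdist_le H2] e e0.
  have e20 : 0 < e / 2 by rewrite divr_gt0.
  have h1 := H1 _ e20; have h2 := H2 _ e20.
  near=> x; apply: (le_trans (normc_le_ReIm _)).
  rewrite ReB ImB distrC [X in _ + X]distrC [leRHS]splitr lerD//; by near: x.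
- move=> H; split; apply/cvgrPdist_le => e e0; have h := H e e0; near=> x;
  rewrite distrC.
    rewrite -ReB; apply: (le_trans (Re_le_normc _)); by near: x.
  rewrite -ImB; apply: (le_trans (Im_le_normc _)); by near: x.
Unshelve. all: by end_near. Qed.

Lemma cvgC_rightP F t l : cvgC t^'+ F l <->
  forall e, 0 < e -> exists2 r, 0 < r &
    forall x, t < x -> x < t + r -> normc (F x - l) <= e.
Proof.
split=> [/cvgC_epsP H e e0|H].
- have := H e e0; rewrite near_withinE => /nbhs_ballP[r /= r0 Hr].
  exists r => // x tx xr; apply: Hr => //; rewrite /ball/= distrC ger0_norm; lra.
- apply/cvgC_epsP => e /H[r r0 Hr]; rewrite near_withinE; apply/nbhs_ballP.
  exists r => //= x; rewrite /ball/= => xr tx; apply: Hr => //.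
  move: xr; rewrite distrC gtr0_norm; lra.
Qed.

Lemma cvgC_leftP F t l : cvgC t^'- F l <->
  forall e, 0 < e -> exists2 r, 0 < r &
    forall x, t - r < x -> x < t -> normc (F x - l) <= e.
Proof.
split=> [/cvgC_epsP H e e0|H].
- have := H e e0; rewrite near_withinE => /nbhs_ballP[r /= r0 Hr].
  exists r => // x tx xr; apply: Hr => //; rewrite /ball/= ger0_norm; lra.
- apply/cvgC_epsP => e /H[r r0 Hr]; rewrite near_withinE; apply/nbhs_ballP.
  exists r => //= x; rewrite /ball/= => xr tx; apply: Hr => //.
  move: xr; rewrite gtr0_norm; lra.
Qed.

Lemma cvgC_nbhsP F t l : cvgC (nbhs t) F l <->
  forall e, 0 < e -> exists2 r, 0 < r &
    forall x, `|x - t| < r -> normc (F x - l) <= e.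
Proof.
split=> [/cvgC_epsP H e e0|H].
- have := H e e0 => /nbhs_ballP[r /= r0 Hr].
  by exists r => // x xr; apply: Hr; rewrite /ball/= distrC.
- apply/cvgC_epsP => e /H[r r0 Hr]; apply/nbhs_ballP.
  by exists r => //= x; rewrite /ball/= distrC; exact: Hr.
Qed.

Lemma cvgC_cst (A : set_system R) {FA : Filter A} z : cvgC A (fun=> z) z.
Proof. by split; apply: cvg_cst. Qed.

Lemma cvgCD (A : set_system R) {FA : Filter A} F G l l' :
  cvgC A F l -> cvgC A G l' -> cvgC A (fun x => F x + G x) (l + l').
Proof.
move=> [a b] [c d]; split; rewrite ?ReD ?ImD.
  under eq_fun do rewrite ReD; exact: cvgD.
under eq_fun do rewrite ImD; exact: cvgD.
Qed.

Lemma cvgCM (A : set_system R) {FA : Filter A} F G l l' :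
  cvgC A F l -> cvgC A G l' -> cvgC A (fun x => F x * G x) (l * l').
Proof.
move=> [a b] [c d]; split; rewrite ?ReM ?ImM.
  under eq_fun do rewrite ReM; by apply: cvgB; exact: cvgM.
under eq_fun do rewrite ImM; by apply: cvgD; exact: cvgM.
Qed.

Lemma cvgCN (A : set_system R) {FA : Filter A} F l :
  cvgC A F l -> cvgC A (fun x => - F x) (- l).
Proof.
move=> [a b]; split; rewrite ?ReN ?ImN.
  under eq_fun do rewrite ReN; exact: cvgN.
under eq_fun do rewrite ImN; exact: cvgN.
Qed.

Lemma cvgCB (A : set_system R) {FA : Filter A} F G l l' :
  cvgC A F l -> cvgC A G l' -> cvgC A (fun x => F x - G x) (l - l').
Proof. by move=> H H'; apply: cvgCD => //; exact: cvgCN. Qed.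

Lemma is_cder_cvg F t l : is_cder F t l -> cvgC (nbhs t) F (F t).
Proof.
move=> [[/derivable1_diffP/differentiable_continuous a _]].
move=> [/derivable1_diffP/differentiable_continuous b _].
exact: conj a b.
Qed.

Lemma cvgC_nbhs_right F t l : cvgC (nbhs t) F l -> cvgC t^'+ F l.
Proof. by move=> [a b]; split; apply: cvg_at_right_filter. Qed.

Lemma cvgC_nbhs_left F t l : cvgC (nbhs t) F l -> cvgC t^'- F l.
Proof. by move=> [a b]; split; apply: cvg_at_left_filter. Qed.

Lemma cvgC_right_eq F G t l r : 0 < r -> (forall x, t < x -> x < t + r -> F x = G x) ->
  cvgC t^'+ F l -> cvgC t^'+ G l.
Proof.
move=> r0 FG /cvgC_rightP H; apply/cvgC_rightP => e /H[r' r'0 H'].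
exists (Num.min r r'); first by rewrite lt_min r0.
move=> x tx; rewrite -ltrBlDl lt_min => /andP[h1 h2].
by rewrite -FG ?H' -?ltrBlDl.
Qed.

Lemma cvgC_left_eq F G t l r : 0 < r -> (forall x, t - r < x -> x < t -> F x = G x) ->
  cvgC t^'- F l -> cvgC t^'- G l.
Proof.
move=> r0 FG /cvgC_leftP H; apply/cvgC_leftP => e /H[r' r'0 H'].
exists (Num.min r r'); first by rewrite lt_min r0.
move=> x h tx; have [h1 h2] : x > t - r /\ x > t - r'.
  by move: h; rewrite minEle; case: (lerP r r'); lra.
by rewrite -FG ?H'.
Qed.

(** Estimates are proved strictly inside a cell and reach the data at its end points by this passage
    to the limit. *)
Lemma cvgC_le_right F t l x0 (K : R) : t < x0 -> cvgC t^'+ F l ->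
  (forall x, t < x -> x < x0 -> normc (F x) <= K) -> normc l <= K.
Proof.
move=> tx /cvgC_rightP H HK; apply/ler_addgt0Pl => e /H[r r0 Hr].
pose x := t + Num.min r (x0 - t) / 2.
have m0 : 0 < Num.min r (x0 - t) by rewrite lt_min r0 subr_gt0.
have m1 : Num.min r (x0 - t) <= r by rewrite ge_min lexx.
have m2 : Num.min r (x0 - t) <= x0 - t by rewrite ge_min lexx orbT.
have hx : t < x by rewrite /x; lra.
have h1 : normc (F x - l) <= e by apply: Hr => //; rewrite /x; lra.
have h2 : normc (F x) <= K by apply: HK => //; rewrite /x; lra.
have -> : l = - (F x - l) + F x by ring.
by apply: (le_trans (normcD _ _)); rewrite normcN lerD.
Qed.

Lemma cvgC_le_left F t l x0 (K : R) : x0 < t -> cvgC t^'- F l ->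
  (forall x, x0 < x -> x < t -> normc (F x) <= K) -> normc l <= K.
Proof.
move=> tx /cvgC_leftP H HK; apply/ler_addgt0Pl => e /H[r r0 Hr].
pose x := t - Num.min r (t - x0) / 2.
have m0 : 0 < Num.min r (t - x0) by rewrite lt_min r0 subr_gt0.
have m1 : Num.min r (t - x0) <= r by rewrite ge_min lexx.
have m2 : Num.min r (t - x0) <= t - x0 by rewrite ge_min lexx orbT.
have hx : x < t by rewrite /x; lra.
have h1 : normc (F x - l) <= e by apply: Hr => //; rewrite /x; lra.
have h2 : normc (F x) <= K by apply: HK => //; rewrite /x; lra.
have -> : l = - (F x - l) + F x by ring.
by apply: (le_trans (normcD _ _)); rewrite normcN lerD.
Qed.

End ComplexCalculus.

#[global] Arguments Normc.normc : simpl never.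

(** * Increments of absolutely continuous functions *)

Section GaugeArgument.
Context {R : realType}.
Implicit Types (F G : R -> R[i]) (f g : R -> R) (z w l : R[i]) (s t x e r : R).
Local Notation normc := (@Normc.normc R).
Local Notation mu := (@lebesgue_measure R).

Lemma negligible_open_cover (E : set R) (e : R) : mu.-negligible E -> 0 < e ->
  exists U : set R, [/\ open U, E `<=` U & (mu U < e%:E)%E].
Proof.
move=> [A [mA A0 EA]] e0.
have [|U [oU AU U']] := @lebesgue_regularity_outer R A e mA _ e0.
  apply: (@le_lt_trans _ _ 0%E); last exact: ltry.
  by rewrite le_eqVlt; apply/orP; left; apply/eqP; exact: A0.
exists U; split => //; first exact: subset_trans AU.
rewrite -(setDUK AU) measureU//; last 2 first.
  - apply: measurableD => //; exact: open_measurable.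
  - by rewrite setDE setICA setICr setI0.
rewrite [X in (X + _)%E](_ : _ = 0%E) ?add0e//; exact: A0.
Qed.

(** Nonoverlapping segments may share end points; their half-open versions are genuinely disjoint,
    so additivity of the integral applies. *)
Lemma sum_integral_nonoverlap (D : set R) (q : R -> R) m (u v : 'I_m -> R) :
  measurable D -> measurable_fun D q -> (forall x, D x -> 0 <= q x) ->
  (forall i j, i != j -> v i <= u j \/ v j <= u i) ->
  (forall i, `]u i, v i] `<=` D) ->
  (\sum_(i < m) \int[mu]_(x in `]u i, v i]) (q x)%:E <= \int[mu]_(x in D) (q x)%:E)%E.
Proof.
move=> mD mq q0 dis uvD.
have sub : \big[setU/set0]_(i <- index_enum 'I_m) `]u i, v i]%classic `<=` D.
  rewrite -bigcup_seq => x [i _]; exact: uvD.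
rewrite -ge0_integral_bigsetU//=; first last.
- by move=> x /sub /q0; rewrite lee_fin.
- by apply/measurable_EFinP; exact: measurable_funS sub _.
- apply/trivIsetP => i j _ _ /dis ij; apply/seteqP; split=> // x [] /=.
  by rewrite !in_itv/= => /andP[? ?] /andP[? ?]; case: ij; lra.
- exact: index_enum_uniq.
apply: ge0_subset_integral => //; last exact/measurable_EFinP.
by apply: bigsetU_measurable => i _; exact: measurable_itv.
Qed.

Lemma sum_length_lt (U : set R) (d : R) m (u v : 'I_m -> R) :
  open U -> (mu U < d%:E)%E -> (forall i, u i <= v i) ->
  (forall i j, i != j -> v i <= u j \/ v j <= u i) ->
  (forall i, `]u i, v i] `<=` U) -> \sum_(i < m) (v i - u i) < d.
Proof.
move=> oU Ud uv dis uvU; rewrite -lte_fin; apply: le_lt_trans Ud.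
have mU : measurable U by exact: open_measurable.
have E (A : set R) : measurable A -> (\int[mu]_(x in A) (cst 1 x)%:E = mu A)%E.
  by move=> mA; rewrite -[RHS]mul1e -(integral_cst mu mA).
have := @sum_integral_nonoverlap U (cst 1) m u v mU.
rewrite E// => H; apply: le_trans (H _ _ _ _) => //.
rewrite -sumEFin; apply: lee_sum => i _.
by rewrite E// lebesgue_measure_itv/= lte_fin -EFinD;
  case: ltP => // h; rewrite lee_fin subr_le0.
Qed.

Definition nonoverlapping (s x : R) (U : set R) m (u v : nat -> R) :=
  [/\ forall i, (i < m)%N -> [/\ s <= u i, u i <= v i & v i <= x],
      forall i j, (i < m)%N -> (j < m)%N -> i != j -> v i <= u j \/ v j <= u i
    & forall i, (i < m)%N -> `[u i, v i] `<=` U].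

(** The invariant of the induction along the segment. Outside the open set [U] the increment of [F]
    is paid by that of [f] with a slack of slope [e]; what happens inside [U] is only recorded, as
    segments to be paid at the end by absolute continuity. *)
Definition chained F f (s e x : R) (U : set R) := exists m u v,
  nonoverlapping s x U m u v /\
  normc (F x - F s) <= f x - f s + e * (x - s)
    + \sum_(i < m) normc (F (v i) - F (u i)).

Lemma chained_good F f s e U x l k : 0 < e -> is_cder F x l -> is_derive x 1 f k ->
  normc l <= k ->
  exists2 r, 0 < r & forall y y', s <= y -> x - r < y -> y <= x -> x <= y' -> y' < x + r ->
    chained F f s e y U -> chained F f s e y' U.
Proof.
move=> e0 Fl fk lk; have e20 : 0 < e / 2 by rewrite divr_gt0.
have fk' : is_cder (fun x => (f x)%:C) x k%:C.
  by split => //=; exact: is_derive_cst.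
have [r1 r10 H1] := is_cder_straddle Fl e20.
have [r2 r20 H2] := is_cder_straddle fk' e20.
exists (Num.min r1 r2); first by rewrite lt_min r10.
move=> y y' sy y1 yx xy' y'1 [m [u [v [[uv dis uvU] H]]]].
have [m1 m2] : Num.min r1 r2 <= r1 /\ Num.min r1 r2 <= r2.
  by rewrite !ge_min !lexx orbT.
exists m, u, v; split.
  split=> // i im; have [? ? ?] := uv i im; split=> //; lra.
have {}H1 : normc (F y' - F y - l * (y' - y)%:C) <= e / 2 * (y' - y) by apply: H1; lra.
have {}H2 : normc ((f y')%:C - (f y)%:C - k%:C * (y' - y)%:C) <= e / 2 * (y' - y).
  by apply: H2; lra.
have H3 : `|f y' - f y - k * (y' - y)| <= e / 2 * (y' - y).
  move: H2; rewrite -normc_real; congr (normc _ <= _).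
  by apply: complexP => /=; ring.
have {H3} H3 : k * (y' - y) <= f y' - f y + e / 2 * (y' - y).
  by move: H3; rewrite ler_norml; lra.
have {}H1 : normc (F y' - F y) <= k * (y' - y) + e / 2 * (y' - y).
  have -> : F y' - F y = l * (y' - y)%:C + (F y' - F y - l * (y' - y)%:C) by ring.
  apply: (le_trans (normcD _ _)); apply: lerD => //.
  rewrite normcM normc_real ger0_norm; last lra.
  by apply: ler_wpM2r => //; lra.
have -> : F y' - F s = (F y' - F y) + (F y - F s) by ring.
apply: (le_trans (normcD _ _)); move: H H1 H3 => /=.
by set S := \sum_(_ < _) _; lra.
Qed.

(** A neighbourhood of [x] lies in [U], so the whole piece from [y] to [y'] is appended to the list;
    monotonicity of [f] and of the slack takes care of the other terms. *)
Lemma chained_bad F f s e U x : 0 < e -> open U -> U x ->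
  (forall u v, s <= u -> u <= v -> f u <= f v) ->
  exists2 r, 0 < r & forall y y', s <= y -> x - r < y -> y <= x -> x <= y' -> y' < x + r ->
    chained F f s e y U -> chained F f s e y' U.
Proof.
move=> e0 oU Ux ndf; have /nbhs_ballP[r /= r0 Hr] : nbhs x U by exact: open_nbhs_nbhs.
exists r => // y y' sy y1 yx xy' y'1 [m [u [v [[uv dis uvU] H]]]].
exists m.+1, (fun i => if i == m then y else u i), (fun i => if i == m then y' else v i).
have neq i : (i < m)%N -> (i == m) = false by move=> im; rewrite ltn_eqF.
split; first split.
- move=> i; rewrite ltnS leq_eqVlt => /predU1P[->|im].
    rewrite eqxx; split => //; lra.
  rewrite neq//; have [? ? ?] := uv i im; split=> //; lra.
- move=> i j; rewrite ltnS leq_eqVlt => /predU1P im; rewrite ltnS leq_eqVlt => /predU1P.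
  move: im => [->|im] [->|jm].
  + by move=> /eqP.
  + rewrite eqxx neq// => _; have [? ? ?] := uv j jm; right; lra.
  + rewrite eqxx neq// => _; have [? ? ?] := uv i im; left; lra.
  + by rewrite !neq//; exact: dis.
- move=> i; rewrite ltnS leq_eqVlt => /predU1P[->|im].
    rewrite eqxx => q /=; rewrite in_itv/= => /andP[? ?]; apply: Hr.
    rewrite /ball/= ltr_norml; lra.
  by rewrite neq//; exact: uvU.
rewrite big_ord_recr/= eqxx.
have -> : F y' - F s = (F y' - F y) + (F y - F s) by ring.
apply: (le_trans (normcD _ _)).
have -> : \sum_(i < m) normc (F (if (i : nat) == m then y' else v i) -
   F (if (i : nat) == m then y else u i)) = \sum_(i < m) normc (F (v i) - F (u i)).
  by apply: eq_bigr => i _; rewrite neq.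
have h1 : f y <= f y' by apply: ndf => //; lra.
have h2 : e * (y - s) <= e * (y' - s) by rewrite ler_pM2l//; lra.
by move: H; set S := \sum_(_ < _) _; lra.
Qed.

(* Cousin's lemma, in the form of an induction along the segment. *)
Lemma segment_induction (P : R -> Prop) s t : s <= t -> P s ->
  (forall x, s <= x -> x <= t -> exists2 r, 0 < r &
    forall y y', s <= y -> x - r < y -> y <= x -> x <= y' -> y' < x + r ->
      P y -> P y') -> P t.
Proof.
move=> st Ps step; pose A := [set x | s <= x /\ x <= t /\ P x].
have As : A s by [].
have supA : has_sup A.
  by split; [exists s|exists t => x [_ []]].
have sX : s <= sup A by apply: ub_le_sup => //; case: supA.
have Xt : sup A <= t by apply: ge_sup; [exists s|move=> x [_ []]].
have [r r0 Hr] := step _ sX Xt.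
have [y [sy [yt Py]] ry] := sup_adherent r0 supA.
have yX : y <= sup A by apply: ub_le_sup => //; case: supA.
have [tX|Xt'] := leP t (sup A).
  by apply: (Hr y t) => //; lra.
pose y' := Num.min t (sup A + r / 2).
have h1 : y' <= t by rewrite /y' ge_min lexx.
have h2 : y' <= sup A + r / 2 by rewrite /y' ge_min lexx orbT.
have h3 : sup A < y' by rewrite /y' lt_min Xt'/=; lra.
have : y' <= sup A.
  apply: ub_le_sup; first by case: supA.
  by split; [lra|split => //; apply: (Hr y) => //; lra].
by lra.
Qed.

(** Takes the place of the fundamental theorem for absolutely continuous functions. The exceptional
    set is put inside an open set whose measure is below the [d] that absolute continuity assigns to
    [e], and so contributes at most [e]. *)
Lemma abs_continuous_increment_le F f s t (E : set R) : s <= t ->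
  abs_continuous_on s t F -> (forall u v, s <= u -> u <= v -> f u <= f v) ->
  mu.-negligible E ->
  (forall x, s < x -> x < t -> ~ E x -> exists l k,
    [/\ is_cder F x l, is_derive x 1 f k & normc l <= k]) ->
  normc (F t - F s) <= f t - f s.
Proof.
move=> st ACF ndf negE H.
suff main e : 0 < e -> normc (F t - F s) <= f t - f s + e * (t - s) + e.
  apply/ler_addgt0Pl => e e0.
  have k0 : 0 < t - s + 1 by lra.
  have /main : 0 < e / (t - s + 1) by rewrite divr_gt0.
  have -> : f t - f s + e / (t - s + 1) * (t - s) + e / (t - s + 1) = e + (f t - f s).
    by field; lra.
  by [].
move=> e0; have [d d0 Hd] := ACF e e0.
(* The end points join the exceptional set, because derivatives are given only strictly between
   them. *)
have negE' : mu.-negligible (E `|` [set s; t]).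
  apply: negligibleU => //; apply/negligibleP => //.
    by apply: measurableU; exact: measurable_set1.
  by apply: countable_lebesgue_measure0; apply: finite_set_countable.
have [U [oU EU Ud]] := negligible_open_cover negE' d0.
have : chained F f s e t U.
  apply: (segment_induction (P := fun x => chained F f s e x U) st).
    exists 0%N, (fun=> 0), (fun=> 0); split; first by split.
    by rewrite big_ord0 !subrr mulr0 normc0 !addr0.
  move=> x sx xt; have [Ux|nUx] := pselect (U x); first exact: chained_bad.
  have nE : ~ (E `|` [set s; t]) x by move=> /EU.
  have [| | |l [k [Fl fk lk]]] := H x.
  - by rewrite lt_neqAle sx andbT; apply/eqP => sx'; apply: nE; right; left.
  - by rewrite lt_neqAle xt andbT; apply/eqP => xt'; apply: nE; right; right.
  - by move=> Ex; apply: nE; left.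
  exact: (chained_good _ _ e0 Fl fk lk).
move=> [m [u [v [[uv dis uvU]]]]] /le_trans; apply.
rewrite lerD2l; apply/ltW/Hd.
- by move=> i; have [] := uv i (ltn_ord i).
- by move=> i j ij; apply: dis.
- apply: (sum_length_lt oU Ud).
  + by move=> i; have [] := uv i (ltn_ord i).
  + by move=> i j ij; apply: dis.
  + move=> i x /=; rewrite in_itv/= => /andP[h1 h2]; apply: (uvU i) => //=.
    by rewrite in_itv/= h2 ltW.
Qed.

(** * Closure properties of absolute continuity *)

Lemma lipschitz_abs_continuous (a b K : R) F :
  (forall s t, a <= s -> s <= t -> t <= b -> normc (F t - F s) <= K * (t - s)) ->
  abs_continuous_on a b F.
Proof.
move=> H e e0; pose K' := `|K| + 1.
have K'0 : 0 < K' by rewrite /K' ltr_wpDl.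
exists (e / K'); first by rewrite divr_gt0.
move=> m s t h1 h2 h3; apply: (@le_lt_trans _ _ (\sum_(i < m) K' * (t i - s i))).
  apply: ler_sum => i _; have [? [? ?]] := h1 i; apply: (le_trans (H _ _ _ _ _)) => //.
  by apply: ler_wpM2r; [lra|rewrite /K'; have := ler_norm K; lra].
by rewrite -mulr_sumr mulrC -ltr_pdivlMr.
Qed.

Lemma abs_continuous_bounded (a b : R) F : abs_continuous_on a b F ->
  exists K : R, forall x, a <= x -> x <= b -> normc (F x) <= K.
Proof.
move=> /(_ 1 ltr01)[d d0 Hd].
have step x y : a <= x -> x <= y -> y <= b -> y - x < d -> normc (F y - F x) < 1.
  move=> ax xy yb yx.
  have := Hd 1%N (fun=> x) (fun=> y); rewrite !big_ord1; apply => //.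
  by move=> i j; rewrite !ord1.
(* Each step of length [d / 2] changes the norm by at most 1. *)
have H n : forall x, a <= x -> x <= b -> x <= a + n%:R * (d / 2) ->
    normc (F x) <= normc (F a) + n%:R.
  elim: n => [|n IH] x ax xb.
    by rewrite mul0r !addr0 => xa; have -> : x = a by lra.
  rewrite -natr1 mulrDl mul1r => xn.
  have [h|h] := leP x (a + n%:R * (d / 2)).
    by apply: (le_trans (IH _ ax xb h)); lra.
  set y := a + n%:R * (d / 2) in h.
  have yn : a <= y by rewrite /y lerDl mulr_ge0//; lra.
  have -> : F x = (F x - F y) + F y by ring.
  apply: (le_trans (normcD _ _)).
  have h1 : normc (F y) <= normc (F a) + n%:R by apply: IH => //; lra.
  have h2 : normc (F x - F y) < 1 by apply: step => //; [lra|rewrite /y; lra].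
  lra.
pose n := Num.bound ((b - a) / (d / 2)); exists (normc (F a) + n%:R) => x ax xb.
apply: H => //; have d20 : 0 < d / 2 by lra.
have : (b - a) / (d / 2) < n%:R.
  by apply: archi_boundP; rewrite divr_ge0//; lra.
rewrite ltr_pdivrMr//; lra.
Qed.

Lemma abs_continuousD (a b : R) F G : abs_continuous_on a b F ->
  abs_continuous_on a b G -> abs_continuous_on a b (fun x => F x + G x).
Proof.
move=> HF HG e e0; have e20 : 0 < e / 2 by lra.
have [d d0 Hd] := HF _ e20; have [d' d'0 Hd'] := HG _ e20.
exists (Num.min d d'); first by rewrite lt_min d0.
move=> m s t h1 h2; rewrite lt_min => /andP[h3 h4].
have /= := Hd m s t h1 h2 h3; have /= := Hd' m s t h1 h2 h4.
set A := \sum_(_ < _) _; set B := \sum_(_ < _) _ => hA hB.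
apply: (@le_lt_trans _ _ (B + A)); last lra.
rewrite -big_split/=; apply: ler_sum => i _.
have -> : F (t i) + G (t i) - (F (s i) + G (s i)) =
  (F (t i) - F (s i)) + (G (t i) - G (s i)) by ring.
exact: normcD.
Qed.

Lemma abs_continuousM (a b : R) F G : abs_continuous_on a b F ->
  abs_continuous_on a b G -> abs_continuous_on a b (fun x => F x * G x).
Proof.
move=> HF HG e e0.
have [K0 HK0] := abs_continuous_bounded HF; have [L0 HL0] := abs_continuous_bounded HG.
pose K := `|K0| + 1; pose L := `|L0| + 1.
have K_gt0 : 0 < K by rewrite /K ltr_wpDl.
have L_gt0 : 0 < L by rewrite /L ltr_wpDl.
have HK x : a <= x -> x <= b -> normc (F x) <= K.
  by move=> ax xb; apply: (le_trans (HK0 x ax xb)); rewrite /K; have := ler_norm K0; lra.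
have HL x : a <= x -> x <= b -> normc (G x) <= L.
  by move=> ax xb; apply: (le_trans (HL0 x ax xb)); rewrite /L; have := ler_norm L0; lra.
have eL : 0 < e / 2 / L by rewrite divr_gt0//; lra.
have eK : 0 < e / 2 / K by rewrite divr_gt0//; lra.
have [d d0 Hd] := HF _ eL; have [d' d'0 Hd'] := HG _ eK.
exists (Num.min d d'); first by rewrite lt_min d0.
move=> m s t h1 h2; rewrite lt_min => /andP[h3 h4].
have /= := Hd m s t h1 h2 h3; have /= := Hd' m s t h1 h2 h4.
rewrite (ltr_pdivlMr _ _ K_gt0) (ltr_pdivlMr _ _ L_gt0) !mulr_suml.
set A := \sum_(_ < _) _; set B := \sum_(_ < _) _ => hA hB.
apply: (@le_lt_trans _ _ (B + A)); last lra.
rewrite -big_split/=; apply: ler_sum => i _; have [? [? ?]] := h1 i.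
have -> : F (t i) * G (t i) - (F (s i) * G (s i)) =
  (F (t i) - F (s i)) * G (t i) + (G (t i) - G (s i)) * F (s i) by ring.
apply: (le_trans (normcD _ _)); rewrite !normcM; apply: lerD; apply: ler_wpM2l;
  rewrite ?normc_ge0//; [apply: HL|apply: HK] => //; lra.
Qed.

Lemma abs_continuous_cst (a b : R) z : abs_continuous_on a b (fun=> z).
Proof.
apply: (@lipschitz_abs_continuous _ _ 0) => s t _ _ _.
by rewrite subrr normc0 mul0r.
Qed.

Lemma abs_continuous_ext (a b : R) F G : (forall x, a <= x -> x <= b -> F x = G x) ->
  abs_continuous_on a b F -> abs_continuous_on a b G.
Proof.
move=> FG H e /H[d d0 Hd]; exists d => // m s t h1 h2 h3.
have := Hd m s t h1 h2 h3; congr (_ < _); apply: eq_bigr => i _.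
by have [? [? ?]] := h1 i; rewrite !FG//; lra.
Qed.

(** The mean value theorem is applied to the real and the imaginary part separately, hence the
    factor 2. *)
Lemma is_cder_lipschitz (a b K : R) F G :
  (forall x, a <= x -> x <= b -> is_cder F x (G x)) ->
  (forall x, a <= x -> x <= b -> normc (G x) <= K) ->
  forall s t, a <= s -> s <= t -> t <= b -> normc (F t - F s) <= 2 * K * (t - s).
Proof.
move=> HF HG s t as_ st tb.
have mvt f g : (forall x, a <= x -> x <= b -> is_derive x 1 f (g x)) ->
    (forall x, a <= x -> x <= b -> `|g x| <= K) -> `|f t - f s| <= K * (t - s).
  move=> Hf Hg.
  have Hd x : x \in `]s, t[ -> is_derive x 1 f (g x).
    by rewrite in_itv/= => /andP[? ?]; apply: Hf; lra.
  have Hc : {within `[s, t], continuous f}.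
    apply: derivable_within_continuous => x; rewrite in_itv/= => /andP[? ?].
    by have [||] := Hf x => //; lra.
  have [c] := MVT_segment st Hd Hc.
  rewrite in_itv/= => /andP[? ?] ->; rewrite normrM (ger0_norm (x := t - s)); last lra.
  by apply: ler_wpM2r; [lra|apply: Hg; lra].
apply: (le_trans (normc_le_ReIm _)); rewrite ReB ImB.
have -> : 2 * K * (t - s) = K * (t - s) + K * (t - s) by ring.
apply: lerD.
  apply: (mvt (fun x => complex.Re (F x)) (fun x => complex.Re (G x))) => x ax xb.
    by have [] := HF x ax xb.
  exact: le_trans (Re_le_normc _) (HG x ax xb).
apply: (mvt (fun x => complex.Im (F x)) (fun x => complex.Im (G x))) => x ax xb.
  by have [] := HF x ax xb.
exact: le_trans (Im_le_normc _) (HG x ax xb).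
Qed.

Lemma is_cder_abs_continuous (a b K : R) F G :
  (forall x, a <= x -> x <= b -> is_cder F x (G x)) ->
  (forall x, a <= x -> x <= b -> normc (G x) <= K) -> abs_continuous_on a b F.
Proof. by move=> H H'; exact: (lipschitz_abs_continuous (is_cder_lipschitz H H')). Qed.

End GaugeArgument.

(** * Primitives *)

Section Primitive.
Context {R : realType}.
Implicit Types (F G : R -> R[i]) (f g : R -> R) (z w l : R[i]) (s t x e r : R).
Local Notation normc := (@Normc.normc R).
Local Notation mu := (@lebesgue_measure R).

(** The integrand is cut off outside []s, e]], so that the primitive continues past [e] as a
    constant and [e] has two-sided neighbourhoods. *)
Definition prim s e g x : R := \int[mu]_(y in `]s, x]) (g \_ `]s, e]) y.

Section prim_integrable.
Variables (s e : R) (g : R -> R).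
Hypothesis ig : mu.-integrable `]s, e] (EFin \o g).

Lemma patch_integrable (A : set R) : measurable A ->
  mu.-integrable A (EFin \o g \_ `]s, e]).
Proof.
move=> mA; rewrite -restrict_EFin; apply/integrable_restrict => //.
apply: integrableS ig => //.
by apply: measurableI => //; exact: measurable_itv.
Qed.

Lemma prim_derive : {ae mu, forall x, s < x -> x <= e -> is_derive x 1 (prim s e g) (g x)}.
Proof.
have H1 y : mu.-integrable [set` Interval (BRight s) (BRight y)] (EFin \o g \_ `]s, e]).
  by apply: patch_integrable; exact: measurable_itv.
have H2 : locally_integrable [set: R] (g \_ `]s, e]).
  by apply: integrable_locally_restrict => //; exact: measurable_itv.
have := FTC1 H1 H2; apply: filterS; first exact: (ae_filter_ringOfSetsType mu).
move=> x /= Hx sx xe.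
have [|d1 d2] := Hx; first by rewrite lte_fin.
split; first exact: d1.
move: d2; rewrite derive1E patchE mem_set//=; by rewrite in_itv/= sx xe.
Qed.

Lemma primB u v : s <= u -> u <= v ->
  prim s e g v - prim s e g u = \int[mu]_(y in `]u, v]) (g \_ `]s, e]) y.
Proof.
move=> su uv; rewrite /prim.
have /Rintegral_itvB /(_ _ _) : mu.-integrable `]s, v] (EFin \o g \_ `]s, e]).
  by apply: patch_integrable; exact: measurable_itv.
by apply; rewrite bnd_simp.
Qed.

Lemma prim_start : prim s e g s = 0.
Proof. by rewrite /prim set_itv_ge ?Rintegral_set0// bnd_simp ltxx. Qed.

Lemma prim_end : prim s e g e = \int[mu]_(y in `]s, e]) g y.
Proof.
rewrite /prim; apply: eq_Rintegral => x; rewrite inE /= => h.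
by rewrite patchE mem_set.
Qed.

Lemma prim_nondecreasing : (forall x, s < x -> x <= e -> 0 <= g x) ->
  forall u v, s <= u -> u <= v -> prim s e g u <= prim s e g v.
Proof.
move=> g0 u v su uv; rewrite -subr_ge0 primB//; apply: Rintegral_ge0 => x _.
rewrite patchE; case: ifPn => // /set_mem /=.
by rewrite in_itv/= => /andP[? ?]; exact: g0.
Qed.

End prim_integrable.

Lemma integrable_cst_itv a b (k : R) : mu.-integrable `]a, b] (fun=> k%:E).
Proof.
apply: measurable_bounded_integrable => //.
- have H : (@lebesgue_measure R `]a, b]%classic < +oo)%E.
    by rewrite lebesgue_measure_itv/=; case: ifP => // _; rewrite -EFinD ltry.
  exact: H.
- exact: bounded_cst.
Qed.

Lemma Rintegral_cst_itv a b (k : R) : a <= b -> \int[mu]_(x in `]a, b]) k = k * (b - a).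
Proof.
move=> ab; rewrite /Rintegral integral_cst//= lebesgue_measure_itv/=.
case: ltP; first by rewrite -EFinD.
rewrite lee_fin => ba; have -> : a = b by lra.
by rewrite subrr mulr0 mule0.
Qed.

Lemma integrable_of_sqr s e g : measurable_fun `]s, e] g ->
  mu.-integrable `]s, e] (EFin \o (fun x => g x ^+ 2)) ->
  mu.-integrable `]s, e] (EFin \o g).
Proof.
move=> mg ig2.
have ig1 : mu.-integrable `]s, e] (EFin \o (fun x => 1 + g x ^+ 2)).
  have -> : EFin \o (fun x => 1 + g x ^+ 2) =
      ((fun=> 1%:E) \+ (EFin \o (fun x => g x ^+ 2)%R))%E by apply/funext.
  by apply: integrableD => //; exact: integrable_cst_itv.
apply: le_integrable ig1 => //; first exact/measurable_EFinP.
move=> x _ /=; rewrite lee_fin [leRHS]ger0_norm ?addr_ge0 ?sqr_ge0//.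
have : 0 <= (`|g x| - 1) ^+ 2 by exact: sqr_ge0.
by rewrite sqrrB real_normK ?num_real// expr1n mulr1 -mulr_natr; have := normr_ge0 (g x); lra.
Qed.

(* AM-GM trades the integral of |g| for small multiples of that of g^2 and of
   the length. *)
Lemma prim_increment_le s e g (k : R) u v : measurable_fun `]s, e] g ->
  mu.-integrable `]s, e] (EFin \o (fun x => g x ^+ 2)) -> 0 < k ->
  s <= u -> u <= v ->
  `|prim s e g v - prim s e g u| <=
    k / 2 * (prim s e (fun x => g x ^+ 2) v - prim s e (fun x => g x ^+ 2) u)
    + (v - u) / (2 * k).
Proof.
move=> mg ig2 k0 su uv; have ig := integrable_of_sqr mg ig2.
have mI : measurable (`]u, v] : set R) by exact: measurable_itv.
have i1 := patch_integrable ig mI.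
have i2 := patch_integrable ig2 mI.
rewrite !primB//; apply: (le_trans (le_normr_Rintegral _ _)) => //.
have -> : (v - u) / (2 * k) = (2 * k)^-1 * (v - u) by rewrite mulrC.
rewrite -Rintegral_cst_itv// -RintegralZl// -RintegralD//; last 2 first.
- have -> : EFin \o (fun x => k / 2 * ((fun y => g y ^+ 2) \_ `]s, e]) x) =
     (fun x => (k / 2)%:E * (EFin \o ((fun y => (g y ^+ 2)%R) \_ `]s, e])) x)%E by apply/funext.
  exact: integrableZl.
- exact: integrable_cst_itv.
apply: le_Rintegral => //.
- exact: integrable_norm.
- have -> : EFin \o (fun x => k / 2 * ((fun y => g y ^+ 2) \_ `]s, e]) x + (2 * k)^-1) =
     ((fun x => (k / 2)%:E * (EFin \o ((fun y => (g y ^+ 2)%R) \_ `]s, e])) x) \+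
       (fun=> ((2 * k)^-1)%:E))%E by apply/funext.
  by apply: integrableD => //; [exact: integrableZl|exact: integrable_cst_itv].
- move=> x _; rewrite !patchE; case: ifPn => _.
    have : 0 <= (k * `|g x| - 1) ^+ 2 / (2 * k).
      by rewrite divr_ge0 ?sqr_ge0//; lra.
    rewrite sqrrB exprMn real_normK ?num_real// expr1n mulr1.
    have -> : (k ^+ 2 * g x ^+ 2 - k * `|g x| *+ 2 + 1) / (2 * k) =
      k / 2 * g x ^+ 2 + (2 * k)^-1 - `|g x| by rewrite -mulr_natr; field; lra.
    lra.
  by rewrite normr0 mulr0 add0r invr_ge0; lra.
Qed.

Lemma abs_continuous_real f a b : (forall e, 0 < e -> exists2 d, 0 < d &
    forall (m : nat) (u v : 'I_m -> R),
      (forall i, a <= u i /\ u i <= v i /\ v i <= b) ->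
      (forall i j, i != j -> v i <= u j \/ v j <= u i) ->
      \sum_(i < m) (v i - u i) < d ->
      \sum_(i < m) `|f (v i) - f (u i)| < e) ->
  abs_continuous_on a b (fun x => (f x)%:C).
Proof.
move=> H e /H[d d0 Hd]; exists d => // m u v h1 h2 h3.
apply: le_lt_trans (Hd m u v h1 h2 h3); apply: ler_sum => i _.
by rewrite -rmorphB normc_real.
Qed.

Lemma sum_prim_increment_le s e g m (u v : 'I_m -> R) :
  mu.-integrable `]s, e] (EFin \o g) -> (forall x, s < x -> x <= e -> 0 <= g x) ->
  (forall i, s <= u i /\ u i <= v i) ->
  (forall i j, i != j -> v i <= u j \/ v j <= u i) ->
  \sum_(i < m) (prim s e g (v i) - prim s e g (u i)) <= \int[mu]_(x in `]s, e]) g x.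
Proof.
move=> ig g0 uv dis.
(* The points [v i] may lie beyond [e], so the intervals are compared with []s, +oo[], on which the
   cut-off integrand has the same integral. *)
have -> : \int[mu]_(x in `]s, e]) g x = \int[mu]_(x in `]s, +oo[) (g \_ `]s, e]) x.
  rewrite [RHS]Rintegral_mkcond [LHS]Rintegral_mkcond; apply: eq_Rintegral => x _.
  rewrite !patchE; case: ifPn => xse; case: ifPn => // /negP[].
  rewrite inE/= in_itv/= andbT; move: xse; rewrite inE/= in_itv/=.
  by case/andP.
have g0' x : 0 <= (g \_ `]s, e]) x.
  rewrite patchE; case: ifPn => // /set_mem /=.
  by rewrite in_itv/= => /andP[? ?]; exact: g0.
have ip : mu.-integrable `]s, +oo[ (EFin \o g \_ `]s, e]).
  by apply: patch_integrable => //; exact: measurable_itv.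
rewrite -lee_fin /Rintegral fineK; last exact: integrable_fin_num.
have -> : \sum_(i < m) (prim s e g (v i) - prim s e g (u i)) =
  \sum_(i < m) \int[mu]_(x in `]u i, v i]) (g \_ `]s, e]) x.
  by apply: eq_bigr => i _; have [? ?] := uv i; rewrite primB.
rewrite -sumEFin.
apply: le_trans (sum_integral_nonoverlap (D := `]s, +oo[) (u := u) (v := v) _ _ _ _ _) => //.
- apply: lee_sum => i _; rewrite /Rintegral fineK//.
  by apply: integrable_fin_num => //; apply: patch_integrable => //; exact: measurable_itv.
- by have /integrableP[/measurable_EFinP] := ip.
- move=> i x /=; rewrite !in_itv/= andbT => /andP[ux _]; have [? ?] := uv i; lra.
Qed.

Lemma prim_abs_continuous s e g a b : measurable_fun `]s, e] g ->
  mu.-integrable `]s, e] (EFin \o (fun x => g x ^+ 2)) -> s <= a ->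
  abs_continuous_on a b (fun x => (prim s e g x)%:C).
Proof.
move=> mg ig2 sa; apply: abs_continuous_real => eps eps0.
pose q := \int[mu]_(x in `]s, e]) g x ^+ 2.
have q0 : 0 <= q by apply: Rintegral_ge0 => x _; exact: sqr_ge0.
(* With lengths summing below [eps * k], each of the two terms of [prim_increment_le] sums to at
   most [eps / 2]: the first because q / (q + 1) <= 1, the second because [k] cancels. *)
pose k := eps / (q + 1); have k0 : 0 < k by rewrite divr_gt0//; lra.
exists (eps * k); first by rewrite mulr_gt0.
move=> m u v h1 h2 h3.
apply: (@le_lt_trans _ _ (\sum_(i < m) (k / 2 * (prim s e (fun x => g x ^+ 2) (v i)
   - prim s e (fun x => g x ^+ 2) (u i)) + (v i - u i) / (2 * k)))).
  apply: ler_sum => i _; have [? [? ?]] := h1 i.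
  by apply: prim_increment_le => //; lra.
rewrite big_split/= -mulr_sumr -mulr_suml.
have H : \sum_(i < m) (prim s e (fun x => g x ^+ 2) (v i) -
    prim s e (fun x => g x ^+ 2) (u i)) <= q.
  apply: sum_prim_increment_le => // [x _ _|i]; first exact: sqr_ge0.
  by have [? [? ?]] := h1 i; split => //; lra.
apply: (@le_lt_trans _ _ (k / 2 * q + (\sum_(i < m) (v i - u i)) / (2 * k))).
  by rewrite lerD2r; apply: ler_wpM2l => //; lra.
have h4 : (\sum_(i < m) (v i - u i)) / (2 * k) < eps / 2.
  rewrite ltr_pdivrMr; last lra.
  by apply: lt_le_trans h3 _; rewrite le_eqVlt; apply/orP; left; apply/eqP; field.
have h5 : k / 2 * q <= eps / 2.
  have -> : k / 2 * q = eps / 2 * (q / (q + 1)) by rewrite /k; field; lra.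
  rewrite ger_pMr; last lra.
  by rewrite ler_pdivrMr; lra.
move: h4; set S := _ / (2 * k); lra.
Qed.

(** A Cauchy-Schwarz inequality for the increment. For every [k] the function [I] has derivative
    [k / 2 * Q x + (2 * k)^-1], which dominates the norm of F' by the inequality of arithmetic and
    geometric means; [k] is chosen at the end. *)
Lemma cell_increment_le s e F (Q : R -> R) : s < e ->
  (forall a b, s < a -> a <= b -> b < e -> abs_continuous_on a b F) ->
  mu.-integrable `]s, e] (EFin \o Q) -> (forall x, 0 <= Q x) ->
  {ae mu, forall x, s < x -> x < e -> exists2 l, is_cder F x l & normc l ^+ 2 <= Q x} ->
  forall a b, s < a -> a <= b -> b < e ->
    normc (F b - F a) ^+ 2 <= (e - s) * \int[mu]_(x in `]s, e]) Q x.
Proof.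
move=> se ACF iQ Q0 HF a b sa ab be; set q := Rintegral _ _ _.
have q0 : 0 <= q by exact: Rintegral_ge0.
set D := normc _; have D0 : 0 <= D by exact: normc_ge0.
have main k : 0 < k -> D <= k / 2 * q + (e - s) / (2 * k).
  move=> k0.
  pose I x := k / 2 * prim s e Q x + x / (2 * k).
  have nd := prim_nondecreasing iQ (fun x _ _ => Q0 x).
  have ndI u v : a <= u -> u <= v -> I u <= I v.
    move=> au uv; rewrite /I lerD//; first by rewrite ler_wpM2l ?divr_ge0 ?nd//; lra.
    by rewrite ler_pM2r// invr_gt0; lra.
  have [E [negE HE]] : exists E, mu.-negligible E /\ forall x, s < x -> x < e -> ~ E x ->
      is_derive x 1 (prim s e Q) (Q x) /\ exists2 l, is_cder F x l & normc l ^+ 2 <= Q x.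
    have H1 := prim_derive iQ.
    exists (~` [set x | s < x -> x <= e -> is_derive x 1 (prim s e Q) (Q x)] `|`
      ~` [set x | s < x -> x < e -> exists2 l, is_cder F x l & normc l ^+ 2 <= Q x]).
    split; first exact: negligibleU.
    move=> x sx xe /not_orP[/contrapT h1 /contrapT h2].
    by split; [apply: h1 => //; exact: ltW|exact: h2].
  have HD x : a < x -> x < b -> ~ E x -> exists l k',
      [/\ is_cder F x l, is_derive x 1 I k' & normc l <= k'].
    move=> ax xb nE.
    have [||dQ [l Fl lQ]] := HE x _ _ nE; [lra|lra|].
    exists l, (k / 2 * Q x + (2 * k)^-1); split=> //.
      have dI : is_derive x 1 (k / 2 \*: prim s e Q + (2 * k)^-1 \*: (id : R -> R))
          (k / 2 *: Q x + (2 * k)^-1 *: (1 : R)) by apply: is_deriveD.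
      have -> : I = k / 2 \*: prim s e Q + (2 * k)^-1 \*: (id : R -> R).
        by apply/funext => y; rewrite /I [y / _]mulrC.
      by apply: is_derive_eq dI _; rewrite /GRing.scale /= mulr1.
    have : 0 <= (k * normc l - 1) ^+ 2 / (2 * k).
      by rewrite divr_ge0 ?sqr_ge0//; lra.
    have -> : (k * normc l - 1) ^+ 2 / (2 * k) = k / 2 * normc l ^+ 2 + (2 * k)^-1 - normc l.
      by field; lra.
    have : k / 2 * normc l ^+ 2 <= k / 2 * Q x by apply: ler_wpM2l => //; lra.
    lra.
  apply: (le_trans (abs_continuous_increment_le ab (ACF _ _ sa ab be) ndI negE HD)).
  rewrite /I.
  have -> : k / 2 * prim s e Q b + b / (2 * k) - (k / 2 * prim s e Q a + a / (2 * k)) =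
    k / 2 * (prim s e Q b - prim s e Q a) + (b - a) / (2 * k) by field; lra.
  apply: lerD; last by rewrite ler_pM2r ?invr_gt0; lra.
  apply: ler_wpM2l; first lra.
  have -> : q = prim s e Q e - prim s e Q s by rewrite prim_start prim_end// subr0.
  by apply: lerB; apply: nd; lra.
have [->|D1] := eqVneq D 0.
  by rewrite expr0n mulr_ge0//; lra.
have D2 : 0 < D by rewrite lt_def D1.
have L0 : 0 < e - s by lra.
(* This value of [k] turns the term with [2 * k] in the denominator into half of [D], which is then
   absorbed on the left. *)
have := main ((e - s) / D); rewrite divr_gt0// => /(_ isT).
have -> : (e - s) / (2 * ((e - s) / D)) = D / 2 by field; lra.
move=> h; have h1 : D / 2 <= (e - s) / D / 2 * q by lra.
have : D / 2 * (2 * D) <= (e - s) / D / 2 * q * (2 * D) by rewrite ler_pM2r//; lra.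
have -> : D / 2 * (2 * D) = D ^+ 2 by field.
by have -> : (e - s) / D / 2 * q * (2 * D) = (e - s) * q by field.
Qed.

(** * Complex-valued primitives *)

Definition cprim s e (G : R -> R[i]) x : R[i] :=
  prim s e (fun y => complex.Re (G y)) x +i* prim s e (fun y => complex.Im (G y)) x.

Definition sq_integrable s e (G : R -> R[i]) :=
  [/\ measurable_fun `]s, e] (fun y => complex.Re (G y)),
      measurable_fun `]s, e] (fun y => complex.Im (G y)) &
      mu.-integrable `]s, e] (EFin \o (fun y => normc (G y) ^+ 2))].

Lemma sq_integrable_ReIm s e G : sq_integrable s e G ->
  mu.-integrable `]s, e] (EFin \o (fun y => complex.Re (G y) ^+ 2)) /\
  mu.-integrable `]s, e] (EFin \o (fun y => complex.Im (G y) ^+ 2)).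
Proof.
move=> [m1 m2 i]; split; apply: le_integrable i => //.
- by apply/measurable_EFinP; exact: measurable_funX.
- move=> x _ /=; rewrite lee_fin !ger0_norm ?sqr_ge0// sqr_normcE lerDl sqr_ge0//.
- by apply/measurable_EFinP; exact: measurable_funX.
- move=> x _ /=; rewrite lee_fin !ger0_norm ?sqr_ge0// sqr_normcE lerDr sqr_ge0//.
Qed.

Lemma cprim_start s e G : cprim s e G s = 0.
Proof. by rewrite /cprim !prim_start. Qed.

Lemma cprim_derive s e G : sq_integrable s e G ->
  {ae mu, forall x, s < x -> x <= e -> is_cder (cprim s e G) x (G x)}.
Proof.
move=> sG; have [i1 i2] := sq_integrable_ReIm sG; have [m1 m2 _] := sG.
have H1 := prim_derive (integrable_of_sqr m1 i1).
have H2 := prim_derive (integrable_of_sqr m2 i2).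
move: H1 H2; apply: filterS2; first exact: (ae_filter_ringOfSetsType mu).
by move=> x h1 h2 sx xe; split; [exact: h1|exact: h2].
Qed.

Lemma cprim_abs_continuous s e G a b : sq_integrable s e G -> s <= a ->
  abs_continuous_on a b (cprim s e G).
Proof.
move=> sG sa; have [i1 i2] := sq_integrable_ReIm sG; have [m1 m2 _] := sG.
have H1 := prim_abs_continuous b m1 i1 sa.
have H2 := prim_abs_continuous b m2 i2 sa.
apply: abs_continuous_ext (abs_continuousD H1
  (abs_continuousM (@abs_continuous_cst R a b 'i) H2)).
move=> x _ _; rewrite /cprim; apply: complexP.
  by rewrite ReD ReM /= mul0r mulr0 subr0 addr0.
by rewrite ImD ImM /= mul0r mul1r !add0r.
Qed.

Lemma abs_continuous_cvg_right F a b : a < b -> abs_continuous_on a b F ->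
  cvgC a^'+ F (F a).
Proof.
move=> ab ACF; apply/cvgC_rightP => eps /ACF[d d0 Hd].
exists (Num.min d (b - a)); first by rewrite lt_min d0 subr_gt0.
move=> x ax; rewrite -ltrBlDl lt_min => /andP[h1 h2].
have := Hd 1%N (fun=> a) (fun=> x); rewrite !big_ord1 => H; apply/ltW/H => //.
  by move=> i {H Hd}; split => //; split; lra.
by move=> i j; rewrite !ord1.
Qed.

Lemma abs_continuous_cvg F a b x : a < x -> x < b -> abs_continuous_on a b F ->
  cvgC (nbhs x) F (F x).
Proof.
move=> ax xb ACF; apply/cvgC_nbhsP => eps /ACF[d d0 Hd].
exists (Num.min d (Num.min (x - a) (b - x))).
  by rewrite !lt_min d0 !subr_gt0 ax.
move=> y; rewrite !lt_min => /and3P[h1 h2 h3].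
have [yx|xy] := leP y x.
  have := Hd 1%N (fun=> y) (fun=> x); rewrite !big_ord1 normcBC => H; apply/ltW/H => //.
  - by move=> i {H Hd}; split => //; move: h2; rewrite ltr_norml; lra.
  - by move=> i j; rewrite !ord1.
  - by move: h1 {H Hd}; rewrite ltr_norml; lra.
have := Hd 1%N (fun=> x) (fun=> y); rewrite !big_ord1 => H; apply/ltW/H => //.
- by move=> i {H Hd}; split => //; move: h3; rewrite ltr_norml; lra.
- by move=> i j; rewrite !ord1.
- by move: h1 {H Hd}; rewrite ltr_norml; lra.
Qed.

End Primitive.

(** * Fundamental solutions *)

Section FundamentalSolutions.
Context {R : realType}.
Implicit Types (F G : R -> R[i]) (z w k : R[i]) (t x d : R).
Local Notation normc := (@Normc.normc R).
Local Notation mu := (@lebesgue_measure R).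

Lemma ReMr k t : complex.Re (k * t%:C) = complex.Re k * t.
Proof. by case: k => a b; rewrite ReM /= mulr0 subr0. Qed.

Lemma ImMr k t : complex.Im (k * t%:C) = complex.Im k * t.
Proof. by case: k => a b; rewrite ImM /= mulr0 add0r. Qed.

Lemma cexpE w : cexp w = (expR (complex.Re w) * cos (complex.Im w)) +i*
  (expR (complex.Re w) * sin (complex.Im w)).
Proof. by case: w. Qed.

Lemma is_derive_expRM (a t : R) : is_derive t 1 (fun x => expR (a * x)) (a * expR (a * t)).
Proof.
have H : is_derive t 1 (fun x : R => a * x) a.
  have -> : (fun x : R => a * x) = a \*: (id : R -> R) by [].
  by apply: is_derive_eq; rewrite /GRing.scale /= mulr1.
by rewrite mulrC; exact: (is_derive1_comp (f := expR)).
Qed.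

Lemma is_derive_cosM (a t : R) : is_derive t 1 (fun x => cos (a * x)) (- a * sin (a * t)).
Proof.
have H : is_derive t 1 (fun x : R => a * x) a.
  have -> : (fun x : R => a * x) = a \*: (id : R -> R) by [].
  by apply: is_derive_eq; rewrite /GRing.scale /= mulr1.
rewrite mulNr mulrC -mulNr; exact: (is_derive1_comp (f := cos)).
Qed.

Lemma is_derive_sinM (a t : R) : is_derive t 1 (fun x => sin (a * x)) (a * cos (a * t)).
Proof.
have H : is_derive t 1 (fun x : R => a * x) a.
  have -> : (fun x : R => a * x) = a \*: (id : R -> R) by [].
  by apply: is_derive_eq; rewrite /GRing.scale /= mulr1.
by rewrite mulrC; exact: (is_derive1_comp (f := sin)).
Qed.

Lemma is_cder_cexpM k t : is_cder (fun x => cexp (k * x%:C)) t (k * cexp (k * t%:C)).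
Proof.
have HE := is_derive_expRM (complex.Re k) t.
have HC := is_derive_cosM (complex.Im k) t.
have HS := is_derive_sinM (complex.Im k) t.
split.
  have -> : (fun x => complex.Re (cexp (k * x%:C))) =
     (fun x => expR (complex.Re k * x)) * (fun x => cos (complex.Im k * x)).
    by apply/funext => x; rewrite cexpE ReMr ImMr.
  apply: is_derive_eq (is_deriveM HE HC) _.
  rewrite cexpE ReMr ImMr ReM /= /GRing.scale /=; ring.
have -> : (fun x => complex.Im (cexp (k * x%:C))) =
   (fun x => expR (complex.Re k * x)) * (fun x => sin (complex.Im k * x)).
  by apply/funext => x; rewrite cexpE ReMr ImMr.
apply: is_derive_eq (is_deriveM HE HS) _.
rewrite cexpE ReMr ImMr ImM /= /GRing.scale /=; ring.
Qed.

Lemma cexpD z w : cexp (z + w) = cexp z * cexp w.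
Proof.
rewrite !cexpE ReD ImD expRD cosD sinD; apply: complexP; rewrite ?ReM ?ImM /=; ring.
Qed.

Lemma cexp0 : cexp 0 = 1 :> R[i].
Proof. by rewrite cexpE /= expR0 cos0 sin0 mulr1 mulr0. Qed.

Lemma cexpNM z : cexp z * cexp (- z) = 1.
Proof. by rewrite -cexpD subrr cexp0. Qed.

Lemma iM : ('i : R[i]) * 'i = -1.
Proof. by rewrite -expr2 sqr_i. Qed.

Lemma i_neq0 : ('i : R[i]) != 0.
Proof. by rewrite eq_complex /= oner_eq0 andbF. Qed.

Lemma is_cder_ccosM k t : is_cder (fun x => ccos (k * x%:C)) t (- (k * csin (k * t%:C))).
Proof.
have H1 := is_cder_cexpM ('i * k) t; have H2 := is_cder_cexpM (- ('i * k)) t.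
apply: is_cder_eq (is_cder_ext _ (is_cderZ (2^-1) (is_cderD H1 H2))) _.
  by move=> x; rewrite /ccos mulrC mulrA mulNr.
rewrite /csin !mulNr -!mulrA; set a := cexp _; set b := cexp _.
have -> : (2 * 'i : R[i])^-1 = - 'i / 2.
  have := i_neq0 => i0; rewrite invfM; rewrite [LHS]mulrC; congr (_ * _).
  by apply: (mulIf i0); rewrite mulVf// mulNr iM opprK.
ring.
Qed.

Lemma is_cder_csinM k t : is_cder (fun x => csin (k * x%:C)) t (k * ccos (k * t%:C)).
Proof.
have H1 := is_cder_cexpM ('i * k) t; have H2 := is_cder_cexpM (- ('i * k)) t.
apply: is_cder_eq (is_cder_ext _ (is_cderZ ((2 * 'i)^-1) (is_cderB H1 H2))) _.
  by move=> x; rewrite /csin mulrC mulrA mulNr.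
rewrite /ccos; have := i_neq0 => i0; rewrite !mulNr !mulrA; field.
by rewrite i0.
Qed.

Definition Cz z t : R[i] := ccos (sqrtC z * t%:C).

(** With [Cz] this is the fundamental system of -f'' = z f at 0. The value at a vanishing root is
    the limit of sin(k t) / k as k tends to 0. *)
Definition Sz z t : R[i] :=
  if sqrtC z == 0 then t%:C else csin (sqrtC z * t%:C) / sqrtC z.

Lemma csin0 : csin 0 = 0 :> R[i].
Proof. by rewrite /csin mulr0 oppr0 subrr mul0r. Qed.

Lemma ccos0 : ccos 0 = 1 :> R[i].
Proof. by rewrite /ccos mulr0 oppr0 cexp0 -mulr2n -[_ *+ 2]mulr_natl divff ?mulr1 ?pnatr_eq0. Qed.

Lemma is_cder_Cz z t : is_cder (Cz z) t (- z * Sz z t).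
Proof.
apply: is_cder_eq (is_cder_ccosM _ _) _; rewrite /Sz.
have -> : - z = - (sqrtC z * sqrtC z) by rewrite -expr2 sqrtCK.
case: eqVneq => [->|k0]; first by rewrite !mul0r oppr0 mul0r.
by rewrite mulNr; congr (- _); field.
Qed.

Lemma is_cder_Sz z t : is_cder (Sz z) t (Cz z t).
Proof.
rewrite /Sz /Cz; case: eqVneq => [->|k0].
  by rewrite mul0r ccos0; exact: is_cder_id.
have := is_cderZ (sqrtC z)^-1 (is_cder_csinM (sqrtC z) t).
rewrite mulrA mulVf// mul1r; apply: is_cder_ext => x.
by rewrite mulrC.
Qed.

Lemma Cz0 z : Cz z 0 = 1.
Proof. by rewrite /Cz mulr0 ccos0. Qed.

Lemma Sz0 z : Sz z 0 = 0.
Proof. by rewrite /Sz mulr0 csin0 mul0r; case: ifP. Qed.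

Lemma ccsin_sqr z : ccos z ^+ 2 + csin z ^+ 2 = 1.
Proof.
rewrite /ccos /csin; set a := cexp _; set b := cexp _.
have ab : a * b = 1 by exact: cexpNM.
have i2 : (2 * 'i : R[i]) ^+ 2 = - 4.
  by rewrite exprMn expr2 expr2 iM mulrN1 -natrM.
rewrite !expr_div_n i2.
have -> : (a + b) ^+ 2 / 2 ^+ 2 + (a - b) ^+ 2 / -4 = a * b by field.
by [].
Qed.

(** The left side is the Wronskian of [Cz] and [Sz]: propagation over any length has determinant 1,
    so data can also be carried backwards. *)
Lemma CSz_sqr z t : Cz z t ^+ 2 + z * Sz z t ^+ 2 = 1.
Proof.
rewrite -[RHS](ccsin_sqr (sqrtC z * t%:C)) /Cz /Sz; congr (_ + _).
have -> : z * (if sqrtC z == 0 then t%:C else csin (sqrtC z * t%:C) / sqrtC z) ^+ 2 =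
   sqrtC z ^+ 2 * (if sqrtC z == 0 then t%:C else csin (sqrtC z * t%:C) / sqrtC z) ^+ 2.
  by rewrite sqrtCK.
case: eqVneq => [->|k0].
  by rewrite expr0n !mul0r csin0 expr0n.
by field.
Qed.

(** The case distinctions at a vanishing root in [discriminant] and in [Sz] agree, which leaves one
    formula for all [z]. *)
Lemma discriminantE d (a0 : R) z :
  discriminant d a0 (sqrtC z) = Cz z d + a0%:C * Sz z d / 2.
Proof.
rewrite /discriminant /Cz /Sz; case: eqVneq => [->|k0].
  rewrite mul0r ccos0 rmorphD rmorph1 rmorphM/= rmorphM/= fmorphV/=.
  by rewrite rmorph_nat.
congr (_ + _); field.
by rewrite k0.
Qed.

Lemma is_cder_bounded F G (a b : R) : (forall x, is_cder F x (G x)) ->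
  exists2 K : R, 0 <= K & forall x, a <= x -> x <= b -> normc (F x) <= K.
Proof.
move=> H; have [ab|ba] := leP a b; last first.
  by exists 0 => // x ax xb; lra.
have cont (f g : R -> R) : (forall x : R, is_derive x 1 f (g x)) ->
    exists2 K : R, 0 <= K & forall x, a <= x -> x <= b -> `|f x| <= K.
  move=> Hf.
  have cf : {within `[a, b], continuous f}.
    by apply: derivable_within_continuous => x _; have [] := Hf x.
  have [c1 c1ab Hc1] := EVT_max ab cf; have [c2 c2ab Hc2] := EVT_min ab cf.
  exists (`|f c1| + `|f c2|); first by rewrite addr_ge0.
  move=> x ax xb; have xab : x \in `[a, b] by rewrite in_itv/= ax.
  have h1 := Hc1 x xab; have h2 := Hc2 x xab.
  have h3 := ler_norm (f c1); have h4 : - f c2 <= `|f c2| by rewrite lerNl lerNnormlW.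
  have h5 := normr_ge0 (f c1); have h6 := normr_ge0 (f c2).
  rewrite ler_norml; lra.
have [K1 K10 HK1] := cont _ _ (fun x => (H x).1).
have [K2 K20 HK2] := cont _ _ (fun x => (H x).2).
exists (K1 + K2); first by rewrite addr_ge0.
move=> x ax xb; apply: (le_trans (normc_le_ReIm _)).
by apply: lerD; [exact: HK1|exact: HK2].
Qed.

Lemma CSz_bounded z (L : R) : exists2 K : R, 1 <= K &
  forall t, 0 <= t -> t <= L -> normc (Cz z t) <= K /\ normc (Sz z t) <= K.
Proof.
have [K1 K10 H1] := is_cder_bounded 0 L (is_cder_Cz z).
have [K2 K20 H2] := is_cder_bounded 0 L (is_cder_Sz z).
exists (1 + K1 + K2); first lra.
move=> t t0 tL; split.
  by apply: (le_trans (H1 _ t0 tL)); lra.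
by apply: (le_trans (H2 _ t0 tL)); lra.
Qed.

End FundamentalSolutions.

(** * Solutions on one cell *)

Section CellSolutions.
Context {R : realType}.
Implicit Types (F G f h g p : R -> R[i]) (z w k v u : R[i]) (s e t x d : R).
Local Notation normc := (@Normc.normc R).
Local Notation mu := (@lebesgue_measure R).

Definition energy s e f : R := \int[mu]_(x in `]s, e]) normc (f x) ^+ 2.

Lemma energy_ge0 s e f : 0 <= energy s e f.
Proof. by apply: Rintegral_ge0 => x _; rewrite sqr_ge0. Qed.

(** The equation -f'' = h on the open cell. The derivative [f1] of [f] exists everywhere there; only
    the derivative of [f1] is restricted to almost every point. *)
Definition cellsol s e f f1 h :=
  [/\ forall x, s < x -> x < e -> is_cder f x (f1 x),
      forall a b, s < a -> a <= b -> b < e -> abs_continuous_on a b f1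
    & {ae mu, forall x, s < x -> x < e -> is_cder f1 x (- h x)}].

Lemma cellsol_abs_continuous s e f f1 h : cellsol s e f f1 h ->
  forall a b, s < a -> a <= b -> b < e -> abs_continuous_on a b f.
Proof.
move=> [Hf Hf1 _] a b sa ab be; have [K HK] := abs_continuous_bounded (Hf1 _ _ sa ab be).
by apply: (is_cder_abs_continuous (G := f1) (K := K)) => x ax xb; [apply: Hf; lra|exact: HK].
Qed.

(* Green's formula for the pair (p, f), whose derivative is p'' f + p h. *)
Lemma cell_green s e f f1 h p p1 p2 p3 (Q : R -> R) : s < e -> cellsol s e f f1 h ->
  (forall x, is_cder p x (p1 x)) -> (forall x, is_cder p1 x (p2 x)) ->
  (forall x, is_cder p2 x (p3 x)) ->
  mu.-integrable `]s, e] (EFin \o Q) -> (forall x, 0 <= Q x) ->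
  (forall x, s < x -> x < e -> normc (p2 x * f x + p x * h x) ^+ 2 <= Q x) ->
  forall a b, s < a -> a <= b -> b < e ->
  normc ((p1 b * f b - p b * f1 b) - (p1 a * f a - p a * f1 a)) ^+ 2
    <= (e - s) * \int[mu]_(x in `]s, e]) Q x.
Proof.
move=> se sol Hp Hp1 Hp2 iQ Q0 HQ a b sa ab be.
have ACf := cellsol_abs_continuous sol; case: sol => Hf ACf1 Hf1.
apply: (cell_increment_le (F := fun x => p1 x * f x - p x * f1 x) (Q := Q)) => //.
- move=> a' b' sa' ab' be'.
  have [K _ HK] := is_cder_bounded a' b' Hp1.
  have [K1 _ HK1] := is_cder_bounded a' b' Hp2.
  have ACp : abs_continuous_on a' b' p.
    by apply: (is_cder_abs_continuous (G := p1) (K := K)) => x ? ?; [exact: Hp|exact: HK].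
  have ACp1 : abs_continuous_on a' b' p1.
    by apply: (is_cder_abs_continuous (G := p2) (K := K1)) => x ? ?; [exact: Hp1|exact: HK1].
  have E x : p1 x * f x - p x * f1 x = p1 x * f x + (-1) * (p x * f1 x) by ring.
  apply: (abs_continuous_ext (fun x _ _ => esym (E x))).
  apply: abs_continuousD; first by apply: abs_continuousM => //; exact: ACf.
  apply: abs_continuousM; first exact: abs_continuous_cst.
  by apply: abs_continuousM => //; exact: ACf1.
- apply: filterS Hf1; first exact: (ae_filter_ringOfSetsType mu).
  move=> x /= H sx xe; exists (p2 x * f x + p x * h x); last exact: HQ.
  apply: is_cder_eq (is_cderB (is_cderM (Hp1 x) (Hf x sx xe)) (is_cderM (Hp x) (H sx xe))) _.
  ring.
Qed.

Lemma sqr_normc_le_sqrt w (K : R) : 0 <= K -> normc w ^+ 2 <= K -> normc w <= Num.sqrt K.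
Proof. by move=> K0 H; rewrite -(ger0_norm (normc_ge0 w)) -sqrtr_sqr ler_sqrt. Qed.

Lemma sqrt_le_sqr_normc w (K : R) : 0 <= K -> normc w <= Num.sqrt K -> normc w ^+ 2 <= K.
Proof.
move=> K0 H; rewrite -(sqr_sqrtr K0).
by rewrite ler_sqr ?nnegrE ?normc_ge0 ?sqrtr_ge0.
Qed.

(** The interior inequality with its left point moved to [s], where only one-sided limits of the
    data exist. *)
Lemma cell_green_start s e f f1 h p p1 p2 p3 (Q : R -> R) v1 v2 : s < e -> cellsol s e f f1 h ->
  (forall x, is_cder p x (p1 x)) -> (forall x, is_cder p1 x (p2 x)) ->
  (forall x, is_cder p2 x (p3 x)) ->
  mu.-integrable `]s, e] (EFin \o Q) -> (forall x, 0 <= Q x) ->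
  (forall x, s < x -> x < e -> normc (p2 x * f x + p x * h x) ^+ 2 <= Q x) ->
  cvgC s^'+ f v1 -> cvgC s^'+ f1 v2 ->
  forall b, s < b -> b < e ->
  normc ((p1 b * f b - p b * f1 b) - (p1 s * v1 - p s * v2)) ^+ 2
    <= (e - s) * \int[mu]_(x in `]s, e]) Q x.
Proof.
move=> se sol Hp Hp1 Hp2 iQ Q0 HQ c1 c2 b sb be.
have K0 : 0 <= (e - s) * \int[mu]_(x in `]s, e]) Q x.
  by apply: mulr_ge0; [lra|exact: Rintegral_ge0].
apply: sqrt_le_sqr_normc => //.
apply: (cvgC_le_right (F := fun x => (p1 b * f b - p b * f1 b) - (p1 x * f x - p x * f1 x)) sb).
  apply: cvgCB; first exact: cvgC_cst.
  by apply: cvgCB; apply: cvgCM => //; apply: cvgC_nbhs_right; apply: is_cder_cvg.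
move=> x sx xb; apply: sqr_normc_le_sqrt => //.
exact: (@cell_green s e f f1 h p p1 p2 p3 Q se sol Hp Hp1 Hp2 iQ Q0 HQ x b sx (ltW xb) be).
Qed.

Lemma is_cder_Czs z s x : is_cder (fun x => Cz z (x - s)) x (- z * Sz z (x - s)).
Proof. exact: is_cder_shift (is_cder_Cz _ _). Qed.

Lemma is_cder_Szs z s x : is_cder (fun x => Sz z (x - s)) x (Cz z (x - s)).
Proof. exact: is_cder_shift (is_cder_Sz _ _). Qed.

Lemma integrable_energyZ s e g (K : R) : sq_integrable s e g ->
  mu.-integrable `]s, e] (EFin \o (fun x => K * normc (g x) ^+ 2)).
Proof. move=> [_ _ i].
have -> : EFin \o (fun x => K * normc (g x) ^+ 2) =
   (fun x => K%:E * (EFin \o (fun x => (normc (g x) ^+ 2)%R)) x)%E by apply/funext.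
exact: integrableZl. Qed.

Lemma Rintegral_energyZ s e g (K : R) : sq_integrable s e g ->
  \int[mu]_(x in `]s, e]) (K * normc (g x) ^+ 2) = K * energy s e g.
Proof. by move=> [_ _ i]; rewrite RintegralZl. Qed.

(** * Comparison with the homogeneous solution of the same data *)

Definition hom z s v1 v2 x : R[i] := Cz z (x - s) * v1 + Sz z (x - s) * v2.
Definition hom1 z s v1 v2 x : R[i] := - z * Sz z (x - s) * v1 + Cz z (x - s) * v2.

(** Green's formula with the test functions S(x - s) and - C(x - s), which solve the homogeneous
    equation, leaves only [g] on the right. It bounds [A] and [B], the errors of the data carried
    back from [b] to [s]; carrying them forward by a matrix of determinant 1 gives the errors at
    [b]. *)
Lemma cell_rep z (L : R) : 0 < L -> exists2 K : R, 0 < K &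
  forall s e f f1 g v1 v2, s < e -> e - s <= L ->
    cellsol s e f f1 (fun x => g x + z * f x) -> sq_integrable s e g ->
    cvgC s^'+ f v1 -> cvgC s^'+ f1 v2 ->
    forall b, s < b -> b < e ->
    normc (f b - hom z s v1 v2 b) ^+ 2 <= K * energy s e g /\
    normc (f1 b - hom1 z s v1 v2 b) ^+ 2 <= K * energy s e g.
Proof.
move=> L0; have [K0 K1 HK] := CSz_bounded z L.
(* [M] bounds all entries of the propagation matrix, including z S. *)
pose M : R := (2 + normc z) * K0; have nz := normc_ge0 z.
have M0 : 0 < M by rewrite mulr_gt0//; lra.
exists ((2 * M) ^+ 2 * (L * K0 ^+ 2)).
  by rewrite !mulr_gt0 ?exprn_gt0//; lra.
move=> s e f f1 g v1 v2 se esL sol sg c1 c2 b sb be.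
have E0 := energy_ge0 s e g.
have HQ p : (forall x, s < x -> x < e -> normc (p x) <= K0) ->
   forall x, s < x -> x < e -> normc (p x * g x) ^+ 2 <= K0 ^+ 2 * normc (g x) ^+ 2.
  move=> Hp x sx xe; rewrite normcM exprMn ler_wpM2r ?sqr_ge0//.
  by rewrite ler_sqr ?nnegrE ?normc_ge0 ?Hp//; lra.
have Q0 x : 0 <= K0 ^+ 2 * normc (g x) ^+ 2 by rewrite mulr_ge0 ?sqr_ge0.
have iQ := integrable_energyZ (K0 ^+ 2) sg.
have HS x : s < x -> x < e -> normc (Sz z (x - s)) <= K0.
  by move=> sx xe; have [||//] := HK (x - s) => //; lra.
have HC x : s < x -> x < e -> normc (Cz z (x - s)) <= K0.
  by move=> sx xe; have [||//] := HK (x - s) => //; lra.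
have HA : normc (Cz z (b - s) * f b - Sz z (b - s) * f1 b - v1) ^+ 2 <=
    (e - s) * (K0 ^+ 2 * energy s e g).
  rewrite -Rintegral_energyZ//.
  have := @cell_green_start s e f f1 _ (fun x => Sz z (x - s)) (fun x => Cz z (x - s))
    (fun x => - z * Sz z (x - s)) (fun x => - z * Cz z (x - s)) _ v1 v2 se sol
    (is_cder_Szs z s) (is_cder_Czs z s) (fun x => is_cderZ (- z) (is_cder_Szs z s x)) iQ Q0.
  rewrite !subrr Cz0 Sz0 mul1r mul0r subr0; apply => // x sx xe.
  have -> : - z * Sz z (x - s) * f x + Sz z (x - s) * (g x + z * f x) = Sz z (x - s) * g x by ring.
  exact: (HQ (fun x => Sz z (x - s)) HS x sx xe).
have HB : normc (z * Sz z (b - s) * f b + Cz z (b - s) * f1 b - v2) ^+ 2 <=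
    (e - s) * (K0 ^+ 2 * energy s e g).
  rewrite -Rintegral_energyZ//.
  have d1 x : is_cder (fun x => - Cz z (x - s)) x (z * Sz z (x - s)).
    by apply: is_cder_eq (is_cderN (is_cder_Czs z s x)) _; ring.
  have d2 x := is_cderZ z (is_cder_Szs z s x).
  have d3 x := is_cderZ z (is_cder_Czs z s x).
  have HQ' x : s < x -> x < e -> normc (z * Cz z (x - s) * f x + - Cz z (x - s) * (g x + z * f x)) ^+ 2
      <= K0 ^+ 2 * normc (g x) ^+ 2.
    move=> sx xe; have -> : z * Cz z (x - s) * f x + - Cz z (x - s) * (g x + z * f x) =
      - (Cz z (x - s) * g x) by ring.
    by rewrite normcN; exact: (HQ (fun x => Cz z (x - s)) HC x sx xe).
  have H0 := cell_green_start se sol d1 d2 d3 iQ Q0 HQ' c1 c2 sb be.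
  apply: le_trans H0; rewrite le_eqVlt; apply/orP; left; apply/eqP; congr (normc _ ^+ 2).
  by rewrite subrr Cz0 Sz0; ring.
set A := (X in normc X ^+ 2 <= _) in HA; set B := (X in normc X ^+ 2 <= _) in HB.
have det := CSz_sqr z (b - s).
have Ef : f b - hom z s v1 v2 b = Cz z (b - s) * A + Sz z (b - s) * B.
  rewrite /A /B /hom -[f b in LHS]mul1r -det; ring.
have Ef1 : f1 b - hom1 z s v1 v2 b = - z * Sz z (b - s) * A + Cz z (b - s) * B.
  rewrite /A /B /hom1 -[f1 b in LHS]mul1r -det; ring.
set q : R := (e - s) * (K0 ^+ 2 * energy s e g) in HA HB.
have q0 : 0 <= q by rewrite /q !mulr_ge0 ?sqr_ge0//; lra.
have qL : q <= L * K0 ^+ 2 * energy s e g.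
  by rewrite /q -mulrA ler_wpM2r// mulr_ge0 ?sqr_ge0.
have fin (X Y : R[i]) : normc X <= M -> normc Y <= M ->
    normc (X * A + Y * B) ^+ 2 <= (2 * M) ^+ 2 * (L * K0 ^+ 2) * energy s e g.
  move=> hX hY; apply: (@le_trans _ _ ((2 * M) ^+ 2 * q)).
    have hA := sqr_normc_le_sqrt q0 HA; have hB := sqr_normc_le_sqrt q0 HB.
    have s0 : 0 <= 2 * M * Num.sqrt q by apply: mulr_ge0; [lra|exact: sqrtr_ge0].
    rewrite -(sqr_sqrtr q0) -exprMn ler_sqr ?nnegrE ?normc_ge0//.
    apply: (le_trans (normcD _ _)); rewrite !normcM.
    have h1 : normc X * normc A <= M * Num.sqrt q by apply: ler_pM; rewrite ?normc_ge0.
    have h2 : normc Y * normc B <= M * Num.sqrt q by apply: ler_pM; rewrite ?normc_ge0.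
    lra.
  apply: (@le_trans _ _ ((2 * M) ^+ 2 * (L * K0 ^+ 2 * energy s e g))).
    by apply: ler_wpM2l; [exact: sqr_ge0|exact: qL].
  by rewrite !mulrA.
have K0z : K0 * normc z >= 0 by rewrite mulr_ge0//; lra.
have hS := HS b sb be; have hC := HC b sb be.
rewrite Ef Ef1; split; apply: fin.
- by rewrite /M; lra.
- by rewrite /M; lra.
- rewrite normcM normcN; have : normc z * normc (Sz z (b - s)) <= normc z * K0 by rewrite ler_wpM2l.
  by rewrite /M; lra.
- by rewrite /M; lra.
Qed.

Lemma is_cder_hom z s v1 v2 x : is_cder (hom z s v1 v2) x (hom1 z s v1 v2 x).
Proof.
have H := is_cderD (is_cderM (is_cder_Czs z s x) (is_cder_cst v1 x))
  (is_cderM (is_cder_Szs z s x) (is_cder_cst v2 x)).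
by apply: is_cder_eq H _; rewrite /hom1; ring.
Qed.

Lemma is_cder_hom1 z s v1 v2 x : is_cder (hom1 z s v1 v2) x (- (z * hom z s v1 v2 x)).
Proof.
have H := is_cderD (is_cderM (is_cderZ (- z) (is_cder_Szs z s x)) (is_cder_cst v1 x))
  (is_cderM (is_cder_Czs z s x) (is_cder_cst v2 x)).
by apply: is_cder_eq H _; rewrite /hom; ring.
Qed.

Lemma hom_start z s v1 v2 : hom z s v1 v2 s = v1.
Proof. by rewrite /hom subrr Cz0 Sz0 mul1r mul0r addr0. Qed.

Lemma hom1_start z s v1 v2 : hom1 z s v1 v2 s = v2.
Proof. by rewrite /hom1 subrr Cz0 Sz0 mulr0 mul1r mul0r add0r. Qed.

Lemma cell_rep_end z (L : R) : 0 < L -> exists2 K : R, 0 < K &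
  forall s e f f1 g v1 v2 u1 u2, s < e -> e - s <= L ->
    cellsol s e f f1 (fun x => g x + z * f x) -> sq_integrable s e g ->
    cvgC s^'+ f v1 -> cvgC s^'+ f1 v2 -> cvgC e^'- f u1 -> cvgC e^'- f1 u2 ->
    normc (u1 - hom z s v1 v2 e) ^+ 2 <= K * energy s e g /\
    normc (u2 - hom1 z s v1 v2 e) ^+ 2 <= K * energy s e g.
Proof.
move=> /(cell_rep z)[K K0 HK]; exists K => // s e f f1 g v1 v2 u1 u2 se eL sol sg c1 c2 d1 d2.
have E0 : 0 <= K * energy s e g by rewrite mulr_ge0 ?energy_ge0// ltW.
have H := HK s e f f1 g v1 v2 se eL sol sg c1 c2.
split; apply: sqrt_le_sqr_normc => //.
- apply: (cvgC_le_left (F := fun b => f b - hom z s v1 v2 b) se).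
    apply: cvgCB => //; apply: cvgC_nbhs_left; exact: is_cder_cvg (is_cder_hom _ _ _ _ _).
  by move=> x sx xe; apply: sqr_normc_le_sqrt => //; have [] := H x sx xe.
- apply: (cvgC_le_left (F := fun b => f1 b - hom1 z s v1 v2 b) se).
    apply: cvgCB => //; apply: cvgC_nbhs_left; exact: is_cder_cvg (is_cder_hom1 _ _ _ _ _).
  by move=> x sx xe; apply: sqr_normc_le_sqrt => //; have [] := H x sx xe.
Qed.

Definition cubic (a b c d : R[i]) t : R[i] := a + b * t%:C + c * t%:C ^+ 2 + d * t%:C ^+ 3.

Lemma is_cder_cubic (a b c d : R[i]) t :
  is_cder (cubic a b c d) t (cubic b (2 * c) (3 * d) 0 t).
Proof.
have h0 := is_cder_id t; have h2 := is_cderM h0 h0; have h3 := is_cderM h0 h2.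
have H := is_cderD (is_cderD (is_cderD (is_cder_cst a t) (is_cderZ b h0)) (is_cderZ c h2))
  (is_cderZ d h3).
apply: is_cder_eq (is_cder_ext _ H) _; last by rewrite /cubic; ring.
by move=> x; rewrite /cubic !exprS expr0 !mulr1.
Qed.

(** Test functions whose value and derivative vanish at s + l / 2 make Green's formula isolate one
    component of the data at [s]. Half of [l] keeps that point strictly inside the cell, and the
    bounds [l] and [L] on the length make the constant uniform. *)
Lemma cell_data_bound (l L : R) : 0 < l -> exists2 K : R, 0 < K &
  forall s e f f1 h v1 v2, l <= e - s -> e - s <= L -> cellsol s e f f1 h ->
    sq_integrable s e f -> sq_integrable s e h ->
    cvgC s^'+ f v1 -> cvgC s^'+ f1 v2 ->
    normc v1 ^+ 2 <= K * (energy s e f + energy s e h) /\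
    normc v2 ^+ 2 <= K * (energy s e f + energy s e h).
Proof.
move=> l0; pose m := l / 2; have m0 : 0 < m by rewrite /m; lra.
pose r : R[i] := (m^-1)%:C; have rm : r * m%:C = 1 by rewrite -rmorphM/= mulVf ?rmorph1//; lra.
(* With r = 1 / m, [P] is t (1 - r t)^2 and [Q] is 1 - 3 (r t)^2 + 2 (r t)^3. Both have a double
   zero at m; value and slope at 0 are 0, 1 for [P] and 1, 0 for [Q]. [P2] and [Q2] are the second
   derivatives. *)
pose P := cubic 0 1 (- (2 * r)) (r ^+ 2); pose P2 := cubic (2 * - (2 * r)) (2 * (3 * r ^+ 2)) (3 * 0) 0.
pose Q := cubic 1 0 (- (3 * r ^+ 2)) (2 * r ^+ 3).
pose Q2 := cubic (2 * - (3 * r ^+ 2)) (2 * (3 * (2 * r ^+ 3))) (3 * 0) 0.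
have [K1 K10 H1] := is_cder_bounded 0 L (is_cder_cubic 0 1 (- (2 * r)) (r ^+ 2)).
have [K2 K20 H2] := is_cder_bounded 0 L (is_cder_cubic (2 * - (2 * r)) (2 * (3 * r ^+ 2)) (3 * 0) 0).
have [K3 K30 H3] := is_cder_bounded 0 L (is_cder_cubic 1 0 (- (3 * r ^+ 2)) (2 * r ^+ 3)).
have [K4 K40 H4] := is_cder_bounded 0 L
  (is_cder_cubic (2 * - (3 * r ^+ 2)) (2 * (3 * (2 * r ^+ 3))) (3 * 0) 0).
pose K0 : R := 1 + K1 + K2 + K3 + K4; have K00 : 0 < K0 by rewrite /K0; lra.
pose L' : R := `|L| + 1; have L'0 : 0 < L' by rewrite /L' ltr_wpDl.
exists (L' * (2 * K0 ^+ 2)); first by rewrite mulr_gt0// mulr_gt0// exprn_gt0.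
move=> s e f f1 h v1 v2 le eL sol sf sh c1 c2.
have se : s < e by lra.
pose q (x : R) : R := 2 * K0 ^+ 2 * normc (f x) ^+ 2 + 2 * K0 ^+ 2 * normc (h x) ^+ 2.
have iq : mu.-integrable `]s, e] (EFin \o q).
  have -> : EFin \o q = ((EFin \o (fun x => (2 * K0 ^+ 2 * normc (f x) ^+ 2)%R)) \+
     (EFin \o (fun x => (2 * K0 ^+ 2 * normc (h x) ^+ 2)%R)))%E by apply/funext.
  by apply: integrableD => //; exact: integrable_energyZ.
have K02 : 0 <= 2 * K0 ^+ 2 by have := sqr_ge0 K0; lra.
have q0 x : 0 <= q x by rewrite /q addr_ge0// mulr_ge0 ?sqr_ge0.
have Eq : \int[mu]_(x in `]s, e]) q x = 2 * K0 ^+ 2 * (energy s e f + energy s e h).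
  by rewrite /q RintegralD ?Rintegral_energyZ -?mulrDr//; exact: integrable_energyZ.
have key (p p2 : R -> R[i]) :
   (forall x, s < x -> x < e -> normc (p x) <= K0 /\ normc (p2 x) <= K0) ->
   forall x, s < x -> x < e -> normc (p2 x * f x + p x * h x) ^+ 2 <= q x.
  move=> Hp x sx xe; have [hp hp2] := Hp x sx xe.
  apply: (@le_trans _ _ ((K0 * normc (f x) + K0 * normc (h x)) ^+ 2)).
    rewrite ler_sqr ?nnegrE ?normc_ge0 ?addr_ge0 ?mulr_ge0 ?normc_ge0//; last 2 first.
    - exact: ltW.
    - exact: ltW.
    by apply: (le_trans (normcD _ _)); rewrite !normcM lerD// ler_wpM2r ?normc_ge0.
  rewrite /q -mulrDr exprMn.
  have : 0 <= K0 ^+ 2 * (normc (f x) - normc (h x)) ^+ 2 by rewrite mulr_ge0 ?sqr_ge0.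
  by lra.
have sh' (a b c d : R[i]) x : is_cder (fun x => cubic a b c d (x - s)) x (cubic b (2 * c) (3 * d) 0 (x - s)).
  exact: is_cder_shift (is_cder_cubic _ _ _ _ _).
have E0 := energy_ge0 s e f; have E1 := energy_ge0 s e h.
have fin (K : R[i]) : normc K ^+ 2 <= (e - s) * \int[mu]_(x in `]s, e]) q x ->
   normc K ^+ 2 <= L' * (2 * K0 ^+ 2) * (energy s e f + energy s e h).
  move=> H; apply: (le_trans H); rewrite Eq; set X := energy s e f + _.
  have X0 : 0 <= X by exact: addr_ge0.
  have h1 : e - s <= L' by rewrite /L'; have := ler_norm L; lra.
  have -> : L' * (2 * K0 ^+ 2) * X = L' * (2 * K0 ^+ 2 * X) by ring.
  by apply: ler_wpM2r => //; exact: mulr_ge0.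
have b1 : s < s + m by lra.
have b2 : s + m < e by rewrite /m; lra.
have bd (a b c d : R[i]) (K : R) : (forall t, 0 <= t -> t <= L -> normc (cubic a b c d t) <= K) -> K <= K0 ->
    forall x, s < x -> x < e -> normc (cubic a b c d (x - s)) <= K0.
  by move=> H KK x sx xe; apply: le_trans KK; apply: H; lra.
split; apply: fin.
- have := cell_green_start se sol (sh' 0 1 (- (2 * r)) (r ^+ 2)) (sh' _ _ _ _) (sh' _ _ _ _) iq q0 _ c1 c2 b1 b2.
  have z1 : s + m - s = m by ring.
  rewrite z1 subrr.
  have -> : cubic 1 (2 * - (2 * r)) (3 * r ^+ 2) 0 m = 0.
    have -> : cubic 1 (2 * - (2 * r)) (3 * r ^+ 2) 0 m = 1 - 4 * (r * m%:C) + 3 * (r * m%:C) ^+ 2.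
      by rewrite /cubic; ring.
    by rewrite rm; ring.
  have -> : cubic 0 1 (- (2 * r)) (r ^+ 2) m = 0.
    have -> : cubic 0 1 (- (2 * r)) (r ^+ 2) m = m%:C * (1 - (r * m%:C)) ^+ 2.
      by rewrite /cubic; ring.
    by rewrite rm subrr expr0n mulr0.
  have -> : cubic 1 (2 * - (2 * r)) (3 * r ^+ 2) 0 0 = 1 by rewrite /cubic rmorph0; ring.
  have -> : cubic 0 1 (- (2 * r)) (r ^+ 2) 0 = 0 by rewrite /cubic rmorph0; ring.
  rewrite !mul0r mul1r !subr0 sub0r normcN; apply.
  by apply: key => x sx xe; split; [apply: (bd _ _ _ _ _ H1)|apply: (bd _ _ _ _ _ H2)] => //;
    rewrite /K0; lra.
- have := cell_green_start se sol (sh' 1 0 (- (3 * r ^+ 2)) (2 * r ^+ 3)) (sh' _ _ _ _) (sh' _ _ _ _) iq q0 _ c1 c2 b1 b2.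
  have z1 : s + m - s = m by ring.
  rewrite z1 subrr.
  have -> : cubic 0 (2 * - (3 * r ^+ 2)) (3 * (2 * r ^+ 3)) 0 m = 0.
    have -> : cubic 0 (2 * - (3 * r ^+ 2)) (3 * (2 * r ^+ 3)) 0 m = 6 * r * (r * m%:C) * (r * m%:C - 1).
      by rewrite /cubic; ring.
    by rewrite rm subrr mulr0.
  have -> : cubic 1 0 (- (3 * r ^+ 2)) (2 * r ^+ 3) m = 0.
    have -> : cubic 1 0 (- (3 * r ^+ 2)) (2 * r ^+ 3) m = 1 - 3 * (r * m%:C) ^+ 2 + 2 * (r * m%:C) ^+ 3.
      by rewrite /cubic; ring.
    by rewrite rm; ring.
  have -> : cubic 0 (2 * - (3 * r ^+ 2)) (3 * (2 * r ^+ 3)) 0 0 = 0 by rewrite /cubic rmorph0; ring.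
  have -> : cubic 1 0 (- (3 * r ^+ 2)) (2 * r ^+ 3) 0 = 1 by rewrite /cubic rmorph0; ring.
  have -> : 0 * f (s + m) - 0 * f1 (s + m) - (0 * v1 - 1 * v2) = v2 by ring.
  apply.
  by apply: key => x sx xe; split; [apply: (bd _ _ _ _ _ H3)|apply: (bd _ _ _ _ _ H4)] => //;
    rewrite /K0; lra.
Qed.

(** Since [f1] is continuous at x, the function f(t) - f1(x) t has almost everywhere near x a
    derivative of norm at most [k]; the increment inequality turns this into differentiability at x
    itself. *)
Lemma ae_is_cder s e f f1 :
  (forall a b, s < a -> a <= b -> b < e -> abs_continuous_on a b f) ->
  (forall x, s < x -> x < e -> cvgC (nbhs x) f1 (f1 x)) ->
  {ae mu, forall x, s < x -> x < e -> is_cder f x (f1 x)} ->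
  forall x, s < x -> x < e -> is_cder f x (f1 x).
Proof.
move=> ACf cf1 Hf x sx xe; apply/is_cder_epsP => k k0.
have /cvgC_nbhsP/(_ k k0)[r r0 Hr] := cf1 x sx xe.
pose r' := Num.min r (Num.min (x - s) (e - x)).
have [r'1 r'2 r'3] : [/\ r' <= r, r' <= x - s & r' <= e - x].
  by rewrite /r' !ge_min !lexx !orbT.
exists r'; first by rewrite /r' !lt_min r0 !subr_gt0 sx.
move=> y yx.
have main a b : a <= b -> `|a - x| < r' -> `|b - x| < r' ->
   normc (f b - f a - f1 x * (b - a)%:C) <= k * (b - a).
  move=> ab; rewrite !ltr_norml => /andP[a1 a2] /andP[b1 b2].
  have nd (u v : R) : a <= u -> u <= v -> k * u <= k * v by move=> _ uv; rewrite ler_pM2l.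
  have D t : is_cder (fun t => - f1 x * t%:C) t (- f1 x).
    by apply: is_cder_eq (is_cderZ (- f1 x) (is_cder_id t)) _; rewrite mulr1.
  have AC : abs_continuous_on a b (fun t => f t + - f1 x * t%:C).
    apply: abs_continuousD; first by apply: ACf; lra.
    by apply: (is_cder_abs_continuous (G := fun=> - f1 x) (K := normc (- f1 x))).
  have := @abs_continuous_increment_le R _ (fun t => k * t) a b
    (~` [set x | s < x -> x < e -> is_cder f x (f1 x)]) ab AC nd Hf.
  have -> : f b + - f1 x * b%:C - (f a + - f1 x * a%:C) = f b - f a - f1 x * (b - a)%:C.
    by rewrite rmorphB/=; ring.
  rewrite mulrBr; apply => t at_ tb /contrapT Ht.
  exists (f1 t - f1 x), k; split.
  - by apply: is_cderD => //; apply: Ht; lra.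
  - have -> : (fun t : R => k * t) = k \*: (id : R -> R) by [].
    by apply: is_derive_eq; rewrite /GRing.scale /= mulr1.
  - by apply: Hr; rewrite ltr_norml; lra.
have x0 : `|x - x| < r' by rewrite subrr normr0 /r' !lt_min r0 !subr_gt0 sx.
have [xy|/ltW xy] := leP x y.
  by rewrite (ger0_norm (x := y - x)) ?subr_ge0//; exact: main.
have := main y x xy yx x0.
have -> : f x - f y - f1 x * (x - y)%:C = - (f y - f x - f1 x * (y - x)%:C).
  by rewrite !rmorphB/=; ring.
by rewrite normcN (ler0_norm (x := y - x)) ?opprB// subr_le0.
Qed.

Lemma continuous_measurable_itv s e (p : R -> R) : (forall x, {for x, continuous p}) ->
  measurable_fun (`]s, e] : set R) p.
Proof.
move=> cp; apply: (measurable_funS (E := setT)) => //.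
by apply: continuous_measurable_fun => x; exact: cp.
Qed.

Lemma sq_integrableM s e g p p1 : (forall x, is_cder p x (p1 x)) ->
  sq_integrable s e g -> sq_integrable s e (fun x => p x * g x).
Proof.
move=> Hp [m1 m2 i]; have [K K0 HK] := is_cder_bounded s e Hp.
have mR : measurable_fun `]s, e] (fun x => complex.Re (p x)).
  apply: continuous_measurable_itv => x.
  by have [] := is_cder_cvg (Hp x).
have mI : measurable_fun `]s, e] (fun x => complex.Im (p x)).
  apply: continuous_measurable_itv => x.
  by have [] := is_cder_cvg (Hp x).
have mR' : measurable_fun `]s, e] (fun x => complex.Re (p x * g x)).
  have -> : (fun x => complex.Re (p x * g x)) = (fun x => complex.Re (p x) * complex.Re (g x)
      - complex.Im (p x) * complex.Im (g x)) by apply/funext => x; rewrite ReM.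
  by apply: measurable_funB; exact: measurable_funM.
have mI' : measurable_fun `]s, e] (fun x => complex.Im (p x * g x)).
  have -> : (fun x => complex.Im (p x * g x)) = (fun x => complex.Re (p x) * complex.Im (g x)
      + complex.Im (p x) * complex.Re (g x)) by apply/funext => x; rewrite ImM.
  by apply: measurable_funD; exact: measurable_funM.
split => //; apply: (le_integrable _ _ _ (@integrable_energyZ s e g (K ^+ 2) _)) => //.
- apply/measurable_EFinP.
  have -> : (fun x => normc (p x * g x) ^+ 2) = (fun x => complex.Re (p x * g x) ^+ 2 +
     complex.Im (p x * g x) ^+ 2) by apply/funext => x; rewrite sqr_normcE.
  by apply: measurable_funD; exact: measurable_funX.
- move=> x xse; have [sx xe] : s < x /\ x <= e by move: xse; rewrite /= in_itv/= => /andP.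
  have H : normc (p x * g x) ^+ 2 <= K ^+ 2 * normc (g x) ^+ 2.
    rewrite normcM exprMn ler_wpM2r ?sqr_ge0//.
    by rewrite ler_sqr ?nnegrE ?normc_ge0// HK// ltW.
  have H0 : 0 <= K ^+ 2 * normc (g x) ^+ 2 by apply: mulr_ge0; exact: sqr_ge0.
  by rewrite /comp !abse_EFin lee_fin (ger0_norm (sqr_ge0 _)) (ger0_norm H0).
Qed.

(** Variation of constants: the coefficients [A] and [B] of the fundamental system are primitives of
    S g and - C g. They are differentiable only almost everywhere, but the candidate [f1] is
    continuous, so [ae_is_cder] makes [f] differentiable at every point of the cell. *)
Lemma local_solution z s e g v1 v2 : s < e -> sq_integrable s e g ->
  exists f f1, [/\ cellsol s e f f1 (fun x => g x + z * f x), f s = v1, f1 s = v2,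
    cvgC s^'+ f v1 /\ cvgC s^'+ f1 v2 & cvgC e^'- f (f e) /\ cvgC e^'- f1 (f1 e)].
Proof.
move=> se sg.
pose C x := Cz z (x - s); pose S x := Sz z (x - s).
have dC x : is_cder C x (- z * S x) by exact: is_cder_Czs.
have dS x : is_cder S x (C x) by exact: is_cder_Szs.
have sS := sq_integrableM dS sg; have sC := sq_integrableM dC sg.
pose A x := v1 + cprim s e (fun x => S x * g x) x.
pose B x := v2 + (-1) * cprim s e (fun x => C x * g x) x.
pose f x := C x * A x + S x * B x.
pose f1 x := (- z * S x) * A x + C x * B x.
have ACA a b : s <= a -> abs_continuous_on a b A.
  move=> sa; apply: abs_continuousD; first exact: abs_continuous_cst.
  exact: cprim_abs_continuous.
have ACB a b : s <= a -> abs_continuous_on a b B.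
  move=> sa; apply: abs_continuousD; first exact: abs_continuous_cst.
  apply: abs_continuousM; first exact: abs_continuous_cst.
  exact: cprim_abs_continuous.
have AC1 p p1 a b : (forall x, is_cder p x (p1 x)) -> (exists p2, forall x, is_cder p1 x (p2 x)) ->
    abs_continuous_on a b p.
  move=> Hp [p2 Hp1]; have [K _ HK] := is_cder_bounded a b Hp1.
  by apply: (is_cder_abs_continuous (G := p1) (K := K)) => x ax xb; [exact: Hp|exact: HK].
have ddS x : is_cder (fun x => - z * S x) x (- z * C x) by exact: is_cderZ.
have ddC x : is_cder (fun x => - z * C x) x (- z * (- z * S x)) by exact: is_cderZ.
have ACC a b : abs_continuous_on a b C.
  by apply: AC1 dC _; exists (fun x => - z * C x).
have ACS a b : abs_continuous_on a b S.
  by apply: AC1 dS _; exists (fun x => - z * S x).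
have ACzS a b : abs_continuous_on a b (fun x => - z * S x).
  by apply: AC1 ddS _; exists (fun x => - z * (- z * S x)).
have ACf a b : s <= a -> abs_continuous_on a b f.
  by move=> sa; apply: abs_continuousD; apply: abs_continuousM => //; [exact: ACA|exact: ACB].
have ACf1 a b : s <= a -> abs_continuous_on a b f1.
  by move=> sa; apply: abs_continuousD; apply: abs_continuousM => //; [exact: ACA|exact: ACB].
have fs : f s = v1.
  by rewrite /f /A /B !cprim_start /C /S subrr Cz0 Sz0; ring.
have f1s : f1 s = v2.
  by rewrite /f1 /A /B !cprim_start /C /S subrr Cz0 Sz0; ring.
have dA := cprim_derive sS; have dB := cprim_derive sC.
have det x : C x ^+ 2 + z * S x ^+ 2 = 1 by exact: CSz_sqr.
exists f, f1; split => //.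
- split.
  + apply: ae_is_cder.
    * by move=> a b sa ab be; apply: ACf; exact: ltW.
    * move=> x sx xe; apply: (@abs_continuous_cvg _ _ s e) => //; exact: ACf1.
    * move: dA dB; apply: filterS2; first exact: (ae_filter_ringOfSetsType mu).
      move=> x hA hB sx xe; have {}hA := hA sx (ltW xe); have {}hB := hB sx (ltW xe).
      have hA' := is_cderD (is_cder_cst v1 x) hA.
      have hB' := is_cderD (is_cder_cst v2 x) (is_cderZ (-1) hB).
      apply: is_cder_eq (is_cderD (is_cderM (dC x) hA') (is_cderM (dS x) hB')) _.
      by rewrite /f1 /A /B; ring.
  + by move=> a b sa ab be; apply: ACf1; exact: ltW.
  + move: dA dB; apply: filterS2; first exact: (ae_filter_ringOfSetsType mu).
    move=> x hA hB sx xe; have {}hA := hA sx (ltW xe); have {}hB := hB sx (ltW xe).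
    have hA' := is_cderD (is_cder_cst v1 x) hA.
    have hB' := is_cderD (is_cder_cst v2 x) (is_cderZ (-1) hB).
    apply: is_cder_eq (is_cderD (is_cderM (ddS x) hA') (is_cderM (dC x) hB')) _.
    have E : g x = (C x ^+ 2 + z * S x ^+ 2) * g x by rewrite det mul1r.
    by rewrite /f [g x in RHS]E /A /B; ring.
- by split; [rewrite -fs|rewrite -f1s]; apply: (abs_continuous_cvg_right se);
    [exact: ACf|exact: ACf1].
(* The primitives continue as constants after [e], so absolute continuity holds across [e] and the
   left limits there are the values. *)
- by split; apply: cvgC_nbhs_left; apply: (@abs_continuous_cvg _ _ s (e + 1)) => //;
    [lra|exact: ACf|lra|exact: ACf1].
Qed.

End CellSolutions.

(** * Recursions with an exponential dichotomy *)

Section DiscreteDichotomy.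
Context {R : realType}.
Local Notation normc := (@Normc.normc R).
Local Notation vec := (R[i] * R[i])%type.
Local Notation mat := ((R[i] * R[i]) * (R[i] * R[i]))%type.
Implicit Types (x y : vec) (M : mat) (v w : nat -> vec) (T : nat -> mat).

Definition vadd x y : vec := (x.1 + y.1, x.2 + y.2).
Definition vscale (k : R[i]) x : vec := (k * x.1, k * x.2).
Definition mapp M x : vec := (M.1.1 * x.1 + M.1.2 * x.2, M.2.1 * x.1 + M.2.2 * x.2).
Definition mdet M : R[i] := M.1.1 * M.2.2 - M.1.2 * M.2.1.
Definition mtr M : R[i] := M.1.1 + M.2.2.
Definition nrm2 x : R := normc x.1 ^+ 2 + normc x.2 ^+ 2.
Definition wedge x y : R[i] := x.1 * y.2 - x.2 * y.1.
Definition is_sol T w v := forall n, v n.+1 = vadd (mapp (T n) (v n)) (w n).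
Definition vzero : nat -> vec := fun=> (0, 0).
Definition sum2_le v (S : R) := forall m, \sum_(n < m) nrm2 (v n) <= S.
Definition l2seq v := exists S, sum2_le v S.

Fixpoint sol T w x n : vec :=
  if n is n'.+1 then vadd (mapp (T n') (sol T w x n')) (w n') else x.

Lemma sol_is_sol T w x : is_sol T w (sol T w x).
Proof. by []. Qed.

Lemma nrm2_ge0 x : 0 <= nrm2 x.
Proof. by rewrite /nrm2 addr_ge0// sqr_ge0. Qed.

Lemma nrm2_eq0 x : nrm2 x = 0 -> x = (0, 0).
Proof.
move=> H; have h1 := sqr_ge0 (normc x.1); have h2 := sqr_ge0 (normc x.2).
have : normc x.1 ^+ 2 = 0 by rewrite /nrm2 in H; lra.
have : normc x.2 ^+ 2 = 0 by rewrite /nrm2 in H; lra.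
move=> /eqP; rewrite sqrf_eq0 normc_eq0 => /eqP E2 /eqP; rewrite sqrf_eq0 normc_eq0 => /eqP E1.
by case: x E1 E2 {H h1 h2} => a b /= -> ->.
Qed.

Lemma nrm2Z k x : nrm2 (vscale k x) = normc k ^+ 2 * nrm2 x.
Proof. by rewrite /nrm2 /= !normcM !exprMn mulrDr. Qed.

Lemma sqr_normcD_le (a b : R[i]) : normc (a + b) ^+ 2 <= 2 * normc a ^+ 2 + 2 * normc b ^+ 2.
Proof.
have h := normcD a b; have ha := normc_ge0 a; have hb := normc_ge0 b; have hab := normc_ge0 (a + b).
have : normc (a + b) ^+ 2 <= (normc a + normc b) ^+ 2 by rewrite ler_sqr// nnegrE; lra.
have : 0 <= (normc a - normc b) ^+ 2 by exact: sqr_ge0.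
by rewrite sqrrB sqrrD; lra.
Qed.

Lemma sqr_normcD_le_eps (a b : R[i]) (k : R) : 0 < k ->
  normc (a + b) ^+ 2 <= (1 + k) * normc a ^+ 2 + (1 + k^-1) * normc b ^+ 2.
Proof.
move=> k0.
have h := normcD a b; have ha := normc_ge0 a; have hb := normc_ge0 b; have hab := normc_ge0 (a + b).
have : normc (a + b) ^+ 2 <= (normc a + normc b) ^+ 2 by rewrite ler_sqr// nnegrE; lra.
have : 0 <= (k * normc a - normc b) ^+ 2 / k by rewrite divr_ge0 ?sqr_ge0// ltW.
have -> : (k * normc a - normc b) ^+ 2 / k =
  k * normc a ^+ 2 + k^-1 * normc b ^+ 2 - 2 * normc a * normc b by field; lra.
by rewrite sqrrD; lra.
Qed.

(** The upper bound applied to a = (a + b) - b; it yields the factor 1 / (1 + k), which is at least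
    1 - k. *)
Lemma sqr_normcD_ge_eps (a b : R[i]) (k : R) : 0 < k ->
  (1 - k) * normc a ^+ 2 - k^-1 * normc b ^+ 2 <= normc (a + b) ^+ 2.
Proof.
move=> k0; have := sqr_normcD_le_eps (a + b) (- b) k0.
rewrite addrK normcN => h.
have k1 : 0 < 1 + k by lra.
have : normc a ^+ 2 / (1 + k) <= normc (a + b) ^+ 2 + k^-1 * normc b ^+ 2.
  rewrite ler_pdivrMr//; apply: (le_trans h); rewrite le_eqVlt; apply/orP; left; apply/eqP.
  by field; lra.
have : (1 - k) * normc a ^+ 2 <= normc a ^+ 2 / (1 + k).
  rewrite ler_pdivlMr// mulrAC ler_piMl ?sqr_ge0//.
  by have := sqr_ge0 k; lra.
lra.
Qed.

Lemma nrm2D x y : nrm2 (vadd x y) <= 2 * nrm2 x + 2 * nrm2 y.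
Proof.
by rewrite /nrm2 /=; have := sqr_normcD_le x.1 y.1; have := sqr_normcD_le x.2 y.2; lra.
Qed.

Definition mbound M (K : R) :=
  [/\ normc M.1.1 <= K, normc M.1.2 <= K, normc M.2.1 <= K & normc M.2.2 <= K].

Definition msub M M' : mat :=
  ((M.1.1 - M'.1.1, M.1.2 - M'.1.2), (M.2.1 - M'.2.1, M.2.2 - M'.2.2)).

Definition mcvg T M := forall e : R, 0 < e -> exists N, forall n, (N <= n)%N -> mbound (msub (T n) M) e.

Lemma lin_bound (a b : R[i]) x (K : R) : normc a <= K -> normc b <= K ->
  normc (a * x.1 + b * x.2) ^+ 2 <= 2 * K ^+ 2 * nrm2 x.
Proof.
move=> aK bK; apply: (le_trans (sqr_normcD_le _ _)); rewrite !normcM !exprMn /nrm2.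
have K0 : 0 <= K by apply: le_trans aK; exact: normc_ge0.
have h1 : normc a ^+ 2 <= K ^+ 2 by rewrite ler_sqr ?nnegrE ?normc_ge0.
have h2 : normc b ^+ 2 <= K ^+ 2 by rewrite ler_sqr ?nnegrE ?normc_ge0.
have h3 : normc a ^+ 2 * normc x.1 ^+ 2 <= K ^+ 2 * normc x.1 ^+ 2 by rewrite ler_wpM2r ?sqr_ge0.
have h4 : normc b ^+ 2 * normc x.2 ^+ 2 <= K ^+ 2 * normc x.2 ^+ 2 by rewrite ler_wpM2r ?sqr_ge0.
lra.
Qed.

Lemma mapp_bound M x (K : R) : mbound M K -> nrm2 (mapp M x) <= 4 * K ^+ 2 * nrm2 x.
Proof.
move=> [h1 h2 h3 h4].
have := lin_bound x h1 h2; have := lin_bound x h3 h4; rewrite {3}/nrm2 /=; lra.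
Qed.

(* If M has eigenvalues m and m^-1 with |m| < 1, then formA M m and formA M m^-1
   are left eigenvectors, and the difference of their squared moduli is a strict
   Lyapunov function of any recursion driven by matrices close to M. *)
Definition formA M (m : R[i]) x : R[i] := (m - M.2.2) * x.1 + M.1.2 * x.2.

Definition lyap M m x : R := normc (formA M m^-1 x) ^+ 2 - normc (formA M m x) ^+ 2.

Lemma formA_mapp M m x : mdet M = 1 -> m != 0 -> mtr M = m + m^-1 ->
  formA M m (mapp M x) = m * formA M m x.
Proof.
move=> dM m0 tM; rewrite /formA /mapp /=.
have E : M.1.1 = m + m^-1 - M.2.2 by rewrite -tM /mtr addrK.
have D : M.1.2 * M.2.1 = (m + m^-1 - M.2.2) * M.2.2 - 1.
  by rewrite -dM /mdet E; ring.
have -> : (m - M.2.2) * (M.1.1 * x.1 + M.1.2 * x.2) + M.1.2 * (M.2.1 * x.1 + M.2.2 * x.2) =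
  ((m - M.2.2) * M.1.1 + M.1.2 * M.2.1) * x.1 + m * M.1.2 * x.2 by ring.
rewrite D E.
have -> : (m - M.2.2) * (m + m^-1 - M.2.2) + ((m + m^-1 - M.2.2) * M.2.2 - 1) =
  m * (m + m^-1 - M.2.2) - 1 by ring.
have -> : m * (m + m^-1 - M.2.2) - 1 = m * (m - M.2.2) by field.
ring.
Qed.

Lemma formA_add M m x y : formA M m (vadd x y) = formA M m x + formA M m y.
Proof. by rewrite /formA /=; ring. Qed.

Lemma formA_scale M m k x : formA M m (vscale k x) = k * formA M m x.
Proof. by rewrite /formA /=; ring. Qed.

Lemma formA_bound M m : exists2 K : R, 0 < K & forall x, normc (formA M m x) ^+ 2 <= K * nrm2 x.
Proof.
pose K := normc (m - M.2.2) + normc M.1.2 + 1.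
have h1 := normc_ge0 (m - M.2.2); have h2 := normc_ge0 M.1.2.
exists (2 * K ^+ 2); first by rewrite mulr_gt0// exprn_gt0// /K; lra.
by move=> x; apply: lin_bound; rewrite /K; lra.
Qed.

(** The two forms differ by (m - 1/m) times the first component, and the entry [M.1.2] then gives
    the second component: they are coordinates on the plane. *)
Lemma form_coercive M m : m != 0 -> m != m^-1 -> M.1.2 != 0 ->
  exists2 K : R, 0 < K &
    forall x, nrm2 x <= K * (normc (formA M m x) ^+ 2 + normc (formA M m^-1 x) ^+ 2).
Proof.
move=> m0 mm M0.
pose d := (m - m^-1)^-1; have d0 : m - m^-1 != 0 by rewrite subr_eq0.
pose p := M.1.2^-1.
pose K := normc d + normc (p * (1 - (m - M.2.2) * d)) + normc (p * (m - M.2.2) * d) + 1.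
have h1 := normc_ge0 d; have h2 := normc_ge0 (p * (1 - (m - M.2.2) * d)).
have h3 := normc_ge0 (p * (m - M.2.2) * d).
exists (2 * K ^+ 2 + 2 * K ^+ 2); first by rewrite addr_gt0// mulr_gt0// exprn_gt0// /K; lra.
move=> x; set a := formA M m x; set b := formA M m^-1 x.
have E1 : x.1 = d * a + - d * b.
  by rewrite /d /a /b /formA; move: d0; set n := m^-1 => d0; field.
have E2 : x.2 = p * (1 - (m - M.2.2) * d) * a + p * (m - M.2.2) * d * b.
  by rewrite /p /d /a /b /formA; move: d0; set n := m^-1 => d0; field; rewrite M0 d0.
have := @lin_bound d (- d) (a, b) K; rewrite normcN /= -E1 => H1.
have := @lin_bound (p * (1 - (m - M.2.2) * d)) (p * (m - M.2.2) * d) (a, b) K; rewrite /= -E2 => H2.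
have {}H1 : normc x.1 ^+ 2 <= 2 * K ^+ 2 * nrm2 (a, b) by apply: H1; rewrite /K; lra.
have {}H2 : normc x.2 ^+ 2 <= 2 * K ^+ 2 * nrm2 (a, b) by apply: H2; rewrite /K; lra.
rewrite /nrm2 /= in H1 H2 *; lra.
Qed.

(** The entry in [hyp_off] makes the two left eigenvectors given by [formA] independent. For the
    monodromy matrix it is S(z, d), which is nonzero off the bands because S(z, d) = 0 forces L = 1
    or L = -1. *)
Record hyperbolic M m : Prop := Hyperbolic {
  hyp_det : mdet M = 1;
  hyp_tr : mtr M = m + m^-1;
  hyp_neq0 : m != 0;
  hyp_lt1 : normc m < 1;
  hyp_off : M.1.2 != 0 }.

Lemma hyp_neqV M m : hyperbolic M m -> m != m^-1.
Proof.
case=> _ _ m0 m1 _; apply/eqP => E.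
have : normc m * normc m = 1 by rewrite {2}E -normcM mulfV// normc1.
have := normc_ge0 m; nra.
Qed.

Lemma lyap_step T M m : hyperbolic M m -> mcvg T M ->
  exists N (c C : R), [/\ 0 < c, 0 < C & forall n x y, (N <= n)%N ->
    lyap M m x + c * nrm2 x - C * nrm2 y <= lyap M m (vadd (mapp (T n) x) y)].
Proof.
move=> hM TM; have mV := hyp_neqV hM; case: hM => dM tM m0 m1 M0.
have [KA KA0 HA] := formA_bound M m; have [KB KB0 HB] := formA_bound M m^-1.
have [K K0 HK] := form_coercive m0 mV M0.
pose s := normc m ^+ 2; have nm0 : 0 < normc m by rewrite normc_gt0.
have s0 : 0 < s by rewrite exprn_gt0.
have s1 : s < 1 by rewrite /s expr_lt1// ltW.
(* The weight in the inequalities for squares of sums: (1 + k) s <= 1 - k is the same as (1 - s)^2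
   >= 0, and a surplus of k times the squares of both forms is left over. *)
pose k := (1 - s) / 2; have k0 : 0 < k by rewrite /k; lra.
pose P := KA + KB; have P0 : 0 < P by rewrite /P; lra.
pose Q := 1 + 2 * k^-1; have Q0 : 0 < Q by rewrite /Q ltr_pwDr// mulr_gt0 ?invr_gt0//.
pose c := k / (2 * K); have c0 : 0 < c by rewrite divr_gt0//; lra.
(* The surplus is at least [2 * c * nrm2 x]. This bound on the squared distance of [T n] from [M]
   spends half of it on the perturbation. *)
pose e2 := c / (8 * (Q * P)); have e20 : 0 < e2.
  by rewrite divr_gt0// mulr_gt0// mulr_gt0.
pose e := Num.sqrt e2; have e0 : 0 < e by rewrite sqrtr_gt0.
have [N HN] := TM e e0; exists N, c, (2 * (Q * P)); split => //.
  by rewrite mulr_gt0// mulr_gt0.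
move=> n x y Nn.
pose r := vadd (mapp (msub (T n) M) x) y.
have Er : vadd (mapp (T n) x) y = vadd (mapp M x) r.
  by rewrite /vadd /r /mapp /=; congr (_, _); ring.
have hr : nrm2 r <= 2 * (4 * e2) * nrm2 x + 2 * nrm2 y.
  apply: (le_trans (nrm2D _ _)).
  have := mapp_bound x (HN n Nn); rewrite /e sqr_sqrtr; [lra|exact: ltW].
have m0' : m^-1 != 0 by rewrite invr_eq0.
have EA : formA M m (vadd (mapp M x) r) = m * formA M m x + formA M m r.
  by rewrite formA_add formA_mapp.
have EB : formA M m^-1 (vadd (mapp M x) r) = m^-1 * formA M m^-1 x + formA M m^-1 r.
  by rewrite formA_add formA_mapp// invrK addrC.
rewrite Er /lyap EA EB.
set a := formA M m x; set b := formA M m^-1 x.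
have ub := sqr_normcD_le_eps (m * a) (formA M m r) k0.
have lb := sqr_normcD_ge_eps (m^-1 * b) (formA M m^-1 r) k0.
rewrite normcM exprMn -/s in ub; rewrite normcM exprMn normcV exprVn -/s in lb.
have hA := HA r; have hB := HB r; have hK := HK x; rewrite -/a -/b in hK.
have b2 := sqr_ge0 (normc b); have a2 := sqr_ge0 (normc a).
have kV : 0 < k^-1 by rewrite invr_gt0.
have L1 : (1 + k) * normc b ^+ 2 <= (1 - k) * (s^-1 * normc b ^+ 2).
  rewrite (mulrA (1 - k)) ler_wpM2r// ler_pdivlMr// /k.
  have : 0 <= (1 - s) ^+ 2 by exact: sqr_ge0.
  by rewrite sqrrB; lra.
have L2 : (1 + k) * (s * normc a ^+ 2) <= (1 - k) * normc a ^+ 2.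
  rewrite (mulrA (1 + k)) ler_wpM2r// /k.
  have : 0 <= (1 - s) ^+ 2 by exact: sqr_ge0.
  by rewrite sqrrB; lra.
have L3 : k^-1 * normc (formA M m^-1 r) ^+ 2 <= k^-1 * (KB * nrm2 r) by rewrite ler_wpM2l// ltW.
have L4 : (1 + k^-1) * normc (formA M m r) ^+ 2 <= (1 + k^-1) * (KA * nrm2 r).
  by rewrite ler_wpM2l//; lra.
have r0 := nrm2_ge0 r.
have L5 : k^-1 * (KB * nrm2 r) + (1 + k^-1) * (KA * nrm2 r) <= Q * P * nrm2 r.
  have -> : Q * P * nrm2 r = k^-1 * (KB * nrm2 r) + (1 + k^-1) * (KA * nrm2 r)
     + (1 + k^-1) * KB * nrm2 r + k^-1 * KA * nrm2 r by rewrite /Q /P; ring.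
  have h1 : 0 <= (1 + k^-1) * KB * nrm2 r by apply: mulr_ge0 => //; apply: mulr_ge0 => //; apply/ltW; lra.
  have h2 : 0 <= k^-1 * KA * nrm2 r by apply: mulr_ge0 => //; apply: mulr_ge0; apply/ltW.
  lra.
have L6 : Q * P * nrm2 r <= c * nrm2 x + 2 * (Q * P) * nrm2 y.
  have QP0 : 0 < Q * P by rewrite mulr_gt0.
  have -> : c * nrm2 x + 2 * (Q * P) * nrm2 y = Q * P * (2 * (4 * e2) * nrm2 x + 2 * nrm2 y).
    by rewrite /e2; field; rewrite !gt_eqF.
  by rewrite ler_pM2l.
have L7 : 2 * c * nrm2 x <= k * (normc a ^+ 2 + normc b ^+ 2).
  have -> : 2 * c = k / K by rewrite /c; field; rewrite gt_eqF.
  have -> : k / K * nrm2 x = k * (nrm2 x / K) by ring.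
  by rewrite ler_pM2l// ler_pdivrMr// mulrC.
lra.
Qed.

(** * Square-summable solutions *)

Lemma sum2_small v (S : R) : sum2_le v S -> forall e, 0 < e -> forall m,
  exists2 n, (m <= n)%N & nrm2 (v n) <= e.
Proof.
move=> vS e e0 m; apply: contrapT => H.
have {}H n : (m <= n)%N -> e < nrm2 (v n).
  by move=> mn; rewrite ltNge; apply/negP => h; apply: H; exists n.
have L k : k%:R * e <= \sum_(n < m + k) nrm2 (v n).
  elim: k => [|k IH].
    by rewrite mul0r; apply: sumr_ge0 => i _; exact: nrm2_ge0.
  rewrite addnS big_ord_recr/= -natr1 mulrDl mul1r lerD//.
  by apply/ltW/H; rewrite leq_addr.
have S0 : 0 <= S by apply: le_trans (vS 0%N); rewrite big_ord0.
have h1 := archi_boundP (divr_ge0 S0 (ltW e0)).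
have := le_trans (L (Num.bound (S / e))) (vS _).
rewrite -ler_pdivlMr// => h2.
by have := lt_le_trans h1 h2; rewrite ltxx.
Qed.

Lemma lyap_sum T M m (N : nat) (c C : R) v w :
  (forall n x y, (N <= n)%N ->
    lyap M m x + c * nrm2 x - C * nrm2 y <= lyap M m (vadd (mapp (T n) x) y)) ->
  is_sol T w v -> forall k,
  c * \sum_(n < k) nrm2 (v (N + n)%N) <=
    lyap M m (v (N + k)%N) - lyap M m (v N) + C * \sum_(n < k) nrm2 (w (N + n)%N).
Proof.
move=> H sv; elim=> [|k IH]; first by rewrite !big_ord0 !mulr0 addn0 subrr addr0.
rewrite !big_ord_recr/= addnS sv (mulrDr c) (mulrDr C).
have := H (N + k)%N (v (N + k)%N) (w (N + k)%N) (leq_addr _ _); lra.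
Qed.

Lemma sum2_shift v (S : R) N : sum2_le v S -> sum2_le (fun n => v (N + n)%N) S.
Proof.
move=> H m; apply: le_trans (H (N + m)%N); rewrite big_split_ord/= lerDr.
by apply: sumr_ge0 => i _; exact: nrm2_ge0.
Qed.

(** A crude bound for the initial stretch, on which the matrices need not be close to their
    limit. *)
Lemma finite_growth T N : exists2 K : R, 0 < K & forall v w (W : R), is_sol T w v ->
  sum2_le w W -> forall n, (n <= N)%N -> nrm2 (v n) <= K * (nrm2 (v 0%N) + W).
Proof.
elim: N => [|N [K K0 IH]].
  exists 1 => // v w W _ wW n; rewrite leqn0 => /eqP ->.
  have : 0 <= W by apply: le_trans (wW 0%N); rewrite big_ord0.
  lra.
pose B := normc (T N).1.1 + normc (T N).1.2 + normc (T N).2.1 + normc (T N).2.2.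
have b1 := normc_ge0 (T N).1.1; have b2 := normc_ge0 (T N).1.2.
have b3 := normc_ge0 (T N).2.1; have b4 := normc_ge0 (T N).2.2.
have hB : mbound (T N) B by split; rewrite /B; lra.
have B2 : 0 <= B ^+ 2 by exact: sqr_ge0.
have BK : 0 <= B ^+ 2 * K by rewrite mulr_ge0// ltW.
exists (K + 8 * (B ^+ 2 * K) + 2); first lra.
move=> v w W sv wW n; have W0 : 0 <= W by apply: le_trans (wW 0%N); rewrite big_ord0.
have x0 := nrm2_ge0 (v 0%N).
have m1 : 0 <= B ^+ 2 * K * (nrm2 (v 0%N) + W) by rewrite mulr_ge0//; lra.
rewrite leq_eqVlt => /predU1P[->|nN]; last first.
  have := IH v w W sv wW n nN; lra.
have hw : nrm2 (w N) <= W.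
  apply: le_trans (wW N.+1); rewrite big_ord_recr/= lerDr.
  by apply: sumr_ge0 => i _; exact: nrm2_ge0.
rewrite sv; have h1 := nrm2D (mapp (T N) (v N)) (w N).
have h2 := mapp_bound (v N) hB.
have h3 : 4 * B ^+ 2 * nrm2 (v N) <= 4 * B ^+ 2 * (K * (nrm2 (v 0%N) + W)).
  apply: ler_wpM2l; first lra.
  exact: IH sv wW N (leqnn N).
have : 0 <= K * (nrm2 (v 0%N) + W) by rewrite mulr_ge0//; lra.
lra.
Qed.

(** In the summed Lyapunov inequality the value at the far end is bounded by its expanding part, and
    along an l2 solution there are arbitrarily late times at which this is at most [e]. What remains
    is the contracting part of the datum at [N] and the inhomogeneity. *)
Lemma l2_apriori T M m : hyperbolic M m -> mcvg T M ->
  exists2 K : R, 0 < K & forall v w (W : R), is_sol T w v -> l2seq v -> sum2_le w W ->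
    sum2_le v (K * (nrm2 (v 0%N) + W)).
Proof.
move=> hM TM; have [N [c [C [c0 C0 HL]]]] := lyap_step hM TM.
have [K K0 HK] := finite_growth T N.
have [KA KA0 HA] := formA_bound M m; have [KB KB0 HB] := formA_bound M m^-1.
pose P := N%:R * K; have P0 : 0 <= P by rewrite /P mulr_ge0// ltW.
have KAK : 0 < KA * K by rewrite mulr_gt0.
have Q0 : 0 < (KA * K + C) / c by rewrite divr_gt0//; lra.
exists (P + (KA * K + C) / c); first lra.
move=> v w W sv [S vS] wW k.
have W0 : 0 <= W by apply: le_trans (wW 0%N); rewrite big_ord0.
have x0 := nrm2_ge0 (v 0%N).
have X0 : 0 <= nrm2 (v 0%N) + W by lra.
have tail j : \sum_(n < j) nrm2 (v (N + n)%N) <= (KA * K + C) / c * (nrm2 (v 0%N) + W).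
  rewrite mulrAC ler_pdivlMr// mulrC; apply/ler_addgt0Pl => e e0.
  have [|n jn Hn] := sum2_small (sum2_shift N vS) (e := e / KB) _ j.
    by rewrite divr_gt0.
  apply: (@le_trans _ _ (c * \sum_(i < n) nrm2 (v (N + i)%N))).
    rewrite ler_pM2l// -!(big_mkord predT (fun i => nrm2 (v (N + i)%N))).
    rewrite (big_cat_nat (leq0n j) jn)/= lerDl.
    by apply: sumr_ge0 => i _; exact: nrm2_ge0.
  apply: (le_trans (lyap_sum HL sv n)); rewrite /lyap.
  have h1 := HB (v (N + n)%N); have h2 := sqr_ge0 (normc (formA M m (v (N + n)%N))).
  have h3 := HA (v N); have h4 := sqr_ge0 (normc (formA M m^-1 (v N))).
  have h5 : KB * nrm2 (v (N + n)%N) <= e by rewrite mulrC -ler_pdivlMr.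
  have h6 : KA * nrm2 (v N) <= KA * (K * (nrm2 (v 0%N) + W)).
    by rewrite ler_pM2l//; exact: HK sv wW N (leqnn N).
  have h7 : C * \sum_(i < n) nrm2 (w (N + i)%N) <= C * W.
    by rewrite ler_pM2l//; exact: sum2_shift wW n.
  have h8 : 0 <= C * nrm2 (v 0%N) by rewrite mulr_ge0// ltW.
  lra.
have head j : (j <= N)%N -> \sum_(n < j) nrm2 (v n) <= P * (nrm2 (v 0%N) + W).
  move=> jN; apply: (@le_trans _ _ (\sum_(n < j) K * (nrm2 (v 0%N) + W))).
    apply: ler_sum => i _; apply: (HK v w W sv wW).
    exact: leq_trans (ltnW (ltn_ord i)) jN.
  rewrite sumr_const card_ord -mulr_natl.
  have -> : P * (nrm2 (v 0%N) + W) = N%:R * (K * (nrm2 (v 0%N) + W)) by rewrite /P; ring.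
  rewrite ler_wpM2r//.
    by rewrite mulr_ge0// ltW.
  by rewrite ler_nat.
rewrite mulrDl; have [kN|/ltnW Nk] := leqP k N.
  have h := head k kN; have h' : 0 <= (KA * K + C) / c * (nrm2 (v 0%N) + W).
    by rewrite mulr_ge0// ltW.
  by apply: (le_trans h); rewrite lerDl.
rewrite -(subnKC Nk) big_split_ord/=.
by apply: lerD; [exact: head|exact: tail].
Qed.

Lemma sol_vadd T w w' x y n :
  sol T (fun n => vadd (w n) (w' n)) (vadd x y) n = vadd (sol T w x n) (sol T w' y n).
Proof. by elim: n => [//|n /= ->]; rewrite /vadd /mapp /=; congr (_, _); ring. Qed.

Lemma sol_scale T k x n : sol T vzero (vscale k x) n = vscale k (sol T vzero x n).
Proof. by elim: n => [//|n /= ->]; rewrite /vadd /mapp /vscale /=; congr (_, _); ring. Qed.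

Lemma sol_vadd0 T w x y n :
  sol T w (vadd x y) n = vadd (sol T w x n) (sol T vzero y n).
Proof.
rewrite -sol_vadd; congr (sol T _ _ n); apply/funext => i.
by rewrite /vadd /= !addr0; case: (w i).
Qed.

(* Completeness through a supremum: no rate is needed. *)
Lemma cauchy_limit (u r : nat -> R) : (forall i j, `|u i - u j| <= r i + r j) ->
  exists l, forall i, `|u i - l| <= r i.
Proof.
move=> H.
suff [l Hl] : exists l, forall i, u i - r i <= l /\ l <= u i + r i.
  by exists l => i; have [h1 h2] := Hl i; rewrite ler_norml; lra.
pose A := range (fun i => u i - r i).
have ub j : ubound A (u j + r j).
  by move=> _ [i _ <-]; have := H i j; rewrite ler_norml => /andP[]; lra.
have supA : has_sup A by split; [exists (u 0%N - r 0%N), 0%N|exists (u 0%N + r 0%N)].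
exists (sup A) => i; split; first by apply: ub_le_sup; [case: supA|exists i].
by apply: ge_sup => //; case: supA.
Qed.

Lemma cauchy_limitC (u : nat -> R[i]) (r : nat -> R) :
  (forall i j, normc (u i - u j) <= r i + r j) ->
  exists l, forall i, normc (u i - l) <= 2 * r i.
Proof.
move=> H.
have [i j|a Ha] := @cauchy_limit (fun i => complex.Re (u i)) r.
  by rewrite -ReB; exact: le_trans (Re_le_normc _) (H i j).
have [i j|b Hb] := @cauchy_limit (fun i => complex.Im (u i)) r.
  by rewrite -ImB; exact: le_trans (Im_le_normc _) (H i j).
exists (a +i* b) => i; apply: (le_trans (normc_le_ReIm _)); rewrite ReB ImB /=.
by have := Ha i; have := Hb i; lra.
Qed.

(* Approximate by the solutions with vanishing expanding component at time k. *)
Lemma l2_solution_from T M m w (W : R) (c C : R) (alpha : R[i]) : hyperbolic M m ->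
  0 < c -> 0 < C ->
  (forall n x y, lyap M m x + c * nrm2 x - C * nrm2 y <= lyap M m (vadd (mapp (T n) x) y)) ->
  sum2_le w W -> exists2 x, formA M m x = alpha & l2seq (sol T w x).
Proof.
move=> hM c0 C0 HL wW; have mV := hyp_neqV hM; have [_ _ m0 m1 M0] := hM.
have W0 : 0 <= W by apply: le_trans (wW 0%N); rewrite big_ord0.
have HLs v w' k : is_sol T w' v -> c * \sum_(n < k) nrm2 (v n) <=
    lyap M m (v k) - lyap M m (v 0%N) + C * \sum_(n < k) nrm2 (w' n).
  by move=> sv; have := @lyap_sum T M m 0 c C v w' (fun n x y _ => HL n x y) sv k.
have [KB KB0 HB] := formA_bound M m^-1.
pose dm := (m - m^-1)^-1; have dm0 : m - m^-1 != 0 by rewrite subr_eq0.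
(* Coordinates adapted to the dichotomy: [vec_of a b] has contracting component a and expanding
   component b, as measured by the two forms. *)
pose vec_of (a b : R[i]) : vec := (dm * (a - b), (a - (m - M.2.2) * (dm * (a - b))) / M.1.2).
have fa a b : formA M m (vec_of a b) = a by rewrite /formA /vec_of /=; field.
have fb a b : formA M m^-1 (vec_of a b) = b.
  have -> : formA M m^-1 (vec_of a b) = formA M m (vec_of a b) - (m - m^-1) * (vec_of a b).1.
    by rewrite /formA; ring.
  by rewrite fa /= /dm mulrA mulfV// mul1r; ring.
have vD a b a' b' : vadd (vec_of a b) (vec_of a' b') = vec_of (a + a') (b + b').
  by rewrite /vadd /vec_of /=; congr (_, _); field.
have vZ k a b : vscale k (vec_of a b) = vec_of (k * a) (k * b).
  by rewrite /vscale /vec_of /=; congr (_, _); field.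
pose hom1 := sol T vzero (vec_of 0 1).
(* A homogeneous solution which starts with contracting component 0 keeps an expanding component at
   least as large as its initial one, since [lyap] does not decrease. This makes the shooting
   equation in [exb] solvable. *)
have hom_grow b k : normc b ^+ 2 <= normc (formA M m^-1 (sol T vzero (vec_of 0 b) k)) ^+ 2.
  have := HLs _ _ k (sol_is_sol T vzero (vec_of 0 b)); rewrite /lyap /= fa fb normc0.
  have -> : \sum_(n < k) nrm2 (vzero n) = 0.
    by apply: big1 => i _; rewrite /nrm2 /= normc0 expr0n addr0.
  have : 0 <= c * \sum_(n < k) nrm2 (sol T vzero (vec_of 0 b) n).
    by apply: mulr_ge0; [exact: ltW|apply: sumr_ge0 => i _; exact: nrm2_ge0].
  have := sqr_ge0 (normc (formA M m (sol T vzero (vec_of 0 b) k))).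
  rewrite expr0n mulr0 /=; lra.
have exb k : exists b, formA M m^-1 (sol T w (vec_of alpha b) k) = 0.
  have h0 : formA M m^-1 (hom1 k) != 0.
    have := hom_grow 1 k; rewrite normc1 expr1n => h.
    by rewrite -normc_gt0 lt_def normc_ge0 andbT; apply/eqP => E; move: h; rewrite -[sol _ _ _ k]/(hom1 k) E expr0n /= ler10.
  exists (- formA M m^-1 (sol T w (vec_of alpha 0) k) / formA M m^-1 (hom1 k)).
  set b := _ / _.
  have -> : vec_of alpha b = vadd (vec_of alpha 0) (vscale b (vec_of 0 1)).
    by rewrite vZ vD mulr0 mulr1 addr0 add0r.
  rewrite sol_vadd0 sol_scale formA_add formA_scale -/hom1 /b mulfVK// addrN//.
have [beta Hbeta] := choice exb.
pose B := (normc alpha ^+ 2 + C * W) / c.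
have B0 : 0 <= B.
  apply: divr_ge0; last exact: ltW.
  by apply: addr_ge0; [exact: sqr_ge0|apply: mulr_ge0 => //; exact: ltW].
pose x k := vec_of alpha (beta k).
have xB k j : (j <= k)%N -> \sum_(n < j) nrm2 (sol T w (x k) n) <= B.
  move=> jk; apply: (@le_trans _ _ (\sum_(n < k) nrm2 (sol T w (x k) n))).
    rewrite -!(big_mkord predT (fun n => nrm2 (sol T w (x k) n))).
    rewrite (big_cat_nat (leq0n j) jk)/= lerDl.
    by apply: sumr_ge0 => i _; exact: nrm2_ge0.
  rewrite /B ler_pdivlMr// mulrC; apply: (le_trans (HLs _ _ k (sol_is_sol T w (x k)))).
  rewrite /lyap Hbeta normc0 expr0n /= fa fb.
  have h1 := sqr_ge0 (normc (formA M m (sol T w (x k) k))).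
  have h2 := sqr_ge0 (normc (beta k)).
  have h3 : C * \sum_(n < k) nrm2 (w n) <= C * W by rewrite ler_pM2l.
  rewrite /=; lra.
have diff i j n : sol T w (x i) n = vadd (sol T w (x j) n) (sol T vzero (vec_of 0 (beta i - beta j)) n).
  by rewrite -sol_vadd0 vD addr0 addrC subrK.
(* The solutions for two shooting times differ by a homogeneous one whose expanding component is at
   least |beta i - beta j| at each time before i, while both have square sums at most [B] up to
   then. *)
have cauchy_le i j : (i <= j)%N -> i%:R * normc (beta i - beta j) ^+ 2 <= KB * (4 * B).
  move=> ij.
  have h n : normc (beta i - beta j) ^+ 2 <=
      KB * (2 * nrm2 (sol T w (x i) n) + 2 * nrm2 (sol T w (x j) n)).
    apply: (le_trans (hom_grow _ n)); apply: (le_trans (HB _)); rewrite ler_pM2l//.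
    have -> : sol T vzero (vec_of 0 (beta i - beta j)) n =
       vadd (sol T w (x i) n) (vscale (-1) (sol T w (x j) n)).
      rewrite (diff i j n) [RHS]/vadd /vscale /=; case: (sol T vzero _ _) => p q /=.
      by congr (_, _); ring.
    by apply: (le_trans (nrm2D _ _)); rewrite nrm2Z normcN normc1 expr1n mul1r.
  have : \sum_(n < i) normc (beta i - beta j) ^+ 2 <=
      \sum_(n < i) KB * (2 * nrm2 (sol T w (x i) n) + 2 * nrm2 (sol T w (x j) n)).
    by apply: ler_sum => n _; exact: h.
  move=> hs; rewrite sumr_const card_ord -(mulr_natl _ i) in hs; apply: (le_trans hs).
  rewrite -mulr_sumr big_split/= -!mulr_sumr ler_pM2l//.
  have h1 := xB i i (leqnn i); have h2 := xB j i ij.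
  move: h1 h2; set s1 := \sum_(_ < _) _; set s2 := \sum_(_ < _) _; lra.
pose D := KB * (4 * B); have D0 : 0 <= D by apply: mulr_ge0; [exact: ltW|lra].
(* The index is shifted by one because the previous estimate is void for i = 0. *)
pose rr k : R := Num.sqrt (D / k.+1%:R).
have rr0 k : 0 <= rr k by exact: sqrtr_ge0.
have rrP i j : (i <= j)%N -> normc (beta i.+1 - beta j.+1) <= rr i.
  move=> ij; have h := cauchy_le i.+1 j.+1 ij.
  rewrite -(ger0_norm (normc_ge0 _)) -sqrtr_sqr ler_sqrt; last exact: divr_ge0.
  by rewrite ler_pdivlMr// mulrC.
have [i j|b Hb] := @cauchy_limitC (fun i => beta i.+1) rr.
  have [ij|/ltnW ji] := leqP i j.
    by have := rrP i j ij; have := rr0 j; lra.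
  by rewrite normcBC; have := rrP j i ji; have := rr0 i; lra.
exists (vec_of alpha b); first exact: fa.
exists (2 * B + 1) => j.
pose H := \sum_(n < j) nrm2 (hom1 n).
have H0 : 0 <= H by apply: sumr_ge0 => i _; exact: nrm2_ge0.
have DH : 0 <= 8 * D * H by apply: mulr_ge0 => //; lra.
(* So large that replacing the shooting parameter by its limit costs at most 1/2 in the square sum
   over the first [j] steps, before the doubling by [nrm2D]. *)
pose k := maxn j (Num.bound (8 * D * H)).
have jk : (j <= k.+1)%N by rewrite ltnW// ltnS leq_maxl.
have hk : 8 * D * H <= k.+1%:R.
  apply/ltW/(lt_le_trans (archi_boundP DH)); rewrite ler_nat.
  by rewrite ltnW// ltnS leq_maxr.
have E n : sol T w (vec_of alpha b) n =
    vadd (sol T w (x k.+1) n) (vscale (b - beta k.+1) (hom1 n)).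
  rewrite -sol_scale -sol_vadd0 vZ vD; congr (sol T w _ n).
  by rewrite mulr0 mulr1 addr0; congr vec_of; ring.
have hb : normc (b - beta k.+1) ^+ 2 * H <= 2^-1.
  have h1 : normc (b - beta k.+1) ^+ 2 <= 4 * (D / k.+1%:R).
    rewrite normcBC -(sqr_sqrtr (a := D / k.+1%:R)); last exact: divr_ge0.
    have -> : 4 * Num.sqrt (D / k.+1%:R) ^+ 2 = (2 * rr k) ^+ 2 by rewrite /rr; ring.
    by rewrite ler_sqr ?nnegrE ?normc_ge0 ?mulr_ge0.
  apply: (@le_trans _ _ (4 * (D / k.+1%:R) * H)); first by rewrite ler_wpM2r.
  have -> : 4 * (D / k.+1%:R) * H = 2^-1 * (8 * D * H / k.+1%:R).
    have t0 : (k.+1%:R : R) != 0 by rewrite pnatr_eq0.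
    by move: (k.+1%:R : R) t0 => t t0; field.
  by rewrite ler_piMr ?invr_ge0// ler_pdivrMr// mul1r.
apply: (@le_trans _ _ (\sum_(n < j) (2 * nrm2 (sol T w (x k.+1) n) +
   2 * (normc (b - beta k.+1) ^+ 2 * nrm2 (hom1 n))))).
  by apply: ler_sum => i _; rewrite E -nrm2Z; exact: nrm2D.
rewrite big_split/= -!mulr_sumr -/H.
by have := xB k.+1 j jk; set s1 := \sum_(_ < _) _; lra.
Qed.

Definition minv M : mat := ((M.2.2, - M.1.2), (- M.2.1, M.1.1)).

Lemma minvK M x : mdet M = 1 -> mapp M (mapp (minv M) x) = x.
Proof.
move=> dM; rewrite /mapp /minv /=; case: x => a b /=.
by congr (_, _); [rewrite -[RHS]mul1r|rewrite -[RHS]mul1r]; rewrite -dM /mdet; ring.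
Qed.

(** Determinant 1 lets the recursion run backwards from a prescribed value at time [N]. *)
Lemma sol_reaches T w N y : (forall n, mdet (T n) = 1) -> exists x, sol T w x N = y.
Proof.
move=> dT; elim: N y => [|N IH] y; first by exists y.
have [x Hx] := IH (mapp (minv (T N)) (vadd y (vscale (-1) (w N)))).
exists x; rewrite /= Hx minvK//; case: y {Hx} => a b.
by rewrite /vadd /vscale /=; congr (_, _); ring.
Qed.

Lemma sol_split T w x N n :
  sol T w x (N + n)%N = sol (fun n => T (N + n)%N) (fun n => w (N + n)%N) (sol T w x N) n.
Proof. by elim: n => [|n IH]; rewrite ?addn0// addnS /= IH. Qed.

Lemma l2seq_shift v N : l2seq (fun n => v (N + n)%N) -> l2seq v.
Proof.
move=> [S HS]; exists (\sum_(n < N) nrm2 (v n) + S) => k.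
apply: (@le_trans _ _ (\sum_(n < N + k) nrm2 (v n))).
  rewrite -!(big_mkord predT (fun n => nrm2 (v n))).
  rewrite (big_cat_nat (leq0n k) (leq_addl N k))/= lerDl.
  by apply: sumr_ge0 => i _; exact: nrm2_ge0.
by rewrite big_split_ord/= lerD2l; exact: HS.
Qed.

(** The Lyapunov inequality holds from time [N] on, where the contracting component of the datum can
    be prescribed. The value 0 serves for the inhomogeneous recursion; the value 1 with zero
    inhomogeneity gives a nontrivial solution. Both are continued backwards to time 0. *)
Lemma l2_solutions T M m : hyperbolic M m -> mcvg T M -> (forall n, mdet (T n) = 1) ->
  (forall w W, sum2_le w W -> exists2 v, is_sol T w v & l2seq v) /\
  (exists v, [/\ is_sol T vzero v, l2seq v & v 0%N != (0, 0)]).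
Proof.
move=> hM TM dT; have [N [c [C [c0 C0 HL]]]] := lyap_step hM TM.
have HL' n x y : lyap M m x + c * nrm2 x - C * nrm2 y <=
    lyap M m (vadd (mapp (T (N + n)%N) x) y) by apply: HL; exact: leq_addr.
have main w W alpha : sum2_le w W -> exists v, [/\ is_sol T w v, l2seq v
    & formA M m (v N) = alpha].
  move=> wW; have [y ya ly] := l2_solution_from alpha hM c0 C0 HL' (sum2_shift N wW).
  have [x xy] := sol_reaches w N y dT.
  exists (sol T w x); split; [exact: sol_is_sol| |by rewrite xy].
  apply: (l2seq_shift (N := N)); case: ly => S HS; exists S => k.
  by under eq_bigr do rewrite sol_split xy; exact: HS.
split.
  by move=> w W /(main _ _ 0)[v [h1 h2 _]]; exists v.
have z2 : sum2_le vzero 0.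
  by move=> k; rewrite big1// => i _; rewrite /nrm2 /= normc0 expr0n addr0.
have [v [h1 h2 h3]] := main _ _ 1 z2; exists v; split => //.
apply/eqP => v0; suff vN n : v n = (0, 0).
  by move: h3; rewrite vN /formA /= !mulr0 addr0 => /eqP; rewrite eq_sym oner_eq0.
elim: n => [//|n IH]; rewrite h1 IH /vadd /mapp /=; congr (_, _); ring.
Qed.

(** * Wronskians of square-summable solutions *)

Lemma wedge_mapp M x y : mdet M = 1 -> wedge (mapp M x) (mapp M y) = wedge x y.
Proof. by move=> dM; rewrite -[RHS]mul1r -dM /wedge /mdet /mapp /=; ring. Qed.

Lemma wedge_le x y (k : R) : 0 < k -> normc (wedge x y) <= k / 2 * nrm2 x + (2 * k)^-1 * nrm2 y.
Proof.
move=> k0; apply: (le_trans (normcB _ _)); rewrite !normcM.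
have am (a b : R) : a * b <= k / 2 * a ^+ 2 + (2 * k)^-1 * b ^+ 2.
  have : 0 <= (k * a - b) ^+ 2 / (2 * k) by rewrite divr_ge0 ?sqr_ge0//; lra.
  have -> : (k * a - b) ^+ 2 / (2 * k) = k / 2 * a ^+ 2 + (2 * k)^-1 * b ^+ 2 - a * b.
    by field; lra.
  lra.
have h1 := am (normc x.1) (normc y.2); have h2 := am (normc x.2) (normc y.1).
rewrite /nrm2; lra.
Qed.

Lemma amgm_optimal (D q L : R) : 0 <= D -> 0 <= q -> 0 < L ->
  (forall k, 0 < k -> D <= k / 2 * q + L / (2 * k)) -> D ^+ 2 <= L * q.
Proof.
move=> D0 q0 L0 main; have [->|D1] := eqVneq D 0.
  by rewrite expr0n /= mulr_ge0// ltW.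
have D2 : 0 < D by rewrite lt_def D1.
have := main (L / D); rewrite divr_gt0// => /(_ isT).
have -> : L / (2 * (L / D)) = D / 2 by field; lra.
move=> h; have h1 : D / 2 <= L / D / 2 * q by lra.
have : D / 2 * (2 * D) <= L / D / 2 * q * (2 * D) by rewrite ler_pM2r//; lra.
have -> : D / 2 * (2 * D) = D ^+ 2 by field.
by have -> : L / D / 2 * q * (2 * D) = L * q by field.
Qed.

(* Discrete Green formula: the Wronskian of v with a homogeneous l2 solution
   telescopes and tends to 0. *)
Lemma wronskian_bound T v w phi (W P : R) : (forall n, mdet (T n) = 1) ->
  is_sol T w v -> is_sol T vzero phi -> l2seq v -> sum2_le phi P -> sum2_le w W -> 0 < P ->
  normc (wedge (v 0%N) (phi 0%N)) ^+ 2 <= P * W.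
Proof.
move=> dT sv sp [S vS] pP wW P0.
have W0 : 0 <= W by apply: le_trans (wW 0%N); rewrite big_ord0.
have step n : wedge (v n.+1) (phi n.+1) = wedge (v n) (phi n) + wedge (w n) (phi n.+1).
  rewrite sv -(wedge_mapp (v n) (phi n) (dT n)) sp /wedge /vadd /=; ring.
apply: amgm_optimal => //; first exact: normc_ge0.
move=> k k0; have tele m : normc (wedge (v 0%N) (phi 0%N)) <= normc (wedge (v m) (phi m)) +
    \sum_(n < m) (k / 2 * nrm2 (w n) + (2 * k)^-1 * nrm2 (phi n.+1)).
  elim: m => [|m IH]; first by rewrite big_ord0 addr0.
  apply: (le_trans IH); rewrite big_ord_recr/= addrA addrAC lerD2r.
  have -> : wedge (v m) (phi m) = wedge (v m.+1) (phi m.+1) - wedge (w m) (phi m.+1).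
    by rewrite step addrK.
  by apply: (le_trans (normcB _ _)); rewrite lerD2l; exact: wedge_le.
apply/ler_addgt0Pl => e e0.
(* Both sequences are packed into one, with moduli as real and imaginary parts, so that a single
   index makes both small. *)
have vp : sum2_le (fun n => (normc (v n).1 +i* normc (v n).2, normc (phi n).1 +i* normc (phi n).2)) (S + P).
  move=> j; have := vS j; have := pP j.
  have -> : \sum_(n < j) nrm2 (normc (v n).1 +i* normc (v n).2, normc (phi n).1 +i* normc (phi n).2)
    = \sum_(n < j) nrm2 (v n) + \sum_(n < j) nrm2 (phi n).
    by rewrite -big_split/=; apply: eq_bigr => i _; rewrite /nrm2 !sqr_normcE.
  lra.
have [|m' _ Hm'] := @sum2_small _ _ vp e _ 0%N; first by [].
apply: (le_trans (tele m')).
have h0 : normc (wedge (v m') (phi m')) <= e.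
  apply: (le_trans (wedge_le _ _ ltr01)); move: Hm'; rewrite /nrm2 /= !sqr_normcE /=.
  have := nrm2_ge0 (v m'); have := nrm2_ge0 (phi m'); rewrite /nrm2 !sqr_normcE; lra.
rewrite big_split/= -!mulr_sumr.
have h1 : k / 2 * \sum_(n < m') nrm2 (w n) <= k / 2 * W.
  by rewrite ler_wpM2l//; lra.
have h2 : (2 * k)^-1 * \sum_(n < m') nrm2 (phi n.+1) <= (2 * k)^-1 * P.
  rewrite ler_wpM2l//; first by rewrite invr_ge0; lra.
  exact: (sum2_shift 1 pP m').
rewrite [P / _]mulrC; lra.
Qed.

End DiscreteDichotomy.

(** * Functions given by their data at the nodes *)

Section Nodes.
Context {R : realType}.
Implicit Types (f h g psi : R -> R[i]) (x alpha : nat -> R) (z : R[i]) (s e t l L kappa : R).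
Local Notation normc := (@Normc.normc R).
Local Notation mu := (@lebesgue_measure R).
Local Notation vec := (R[i] * R[i])%type.

(** Node 0 is the end point of the half-line, so that cell n lies between nodes n and n + 1 for
    every n. *)
Definition node x n : R := if n is 0%N then 0 else x n.

Definition regular x l L := 0 < l /\ forall n, l <= node x n.+1 - node x n <= L.

Section regular_nodes.
Variables (x : nat -> R) (l L : R).
Hypothesis reg : regular x l L.
Local Notation y := (node x).

Lemma node_ltS n : y n < y n.+1.
Proof. by have [l0 H] := reg; have /andP[] := H n; lra. Qed.

Lemma node_le m n : (m <= n)%N -> y m <= y n.
Proof.
move=> mn; rewrite -(subnK mn); elim: (n - m)%N => [//|k IH].
by rewrite addSn; apply: (le_trans IH); apply/ltW/node_ltS.
Qed.

Lemma node_ge0 n : 0 <= y n.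
Proof. by have := node_le (leq0n n). Qed.

Lemma node_lower n : n%:R * l <= y n.
Proof.
elim: n => [|n IH]; first by rewrite mul0r.
by have [l0 H] := reg; have /andP[h _] := H n; rewrite -natr1 mulrDl mul1r; lra.
Qed.

Lemma node_unbounded t : exists n, t < y n.
Proof.
have [l0 _] := reg; have [t0|t0] := leP 0 t; last by exists 0%N.
exists (Num.bound (t / l)); apply: lt_le_trans (node_lower _).
by rewrite -ltr_pdivrMr//; apply: archi_boundP; rewrite divr_ge0// ltW.
Qed.

(** Cells closed on the left serve to glue functions, cells closed on the right to decompose
    integrals. *)
Lemma cell_index_co t : 0 <= t -> exists n, y n <= t /\ t < y n.+1.
Proof.
move=> t0; have [n0 Hn0] := node_unbounded t.
have ex : exists n, t < y n by exists n0.
case: (ex_minnP ex) => [[|n]] tn Hn; first by move: tn; rewrite ltNge t0.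
exists n; split => //; rewrite leNgt; apply/negP => h.
by have := Hn n h; rewrite ltnn.
Qed.

Lemma cell_index_oc t : 0 < t -> exists n, y n < t /\ t <= y n.+1.
Proof.
move=> t0; have [n0 Hn0] := node_unbounded t.
have ex : exists n, t <= y n by exists n0; exact: ltW.
case: (ex_minnP ex) => [[|n]] tn Hn; first by move: tn; rewrite leNgt t0.
exists n; split => //; rewrite ltNge; apply/negP => h.
by have := Hn n h; rewrite ltnn.
Qed.

Definition holes := @halfline R `\` points x.

Lemma cell_holes n t : y n < t -> t < y n.+1 -> holes t.
Proof.
move=> nt tn; split.
  by rewrite /halfline /= in_itv/= andbT; exact: le_lt_trans (node_ge0 n) nt.
move=> [m m1 xm]; have ym : y m = t by case: m m1 xm.
have [mn|nm] := leqP m n.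
  by have := node_le mn; rewrite ym; lra.
by have := node_le nm; rewrite ym; lra.
Qed.

Lemma holes_cell t : holes t -> exists n, y n < t /\ t < y n.+1.
Proof.
move=> [t0 nt]; have {}t0 : 0 < t by move: t0; rewrite /halfline /= in_itv/= andbT.
have [n [h1 h2]] := cell_index_oc t0; exists n; split => //.
rewrite lt_neqAle h2 andbT; apply/eqP => E; apply: nt.
by exists n.+1.
Qed.

Lemma segment_holes_cell (a b : R) : a <= b -> `[a, b] `<=` holes ->
  exists n, y n < a /\ b < y n.+1.
Proof.
move=> ab sub; have /holes_cell[n [h1 h2]] : holes a by apply: sub; rewrite /= in_itv/= lexx.
exists n; split => //; rewrite ltNge; apply/negP => h.
have : holes (y n.+1) by apply: sub; rewrite /= in_itv/= h andbT ltW.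
by case=> _; apply; exists n.+1.
Qed.

Definition cells n : set R := `]y n, y n.+1].

Lemma halfline_cells : @halfline R = \bigcup_n cells n.
Proof.
apply/seteqP; split => t.
  rewrite /halfline /= in_itv/= andbT => /cell_index_oc[n [h1 h2]].
  by exists n => //; rewrite /cells /= in_itv/= h1.
move=> [n _]; rewrite /cells /halfline /= !in_itv/= andbT => /andP[h _].
exact: le_lt_trans (node_ge0 n) h.
Qed.

Lemma cells_trivIset : trivIset setT cells.
Proof.
apply/trivIsetP => i j _ _ ij; apply/seteqP; split => // t [].
rewrite /cells /= !in_itv/= => /andP[h1 h2] /andP[h3 h4].
move: ij; rewrite neq_ltn => /orP[ij|ji].
  by have /= := node_le ij; lra.
by have /= := node_le ji; lra.
Qed.

Lemma cells_measurable n : measurable (cells n).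
Proof. exact: measurable_itv. Qed.

Lemma cells_halfline n : cells n `<=` @halfline R.
Proof. by rewrite halfline_cells => t nt; exists n. Qed.

Lemma glue (F : nat -> R -> R[i]) : exists f, forall n t, y n <= t -> t < y n.+1 -> f t = F n t.
Proof.
have H t : exists n, 0 <= t -> y n <= t /\ t < y n.+1.
  have [t0|t0] := leP 0 t; last by exists 0%N.
  by have [n Hn] := cell_index_co t0; exists n.
have [idx Hidx] := choice H; exists (fun t => F (idx t) t) => n t nt tn.
have [h1 h2] := Hidx t (le_trans (node_ge0 n) nt).
congr (F _ t); apply/eqP; rewrite eqn_leq; apply/andP; split.
  by rewrite leqNgt; apply/negP => h; have := node_le h; lra.
by rewrite leqNgt; apply/negP => h; have := node_le h; lra.
Qed.

Lemma normc_sqr_measurable (D : set R) f : measurable D ->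
  measurable_fun D (fun t => complex.Re (f t)) ->
  measurable_fun D (fun t => complex.Im (f t)) -> measurable_fun D (fun t => normc (f t) ^+ 2).
Proof.
move=> mD m1 m2.
have -> : (fun t => normc (f t) ^+ 2) = (fun t => complex.Re (f t) ^+ 2 + complex.Im (f t) ^+ 2).
  by apply/funext => t; rewrite sqr_normcE.
by apply: measurable_funD; exact: measurable_funX.
Qed.

Lemma sqintegral_cells f : measurable_fun (@halfline R) (fun t => complex.Re (f t)) ->
  measurable_fun (@halfline R) (fun t => complex.Im (f t)) ->
  sqintegral f = (\sum_(0 <= n <oo) \int[mu]_(t in cells n) (normc (f t) ^+ 2)%:E)%E.
Proof.
move=> m1 m2; rewrite /sqintegral halfline_cells ge0_integral_bigcup//.
- exact: cells_measurable.
- rewrite -halfline_cells; apply/measurable_EFinP; apply: normc_sqr_measurable => //.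
  exact: measurable_itv.
- by move=> t _; rewrite lee_fin sqr_ge0.
- exact: cells_trivIset.
Qed.

Lemma inL2_sq_integrable f n : inL2 f -> sq_integrable (y n) (y n.+1) f.
Proof.
move=> [m1 m2 fin].
have mh : measurable (@halfline R) by exact: measurable_itv.
have n1 := measurable_funS mh (@cells_halfline n) m1.
have n2 := measurable_funS mh (@cells_halfline n) m2.
split => //; apply/integrableP; split.
  apply/measurable_EFinP; apply: normc_sqr_measurable => //; exact: measurable_itv.
apply: le_lt_trans fin; rewrite /sqintegral.
under eq_integral do rewrite abse_EFin ger0_norm ?sqr_ge0//.
apply: ge0_subset_integral => //.
- apply/measurable_EFinP; exact: normc_sqr_measurable.
- by move=> t _; rewrite lee_fin sqr_ge0.
- exact: cells_halfline.
Qed.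

Lemma energyE s e f : sq_integrable s e f ->
  (\int[mu]_(t in `]s, e]) (normc (f t) ^+ 2)%:E = (energy s e f)%:E)%E.
Proof.
move=> [_ _ i]; rewrite /energy /Rintegral fineK//.
by apply: integrable_fin_num => //; exact: measurable_itv.
Qed.

Lemma sum_energy_le f m : inL2 f ->
  \sum_(n < m) energy (y n) (y n.+1) f <= fine (sqintegral f).
Proof.
move=> Hf; have [m1 m2 fin] := Hf.
have q0 : (0 <= sqintegral f)%E by apply: integral_ge0 => t _; rewrite lee_fin sqr_ge0.
rewrite -lee_fin fineK ?ge0_fin_numE// sqintegral_cells// -sumEFin.
have -> : (\sum_(n < m) (energy (y n) (y n.+1) f)%:E =
  \sum_(0 <= n < m) \int[mu]_(t in cells n) (normc (f t) ^+ 2)%:E)%E.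
  by rewrite big_mkord; apply: eq_bigr => n _; rewrite -energyE//; exact: inL2_sq_integrable.
apply: nneseries_lim_ge => n _ _.
by apply: integral_ge0 => t _; rewrite lee_fin sqr_ge0.
Qed.

Lemma inL2_of_energy f (S : R) :
  measurable_fun (@halfline R) (fun t => complex.Re (f t)) ->
  measurable_fun (@halfline R) (fun t => complex.Im (f t)) ->
  (forall n, sq_integrable (y n) (y n.+1) f) ->
  (forall m, \sum_(n < m) energy (y n) (y n.+1) f <= S) ->
  inL2 f /\ fine (sqintegral f) <= S.
Proof.
move=> m1 m2 sf HS.
have q0 : (0 <= sqintegral f)%E by apply: integral_ge0 => t _; rewrite lee_fin sqr_ge0.
have le : (sqintegral f <= S%:E)%E.
  rewrite sqintegral_cells//; apply: lime_le.
    by apply: is_cvg_nneseries => n _ _; apply: integral_ge0 => t _; rewrite lee_fin sqr_ge0.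
  near=> m; have -> : (\sum_(0 <= n < m) \int[mu]_(t in cells n) (normc (f t) ^+ 2)%:E =
    \sum_(n < m) (energy (y n) (y n.+1) f)%:E)%E.
    by rewrite big_mkord; apply: eq_bigr => n _; rewrite -energyE.
  by rewrite sumEFin lee_fin.
have fin : (sqintegral f < +oo)%E by apply: le_lt_trans le _; rewrite ltry.
split => //; rewrite -lee_fin fineK// ge0_fin_numE//.
Unshelve. all: by end_near. Qed.

(** The datum at a node is the value together with the derivative from the right. The interaction is
    encoded in the limit of [f1] from the left, which is lower by alpha times the value; at node 0
    there are only limits from the right. *)
Definition cell_data alpha f f1 h (v : nat -> vec) :=
  [/\ forall n, cellsol (y n) (y n.+1) f f1 h,
      forall n, cvgC (y n)^'+ f (v n).1 /\ cvgC (y n)^'+ f1 (v n).2,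
      forall n, cvgC (y n.+1)^'- f (v n.+1).1 /\
        cvgC (y n.+1)^'- f1 ((v n.+1).2 - (alpha n.+1)%:C * (v n.+1).1) &
      forall n, f (y n.+1) = (v n.+1).1].

Definition bc kappa (v : vec) := v.1 * (cos kappa)%:C = v.2 * (sin kappa)%:C.

Lemma Hamiltonian_cell_data kappa alpha f h : Hamiltonian kappa x alpha (f, h) ->
  exists v, cell_data alpha f (cderive f) h v /\ bc kappa (v 0%N).
Proof.
move=> [[Df ACf ACf1 J] _ Hh [v0 [w0 [c0 d0 B0]]]].
have H n : exists u : vec, [/\ cvgC (y n)^'+ f u.1, cvgC (y n)^'+ (cderive f) u.2,
    n = 0%N -> u = (v0, w0) & (0 < n)%N -> [/\ cvgC (y n)^'- f u.1,
      cvgC (y n)^'- (cderive f) (u.2 - (alpha n)%:C * u.1) & f (y n) = u.1]].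
  case: n => [|n]; first by exists (v0, w0).
  have [//|a b [dr [dl [e1 e2 e3]]]] := J n.+1.
  exists (f (x n.+1), dr); split => // _; split => //=.
  by rewrite -e3 opprB addrC subrK.
have [v Hv] := choice H; exists v; split; last first.
  by have [_ _ /(_ erefl) -> _] := Hv 0%N.
split.
- move=> n; split.
  + by move=> t nt tn; apply: derivable_at_cder; apply: Df; exact: cell_holes nt tn.
  + move=> a b na ab bn; apply: ACf1 => // t /=; rewrite in_itv/= => /andP[h1 h2].
    by apply: (@cell_holes n); lra.
  + apply: filterS Hh; first exact: (ae_filter_ringOfSetsType mu).
    move=> t Ht nt tn; have [d ->] := Ht (cell_holes nt tn).
    by rewrite opprK; exact: derivable_at_cder.
- by move=> n; have [h1 h2 _ _] := Hv n.
- by move=> n; have [_ _ _ /(_ isT)[]] := Hv n.+1.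
- by move=> n; have [_ _ _ /(_ isT)[]] := Hv n.+1.
Qed.

(** Near a point inside cell n the glued function coincides with [F n], so its derivatives are those
    of [F n]; the nodes are handled by the one-sided limits alone. *)
Lemma glued_cell_data alpha f h (F F1 : nat -> R -> R[i]) (v : nat -> vec) :
  (forall n t, y n <= t -> t < y n.+1 -> f t = F n t) ->
  (forall n, cellsol (y n) (y n.+1) (F n) (F1 n) h) ->
  (forall n, F n (y n) = (v n).1) ->
  (forall n, cvgC (y n)^'+ (F n) (v n).1 /\ cvgC (y n)^'+ (F1 n) (v n).2) ->
  (forall n, cvgC (y n.+1)^'- (F n) (v n.+1).1 /\
     cvgC (y n.+1)^'- (F1 n) ((v n.+1).2 - (alpha n.+1)%:C * (v n.+1).1)) ->
  cell_data alpha f (cderive f) h v.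
Proof.
move=> fF sF F0 cr cl.
have dF n t : y n < t -> t < y n.+1 -> is_cder f t (F1 n t).
  move=> nt tn; have [H _ _] := sF n.
  pose r := Num.min (t - y n) (y n.+1 - t).
  have [r1 r2] : r <= t - y n /\ r <= y n.+1 - t by rewrite /r !ge_min !lexx orbT.
  apply: (@is_cder_near _ (F n) _ _ _ r _ _ (H t nt tn)).
    by rewrite /r lt_min !subr_gt0 nt.
  by move=> s; rewrite ltr_norml => /andP[? ?]; rewrite (fF n)//; lra.
have cF n t : y n < t -> t < y n.+1 -> cderive f t = F1 n t.
  by move=> nt tn; have [] := is_cderE (dF n t nt tn).
have dF1 n t (l' : R[i]) : y n < t -> t < y n.+1 -> is_cder (F1 n) t l' -> is_cder (cderive f) t l'.
  move=> nt tn H.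
  pose r := Num.min (t - y n) (y n.+1 - t).
  have [r1 r2] : r <= t - y n /\ r <= y n.+1 - t by rewrite /r !ge_min !lexx orbT.
  apply: (@is_cder_near _ (F1 n) _ _ _ r _ _ H).
    by rewrite /r lt_min !subr_gt0 nt.
  by move=> s; rewrite ltr_norml => /andP[? ?]; rewrite (cF n)//; lra.
have gap n : 0 < y n.+1 - y n by have := node_ltS n; lra.
split.
- move=> n; have [H1 H2 H3] := sF n; split.
  + by move=> t nt tn; rewrite (cF n)//; exact: dF.
  + move=> a b na ab bn; apply: abs_continuous_ext (H2 a b na ab bn).
    by move=> t at_ tb; rewrite (cF n)//; lra.
  + apply: filterS H3; first exact: (ae_filter_ringOfSetsType mu).
    by move=> t Ht nt tn; apply: (dF1 n) => //; exact: Ht.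
- move=> n; have [h1 h2] := cr n; split.
    by apply: (cvgC_right_eq (gap n)) h1 => t t1 t2; rewrite (fF n)//; lra.
  by apply: (cvgC_right_eq (gap n)) h2 => t t1 t2; rewrite (cF n)//; lra.
- move=> n; have [h1 h2] := cl n; split.
    by apply: (cvgC_left_eq (gap n)) h1 => t t1 t2; rewrite (fF n)//; lra.
  by apply: (cvgC_left_eq (gap n)) h2 => t t1 t2; rewrite (cF n)//; lra.
- by move=> n; rewrite (fF n.+1) ?F0//; exact: node_ltS.
Qed.

Lemma cell_data_Hamiltonian kappa alpha f h (v : nat -> vec) :
  cell_data alpha f (cderive f) h v -> bc kappa (v 0%N) -> inL2 f -> inL2 h ->
  Hamiltonian kappa x alpha (f, h).
Proof.
move=> [sf crf clf fv] B0 Lf Lh; split => //.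
- split.
  + move=> t /holes_cell[n [nt tn]]; have [H _ _] := sf n.
    by have [d _] := is_cderE (H t nt tn); exact: d.
  + move=> a b ab /(segment_holes_cell ab)[n [na bn]].
    exact: (cellsol_abs_continuous (sf n)).
  + move=> a b ab /(segment_holes_cell ab)[n [na bn]].
    by have [_ H _] := sf n; exact: H.
  + case=> [//|n] _; have [h1 h2] := crf n.+1; have [h3 h4] := clf n.
    have E : f (x n.+1) = (v n.+1).1 := fv n.
    rewrite E; split => //; exists (v n.+1).2, ((v n.+1).2 - (alpha n.+1)%:C * (v n.+1).1).
    by split => //; rewrite opprB addrC subrK.
- have Hall : {ae mu, forall t n, y n < t -> t < y n.+1 -> is_cder (cderive f) t (- h t)}.
    by apply: ae_foralln => n; have [_ _] := sf n.
  apply: filterS Hall; first exact: (ae_filter_ringOfSetsType mu).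
  move=> t Ht /holes_cell[n [nt tn]]; have [d E] := is_cderE (Ht n nt tn).
  by split => //; rewrite E opprK.
- exists (v 0%N).1, (v 0%N).2; have [h1 h2] := crf 0%N; by split.
Qed.

Lemma cell_data_cvg alpha f f1 h (v : nat -> vec) t : cell_data alpha f f1 h v -> 0 < t ->
  cvgC (nbhs t) f (f t).
Proof.
move=> [sf crf clf fv] /cell_index_oc[n [nt tn]].
have [E|tn'] := eqVneq t (y n.+1); last first.
  have [H _ _] := sf n; apply: is_cder_cvg (H t nt _).
  by rewrite lt_neqAle tn' tn.
rewrite E; apply/cvgC_nbhsP => e e0; rewrite (fv n).
have [/cvgC_rightP/(_ e e0)[r1 r10 H1] _] := crf n.+1.
have [/cvgC_leftP/(_ e e0)[r2 r20 H2] _] := clf n.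
exists (Num.min r1 r2); first by rewrite lt_min r10.
move=> s; rewrite lt_min => /andP[s1 s2].
have [->|] := eqVneq s (y n.+1); first by rewrite (fv n) subrr normc0 ltW.
rewrite neq_lt => /orP[h0|h0].
  by apply: H2 => //; move: s2; rewrite ltr_norml; lra.
by apply: H1 => //; move: s1; rewrite ltr_norml; lra.
Qed.

(** The function is continuous across the nodes, hence continuous on the open half-line. *)
Lemma cell_data_measurable alpha f f1 h (v : nat -> vec) : cell_data alpha f f1 h v ->
  measurable_fun (@halfline R) (fun t => complex.Re (f t)) /\
  measurable_fun (@halfline R) (fun t => complex.Im (f t)).
Proof.
move=> D; have C t : halfline t -> cvgC (nbhs t) f (f t).
  by rewrite /halfline /= in_itv/= andbT => /(cell_data_cvg D).
have oh : open (@halfline R) by exact: rray_open.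
by split; apply: open_continuous_measurable_fun => // t /set_mem /C [].
Qed.

Lemma sq_integrable_bounded s e f (B : R) : s <= e ->
  measurable_fun (`]s, e] : set R) (fun t => complex.Re (f t)) ->
  measurable_fun (`]s, e] : set R) (fun t => complex.Im (f t)) ->
  (forall t, s < t -> t <= e -> normc (f t) ^+ 2 <= B) ->
  sq_integrable s e f /\ energy s e f <= B * (e - s).
Proof.
move=> se m1 m2 H.
have mI : measurable (`]s, e] : set R) by exact: measurable_itv.
have i : mu.-integrable `]s, e] (EFin \o (fun t => normc (f t) ^+ 2)).
  apply: le_integrable (integrable_cst_itv s e B) => //.
    by apply/measurable_EFinP; exact: normc_sqr_measurable.
  move=> t /=; rewrite in_itv/= => /andP[st te].
  rewrite lee_fin ger0_norm ?sqr_ge0//; apply: (le_trans (H t st te)).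
  exact: ler_norm.
split; first by split.
rewrite -Rintegral_cst_itv//; apply: le_Rintegral => //; first exact: integrable_cst_itv.
by move=> t /=; rewrite in_itv/= => /andP[st te]; exact: H.
Qed.

End regular_nodes.
End Nodes.

(** * Transfer matrices *)

Section TransferMatrices.
Context {R : realType}.
Implicit Types (f h g psi : R -> R[i]) (x alpha : nat -> R) (z : R[i]) (s e t l L kappa a d : R).
Local Notation normc := (@Normc.normc R).
Local Notation mu := (@lebesgue_measure R).
Local Notation vec := (R[i] * R[i])%type.

(** Propagation over the length [t] followed by the jump of strength [a], so that data taken from
    the right are mapped to data taken from the right. *)
Definition tmat z t a : (R[i] * R[i]) * (R[i] * R[i]) :=
  ((Cz z t, Sz z t), (a%:C * Cz z t - z * Sz z t, a%:C * Sz z t + Cz z t)).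

Lemma tmat_det z t a : mdet (tmat z t a) = 1.
Proof. by rewrite -(CSz_sqr z t) /mdet /tmat /=; ring. Qed.

Lemma tmat_tr z t a : mtr (tmat z t a) = 2 * discriminant t a (sqrtC z).
Proof. by rewrite discriminantE /mtr /tmat /=; field. Qed.

Lemma tmat_hom z s e a (v : vec) : mapp (tmat z (e - s) a) v =
  (hom z s v.1 v.2 e, hom1 z s v.1 v.2 e + a%:C * hom z s v.1 v.2 e).
Proof. by rewrite /mapp /tmat /hom /hom1 /=; congr (_, _); ring. Qed.

Definition transfer x alpha z n := tmat z (node x n.+1 - node x n) (alpha n.+1).

Lemma transfer_det x alpha z n : mdet (transfer x alpha z n) = 1.
Proof. exact: tmat_det. Qed.

(** * Convergence of the transfer matrices *)

Definition tends (u : nat -> R) (l : R) := forall e, 0 < e -> exists N, forall n, (N <= n)%N -> `|u n - l| <= e.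

Lemma tendsD (u w : nat -> R) a d : tends u a -> tends w d -> tends (fun n => u n + w n) (a + d).
Proof.
move=> Hu Hw e e0; have e20 : 0 < e / 2 by lra.
have [N1 H1] := Hu _ e20; have [N2 H2] := Hw _ e20; exists (maxn N1 N2) => n.
rewrite geq_max => /andP[/H1 h1 /H2 h2].
by rewrite opprD addrACA (le_trans (ler_normD _ _))//; lra.
Qed.

Definition ctends (u : nat -> R[i]) (l : R[i]) :=
  forall e, 0 < e -> exists N, forall n, (N <= n)%N -> normc (u n - l) <= e.

Lemma ctendsD u w (a d : R[i]) : ctends u a -> ctends w d -> ctends (fun n => u n + w n) (a + d).
Proof.
move=> Hu Hw e e0; have e20 : 0 < e / 2 by lra.
have [N1 H1] := Hu _ e20; have [N2 H2] := Hw _ e20; exists (maxn N1 N2) => n.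
rewrite geq_max => /andP[/H1 h1 /H2 h2].
by rewrite opprD addrACA (le_trans (normcD _ _))//; lra.
Qed.

Lemma ctends_cst (a : R[i]) : ctends (fun=> a) a.
Proof. by move=> e e0; exists 0%N => n _; rewrite subrr normc0 ltW. Qed.

Lemma ctendsM u w (a d : R[i]) : ctends u a -> ctends w d -> ctends (fun n => u n * w n) (a * d).
Proof.
move=> Hu Hw e e0.
pose K : R := normc a + normc d + 1.
have na := normc_ge0 a; have nd := normc_ge0 d.
have K0 : 0 < K by rewrite /K; lra.
have e1 : 0 < Num.min 1 (e / (2 * K)) by rewrite lt_min ltr01 divr_gt0// mulr_gt0.
have [N1 H1] := Hu _ e1; have [N2 H2] := Hw _ e1; exists (maxn N1 N2) => n.
rewrite geq_max => /andP[/H1 h1 /H2 h2].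
have m1 : Num.min 1 (e / (2 * K)) <= 1 by rewrite ge_min lexx.
have m2 : Num.min 1 (e / (2 * K)) <= e / (2 * K) by rewrite ge_min lexx orbT.
have -> : u n * w n - a * d = (u n - a) * (d + (w n - d)) + a * (w n - d) by ring.
apply: (le_trans (normcD _ _)); rewrite !normcM.
have h3 : normc (d + (w n - d)) <= K by apply: (le_trans (normcD _ _)); rewrite /K; lra.
have h4 : normc (u n - a) * normc (d + (w n - d)) <= e / (2 * K) * K.
  by apply: ler_pM; rewrite ?normc_ge0//; lra.
have h5 : normc a * normc (w n - d) <= K * (e / (2 * K)).
  by apply: ler_pM; rewrite ?normc_ge0//; rewrite /K in h3 *; lra.
have -> : e = e / (2 * K) * K + K * (e / (2 * K)) by field; lra.
exact: lerD.
Qed.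

Lemma ctends_comp F (w : R[i]) (u : nat -> R) a : is_cder F a w -> tends u a ->
  ctends (fun n => F (u n)) (F a).
Proof.
move=> /is_cder_cvg/cvgC_nbhsP H Hu e /H[r r0 Hr]; have r20 : 0 < r / 2 by lra.
have [N HN] := Hu _ r20; exists N => n Nn; apply: Hr.
by apply: le_lt_trans (HN n Nn) _; lra.
Qed.

Lemma ctends_real (u : nat -> R) a : tends u a -> ctends (fun n => (u n)%:C) a%:C.
Proof.
by move=> H e /H[N HN]; exists N => n Nn; rewrite -rmorphB normc_real; exact: HN.
Qed.

Lemma transfer_mcvg x alpha z d a : tends (fun n => node x n.+1 - node x n) d ->
  tends (fun n => alpha n.+1) a -> mcvg (transfer x alpha z) (tmat z d a).
Proof.
move=> hx ha.
have tC := ctends_comp (is_cder_Cz z d) hx; have tS := ctends_comp (is_cder_Sz z d) hx.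
have tA := ctends_real ha.
have t3 := ctendsD (ctendsM tA tC) (ctendsM (ctends_cst (- z)) tS).
have t4 := ctendsD (ctendsM tA tS) tC.
move=> e e0; have [N1 H1] := tC e e0; have [N2 H2] := tS e e0.
have [N3 H3] := t3 e e0; have [N4 H4] := t4 e e0.
exists (maxn (maxn N1 N2) (maxn N3 N4)) => n; rewrite !geq_max.
move=> /andP[/andP[n1 n2] /andP[n3 n4]]; split => /=; [exact: H1|exact: H2| |exact: H4].
by have := H3 n n3; rewrite !mulNr.
Qed.

Lemma measurable_linC (D : set R) f h (a b : R[i]) :
  measurable_fun D (fun t => complex.Re (f t)) -> measurable_fun D (fun t => complex.Im (f t)) ->
  measurable_fun D (fun t => complex.Re (h t)) -> measurable_fun D (fun t => complex.Im (h t)) ->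
  measurable_fun D (fun t => complex.Re (a * f t + b * h t)) /\
  measurable_fun D (fun t => complex.Im (a * f t + b * h t)).
Proof.
move=> m1 m2 m3 m4; split.
  have -> : (fun t => complex.Re (a * f t + b * h t)) = (fun t =>
     (complex.Re a * complex.Re (f t) - complex.Im a * complex.Im (f t)) +
     (complex.Re b * complex.Re (h t) - complex.Im b * complex.Im (h t))).
    by apply/funext => t; rewrite ReD !ReM.
  by apply: measurable_funD; apply: measurable_funB; apply: measurable_funM.
have -> : (fun t => complex.Im (a * f t + b * h t)) = (fun t =>
   (complex.Re a * complex.Im (f t) + complex.Im a * complex.Re (f t)) +
   (complex.Re b * complex.Im (h t) + complex.Im b * complex.Re (h t))).
  by apply/funext => t; rewrite ImD !ImM.
by apply: measurable_funD; apply: measurable_funD; apply: measurable_funM.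
Qed.

Lemma sq_integrable_lin s e f h (a b : R[i]) : sq_integrable s e f -> sq_integrable s e h ->
  sq_integrable s e (fun t => a * f t + b * h t) /\
  energy s e (fun t => a * f t + b * h t) <=
    2 * normc a ^+ 2 * energy s e f + 2 * normc b ^+ 2 * energy s e h.
Proof.
move=> sf sh; have [m1 m2 i1] := sf; have [m3 m4 i2] := sh.
have [m5 m6] := measurable_linC a b m1 m2 m3 m4.
have mI : measurable (`]s, e] : set R) by exact: measurable_itv.
pose q t := 2 * normc a ^+ 2 * normc (f t) ^+ 2 + 2 * normc b ^+ 2 * normc (h t) ^+ 2.
have iq : mu.-integrable `]s, e] (EFin \o q).
  have -> : EFin \o q = ((EFin \o (fun t => (2 * normc a ^+ 2 * normc (f t) ^+ 2)%R)) \+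
     (EFin \o (fun t => (2 * normc b ^+ 2 * normc (h t) ^+ 2)%R)))%E by apply/funext.
  by apply: integrableD => //; exact: integrable_energyZ.
have H t : normc (a * f t + b * h t) ^+ 2 <= q t.
  by apply: (le_trans (sqr_normcD_le _ _)); rewrite !normcM !exprMn /q; lra.
have i5 : mu.-integrable `]s, e] (EFin \o (fun t => normc (a * f t + b * h t) ^+ 2)).
  apply: le_integrable iq => //.
    by apply/measurable_EFinP; exact: normc_sqr_measurable.
  move=> t _; rewrite /comp !abse_EFin lee_fin (ger0_norm (sqr_ge0 _)).
  by apply: (le_trans (H t)); exact: ler_norm.
split; first by split.
rewrite -!Rintegral_energyZ// -RintegralD//; last 2 first.
- exact: integrable_energyZ.
- exact: integrable_energyZ.
exact: le_Rintegral.
Qed.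

Section regular_nodes.
Variables (x : nat -> R) (l L : R).
Hypothesis reg : regular x l L.
Local Notation y := (node x).

Lemma sqintegral_lin f h (a b : R[i]) : inL2 f -> inL2 h ->
  inL2 (fun t => a * f t + b * h t) /\ fine (sqintegral (fun t => a * f t + b * h t)) <=
    2 * normc a ^+ 2 * fine (sqintegral f) + 2 * normc b ^+ 2 * fine (sqintegral h).
Proof.
move=> Lf Lh; have [m1 m2 _] := Lf; have [m3 m4 _] := Lh.
have [m5 m6] := measurable_linC a b m1 m2 m3 m4.
have H n := sq_integrable_lin a b (inL2_sq_integrable reg n Lf) (inL2_sq_integrable reg n Lh).
apply: (inL2_of_energy reg m5 m6).
  by move=> n; have [] := H n.
move=> m; apply: (@le_trans _ _ (\sum_(n < m) (2 * normc a ^+ 2 * energy (y n) (y n.+1) f +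
   2 * normc b ^+ 2 * energy (y n) (y n.+1) h))).
  by apply: ler_sum => n _; have [] := H n.
rewrite big_split/= -!mulr_sumr.
have a2 : 0 <= 2 * normc a ^+ 2 by have := sqr_ge0 (normc a); lra.
have b2 : 0 <= 2 * normc b ^+ 2 by have := sqr_ge0 (normc b); lra.
by apply: lerD; apply: ler_wpM2l => //; exact: (sum_energy_le reg).
Qed.

Lemma inL2_lin f h (a b : R[i]) : inL2 f -> inL2 h -> inL2 (fun t => a * f t + b * h t).
Proof. by move=> Lf Lh; have [] := sqintegral_lin a b Lf Lh. Qed.

Lemma inL2_shifted f h z : inL2 f -> inL2 h -> inL2 (shifted f h z).
Proof.
move=> Lf Lh; have := inL2_lin (- z) 1 Lf Lh; congr inL2.
by apply/funext => t; rewrite /shifted mul1r addrC mulNr.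
Qed.

Lemma regular_gap n : y n < y n.+1 /\ y n.+1 - y n <= L.
Proof. by have [l0 H] := reg; have /andP[] := H n; lra. Qed.

Lemma regular_L_gt0 : 0 < L.
Proof. by have [h1 h2] := regular_gap 0; lra. Qed.

(** The residual of data in the homogeneous recursion. Any sequence solves the recursion with its
    own residual, and for the data of a function the residual is controlled cell by cell. *)
Definition defect alpha z (v : nat -> vec) n : vec :=
  vadd (v n.+1) (vscale (-1) (mapp (transfer x alpha z n) (v n))).

Lemma defect_is_sol alpha z v : is_sol (transfer x alpha z) (defect alpha z v) v.
Proof.
move=> n; rewrite /defect /vadd /vscale /=; case: (v n.+1) => p q /=.
by congr (_, _); ring.
Qed.

Lemma cell_data_defect alpha z (A : R) : (forall n, `|alpha n| <= A) ->
  exists2 K : R, 0 < K & forall f f1 g v,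
    cell_data x alpha f f1 (fun t => g t + z * f t) v ->
    (forall n, sq_integrable (y n) (y n.+1) g) ->
    (forall n, nrm2 (defect alpha z v n) <= K * energy (y n) (y n.+1) g) /\
    (forall n t, y n < t -> t <= y n.+1 ->
      normc (f t - hom z (y n) (v n).1 (v n).2 t) ^+ 2 <= K * energy (y n) (y n.+1) g).
Proof.
move=> alA; have [K K0 HK] := cell_rep z regular_L_gt0; have [K' K'0 HK'] := cell_rep_end z regular_L_gt0.
have A2 := sqr_ge0 A; have KA : 0 <= K' * (A ^+ 2) by rewrite mulr_ge0// ltW.
exists (K + 3 * K' + 2 * (K' * (A ^+ 2))); first lra.
move=> f f1 g v [sf cr cl fv] sg.
have E n : 0 <= energy (y n) (y n.+1) g := energy_ge0 _ _ _.
have KE n : 0 <= K * energy (y n) (y n.+1) g by rewrite mulr_ge0// ltW.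
have KE' n : 0 <= K' * energy (y n) (y n.+1) g by rewrite mulr_ge0// ltW.
have KE2 n : 0 <= K' * A ^+ 2 * energy (y n) (y n.+1) g by rewrite mulr_ge0.
have Hend n : normc ((v n.+1).1 - hom z (y n) (v n).1 (v n).2 (y n.+1)) ^+ 2 <=
     K' * energy (y n) (y n.+1) g /\
   normc ((v n.+1).2 - (alpha n.+1)%:C * (v n.+1).1 - hom1 z (y n) (v n).1 (v n).2 (y n.+1)) ^+ 2 <=
     K' * energy (y n) (y n.+1) g.
  have [g1 g2] := regular_gap n; have [h1 h2] := cr n; have [h3 h4] := cl n.
  exact: HK' (sf n) (sg n) h1 h2 h3 h4.
split => n.
  have [h1 h2] := Hend n; rewrite /nrm2 /defect tmat_hom /=.
  set p := hom z _ _ _ _ in h1 *; set q := hom1 z _ _ _ _ in h2 *.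
  have -> : (v n.+1).1 + -1 * p = (v n.+1).1 - p by ring.
  have -> : (v n.+1).2 + -1 * (q + (alpha n.+1)%:C * p) =
     ((v n.+1).2 - (alpha n.+1)%:C * (v n.+1).1 - q) + (alpha n.+1)%:C * ((v n.+1).1 - p) by ring.
  have h3 := sqr_normcD_le ((v n.+1).2 - (alpha n.+1)%:C * (v n.+1).1 - q)
     ((alpha n.+1)%:C * ((v n.+1).1 - p)).
  rewrite normcM exprMn normc_real in h3.
  have h4 : `|alpha n.+1| ^+ 2 * normc ((v n.+1).1 - p) ^+ 2 <= A ^+ 2 * (K' * energy (y n) (y n.+1) g).
    apply: ler_pM; rewrite ?sqr_ge0//.
    by rewrite ler_sqr ?nnegrE//; apply: le_trans (alA n.+1).
  have := KE n; have := KE2 n; lra.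
move=> t nt tn; have [E'|tn'] := eqVneq t (y n.+1).
  rewrite E' (fv n); have [h1 _] := Hend n; have := KE n; have := KE2 n; have := KE' n; lra.
have [g1 g2] := regular_gap n; have [h1 h2] := cr n.
have [|h3 _] := HK _ _ _ _ _ _ _ g1 g2 (sf n) (sg n) h1 h2 t nt.
  by rewrite lt_neqAle tn' tn.
have := KE2 n; have := KE' n; lra.
Qed.

Lemma cell_data_l2 alpha : exists2 K : R, 0 < K & forall f f1 h v,
  cell_data x alpha f f1 h v -> inL2 f -> inL2 h ->
  sum2_le v (K * (fine (sqintegral f) + fine (sqintegral h))).
Proof.
have [l0 Hl] := reg; have [K K0 HK] := cell_data_bound L l0; exists (2 * K); first lra.
move=> f f1 h v [sf cr _ _] Lf Lh m.
apply: (@le_trans _ _ (\sum_(n < m) (2 * K * energy (y n) (y n.+1) f + 2 * K * energy (y n) (y n.+1) h))).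
  apply: ler_sum => n _; have /andP[g1 g2] := Hl n; have [h1 h2] := cr n.
  have [] := HK _ _ _ _ _ _ _ g1 g2 (sf n) (inL2_sq_integrable reg n Lf) (inL2_sq_integrable reg n Lh) h1 h2.
  by rewrite /nrm2; lra.
rewrite big_split/= -!mulr_sumr -mulrDr; apply: ler_wpM2l; first lra.
by apply: lerD; exact: (sum_energy_le reg).
Qed.

Lemma hom_sqr_bound z : exists2 K : R, 0 < K & forall s t v1 v2, s <= t -> t - s <= L ->
  normc (hom z s v1 v2 t) ^+ 2 <= K * (normc v1 ^+ 2 + normc v2 ^+ 2).
Proof.
have [K K1 HK] := CSz_bounded z L; have K2 : 0 < K ^+ 2 by rewrite exprn_gt0//; lra.
exists (2 * K ^+ 2); first lra.
move=> s t v1 v2 st tL; have [||h1 h2] := HK (t - s); [lra|lra|].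
exact: (@lin_bound R (Cz z (t - s)) (Sz z (t - s)) (v1, v2) K h1 h2).
Qed.

Lemma cell_data_inL2 alpha z (A : R) : (forall n, `|alpha n| <= A) ->
  exists2 K : R, 0 < K & forall f f1 g v (V W : R),
    cell_data x alpha f f1 (fun t => g t + z * f t) v ->
    (forall n, sq_integrable (y n) (y n.+1) g) ->
    (forall m, \sum_(n < m) energy (y n) (y n.+1) g <= W) -> sum2_le v V ->
    inL2 f /\ fine (sqintegral f) <= K * (V + W).
Proof.
move=> alA; have [K K0 HK] := cell_data_defect z alA; have [K' K'0 HK'] := hom_sqr_bound z.
have L0 := regular_L_gt0.
have h1 : 0 < 2 * K' * L by rewrite mulr_gt0//; lra.
have h2 : 0 < 2 * K * L by rewrite mulr_gt0//; lra.
exists (2 * K' * L + 2 * K * L); first lra.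
move=> f f1 g v V W D sg gW vV.
have W0 : 0 <= W by apply: le_trans (gW 0%N); rewrite big_ord0.
have V0 : 0 <= V by apply: le_trans (vV 0%N); rewrite big_ord0.
have [m1 m2] := cell_data_measurable reg D.
have [_ Hpt] := HK _ _ _ _ D sg.
have mh : measurable (@halfline R) by exact: measurable_itv.
have bd n : sq_integrable (y n) (y n.+1) f /\ energy (y n) (y n.+1) f <=
    (2 * K' * nrm2 (v n) + 2 * K * energy (y n) (y n.+1) g) * (y n.+1 - y n).
  have [g1 g2] := regular_gap n.
  have n1 := measurable_funS mh (@cells_halfline R x l L reg n) m1.
  have n2 := measurable_funS mh (@cells_halfline R x l L reg n) m2.
  apply: sq_integrable_bounded => //; first exact: ltW.
  - move=> t nt tn; have h3 := Hpt n t nt tn.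
    have h4 : normc (hom z (y n) (v n).1 (v n).2 t) ^+ 2 <= K' * nrm2 (v n) by apply: HK'; lra.
    have := sqr_normcD_le (hom z (y n) (v n).1 (v n).2 t) (f t - hom z (y n) (v n).1 (v n).2 t).
    by rewrite addrC subrK; lra.
apply: (inL2_of_energy reg m1 m2) => [n|m]; first by have [] := bd n.
apply: (@le_trans _ _ (\sum_(n < m) (2 * K' * L * nrm2 (v n) + 2 * K * L * energy (y n) (y n.+1) g))).
  apply: ler_sum => n _; have [_ h] := bd n; apply: (le_trans h).
  have [g1 g2] := regular_gap n; have e0 := energy_ge0 (y n) (y n.+1) g; have n0 := nrm2_ge0 (v n).
  have -> : 2 * K' * L * nrm2 (v n) + 2 * K * L * energy (y n) (y n.+1) g =
    (2 * K' * nrm2 (v n) + 2 * K * energy (y n) (y n.+1) g) * L by ring.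
  apply: ler_wpM2l => //.
  by apply: addr_ge0; apply: mulr_ge0 => //; lra.
rewrite big_split/= -!mulr_sumr.
have h3 : 2 * K' * L * \sum_(n < m) nrm2 (v n) <= 2 * K' * L * V by rewrite ler_pM2l.
have h4 : 2 * K * L * \sum_(n < m) energy (y n) (y n.+1) g <= 2 * K * L * W by rewrite ler_pM2l.
have h5 : 0 <= 2 * K' * L * W by rewrite mulr_ge0// ltW.
have h6 : 0 <= 2 * K * L * V by rewrite mulr_ge0// ltW.
lra.
Qed.

End regular_nodes.
End TransferMatrices.

(** * The resolvent set *)

Section Resolvent.
Context {R : realType}.
Implicit Types (f h g psi : R -> R[i]) (z : R[i]) (s e t : R).
Local Notation normc := (@Normc.normc R).
Local Notation mu := (@lebesgue_measure R).
Local Notation vec := (R[i] * R[i])%type.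

Lemma cellsol_congr s e f f1 h h' : (forall t, s < t -> t < e -> h t = h' t) ->
  cellsol s e f f1 h -> cellsol s e f f1 h'.
Proof.
move=> E [H1 H2 H3]; split => //; apply: filterS H3; first exact: (ae_filter_ringOfSetsType mu).
by move=> t H st te; rewrite -E//; exact: H.
Qed.

Lemma cellsolD s e f f1 h g g1 k : cellsol s e f f1 h -> cellsol s e g g1 k ->
  cellsol s e (fun t => f t + g t) (fun t => f1 t + g1 t) (fun t => h t + k t).
Proof.
move=> [H1 H2 H3] [K1 K2 K3]; split.
- by move=> t st te; apply: is_cderD; [exact: H1|exact: K1].
- by move=> a b sa ab be; apply: abs_continuousD; [exact: H2|exact: K2].
- move: H3 K3; apply: filterS2; first exact: (ae_filter_ringOfSetsType mu).
  by move=> t H K st te; apply: is_cder_eq (is_cderD (H st te) (K st te)) _; rewrite opprD.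
Qed.

Lemma ae_all (P : R -> Prop) : (forall t, P t) -> {ae mu, forall t, P t}.
Proof.
by move=> H; apply: filterS (@filterT _ _ (ae_filter_ringOfSetsType mu)) => t _; exact: H.
Qed.

Lemma cellsol_smooth s e f f1 f2 : (forall t, is_cder f t (f1 t)) ->
  (forall t, is_cder f1 t (f2 t)) -> (exists f3, forall t, is_cder f2 t (f3 t)) ->
  cellsol s e f f1 (fun t => - f2 t).
Proof.
move=> H1 H2 [f3 H3]; split => //.
- move=> a b _ _ _; have [K _ HK] := is_cder_bounded a b H3.
  by apply: (is_cder_abs_continuous (G := f2) (K := K)) => t ta tb; [exact: H2|exact: HK].
- by apply: ae_all => t _ _; rewrite opprK.
Qed.

Lemma cellsol_hom z s e r v1 v2 :
  cellsol s e (hom z r v1 v2) (hom1 z r v1 v2) (fun t => z * hom z r v1 v2 t).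
Proof.
have H := @cellsol_smooth s e _ _ _ (is_cder_hom z r v1 v2) (is_cder_hom1 z r v1 v2).
apply: cellsol_congr (H _) => [t _ _|]; first by rewrite opprK.
exists (fun t => - (z * hom1 z r v1 v2 t)) => t.
by apply: is_cderN; apply: is_cderZ; exact: is_cder_hom.
Qed.

Lemma hom0 z s t : hom z s 0 0 t = 0.
Proof. by rewrite /hom !mulr0 addr0. Qed.

Lemma hom10 z s t : hom1 z s 0 0 t = 0.
Proof. by rewrite /hom1 !mulr0 addr0. Qed.

Lemma eqL2_all f g : (forall t, f t = g t) -> eqL2 f g.
Proof. by move=> E; apply: ae_all => t _; exact: E. Qed.

Lemma sqintegral_eqL2 f g : inL2 f -> inL2 g -> eqL2 f g -> sqintegral f = sqintegral g.
Proof.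
move=> [m1 m2 _] [m3 m4 _] E; rewrite /sqintegral.
have mh : measurable (@halfline R) by exact: measurable_itv.
apply: ae_eq_integral => //.
- by apply/measurable_EFinP; exact: normc_sqr_measurable.
- by apply/measurable_EFinP; exact: normc_sqr_measurable.
- apply: filterS E; first exact: (ae_filter_ringOfSetsType mu).
  by move=> t H /H ->.
Qed.

Lemma inL2_cst0 : inL2 (cst 0 : R -> R[i]).
Proof.
split; [exact: measurable_cst|exact: measurable_cst|].
rewrite /sqintegral integral0_eq//.
by move=> t _; rewrite normc0 expr0n.
Qed.

Lemma sqintegral_cst0 : sqintegral (cst 0 : R -> R[i]) = 0%E.
Proof. by rewrite /sqintegral integral0_eq// => t _; rewrite normc0 expr0n. Qed.

Lemma fine_sqintegral_eq0 f : inL2 f -> eqL2 f (cst 0) -> fine (sqintegral f) = 0.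
Proof. by move=> Lf /(sqintegral_eqL2 Lf inL2_cst0) ->; rewrite sqintegral_cst0. Qed.

Lemma sqintegral_ge0 f : 0 <= fine (sqintegral f).
Proof. by apply: fine_ge0; apply: integral_ge0 => t _; rewrite lee_fin sqr_ge0. Qed.

Lemma L2norm_le f g (K : R) : 0 <= K -> fine (sqintegral f) <= K * fine (sqintegral g) ->
  L2norm f <= Num.sqrt K * L2norm g.
Proof.
by move=> K0 H; rewrite /L2norm -sqrtrM// ler_wsqrtr.
Qed.

Lemma Hamiltonian_inL2 kappa x alpha f h : Hamiltonian kappa x alpha (f, h) -> inL2 f /\ inL2 h.
Proof. by case. Qed.

Lemma shiftedK f h z : h = (fun t => shifted f h z t + z * f t).
Proof. by apply/funext => t; rewrite /shifted subrK. Qed.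

Section spectral.
Variables (x alpha : nat -> R) (l L A d a0 kappa : R).
Hypothesis reg : regular x l L.
Hypothesis alA : forall n, `|alpha n| <= A.
Hypothesis gap_d : tends (fun n => node x n.+1 - node x n) d.
Hypothesis alpha_a0 : tends (fun n => alpha n.+1) a0.
Local Notation y := (node x).
Local Notation T := (Hamiltonian kappa x alpha).

(** The equation with right-hand side [g] is solved with zero data in each cell, and the end values
    form the inhomogeneity [w], which thus depends on [g] only. Every l2 solution of the recursion
    then gives a function, by adding in each cell the homogeneous solution with its data. *)
Lemma solve_with_data z : exists2 C : R, 0 <= C & forall g, inL2 g -> exists w : nat -> vec,
  sum2_le w (C * fine (sqintegral g)) /\ forall v, is_sol (transfer x alpha z) w v -> l2seq v -> bc kappa (v 0%N) ->
  exists f, T (f, fun t => g t + z * f t) /\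
    cell_data x alpha f (cderive f) (fun t => g t + z * f t) v.
Proof.
have [K K0 HK] := cell_rep_end z (regular_L_gt0 reg).
have A2 : 0 <= 2 * A ^+ 2 by have := sqr_ge0 A; lra.
have KA : 0 <= K * (2 * A ^+ 2) by rewrite mulr_ge0// ltW.
pose C : R := 3 * K + K * (2 * A ^+ 2); have C0 : 0 <= C by rewrite /C; lra.
exists C => // g Lg.
have ex n : exists p : (R -> R[i]) * (R -> R[i]), [/\ cellsol (y n) (y n.+1) p.1 p.2
      (fun t => g t + z * p.1 t), p.1 (y n) = 0, p.2 (y n) = 0,
    cvgC (y n)^'+ p.1 0 /\ cvgC (y n)^'+ p.2 0 &
    cvgC (y n.+1)^'- p.1 (p.1 (y n.+1)) /\ cvgC (y n.+1)^'- p.2 (p.2 (y n.+1))].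
  have [p [p1 [h1 h2 h3 h4 h5]]] := local_solution z 0 0 (node_ltS reg n) (inL2_sq_integrable reg n Lg).
  by exists (p, p1).
have [P HP] := choice ex.
pose w n : vec := ((P n).1 (y n.+1), (P n).2 (y n.+1) + (alpha n.+1)%:C * (P n).1 (y n.+1)).
exists w; split.
  move=> m; apply: (@le_trans _ _ (\sum_(n < m) C * energy (y n) (y n.+1) g)); last first.
    by rewrite -mulr_sumr; apply: ler_wpM2l => //; exact: (sum_energy_le reg).
  apply: ler_sum => n _; have [s1 s2 s3 [c1 c2] [e1 e2]] := HP n.
  have [g1 g2] := regular_gap reg n.
  have [h1 h2] := HK _ _ _ _ _ _ _ _ _ g1 g2 s1 (inL2_sq_integrable reg n Lg) c1 c2 e1 e2.
  rewrite hom0 subr0 in h1; rewrite hom10 subr0 in h2.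
  have h3 := sqr_normcD_le ((P n).2 (y n.+1)) ((alpha n.+1)%:C * (P n).1 (y n.+1)).
  rewrite normcM exprMn normc_real in h3.
  have h4 : `|alpha n.+1| ^+ 2 * normc ((P n).1 (y n.+1)) ^+ 2 <= A ^+ 2 * (K * energy (y n) (y n.+1) g).
    apply: ler_pM; rewrite ?sqr_ge0//.
    by rewrite ler_sqr ?nnegrE//; apply: le_trans (alA n.+1).
  have e0 := energy_ge0 (y n) (y n.+1) g.
  by rewrite /nrm2 /w /C /=; lra.
move=> v sv [S vS] B0.
pose F n t := (P n).1 t + hom z (y n) (v n).1 (v n).2 t.
pose F1 n t := (P n).2 t + hom1 z (y n) (v n).1 (v n).2 t.
have [f fF] := glue reg F; exists f.
have D : cell_data x alpha f (cderive f) (fun t => g t + z * f t) v.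
  apply: (glued_cell_data reg fF (F1 := F1)).
  - move=> n; have [s1 _ _ _ _] := HP n.
    apply: cellsol_congr (cellsolD s1 (cellsol_hom z (y n) (y n.+1) (y n) (v n).1 (v n).2)).
    by move=> t nt tn; rewrite (fF n)//; [rewrite /F; ring|exact: ltW].
  - by move=> n; have [_ s2 _ _ _] := HP n; rewrite /F s2 hom_start add0r.
  - move=> n; have [_ _ _ [c1 c2] _] := HP n; split.
      rewrite -[(v n).1]add0r; apply: cvgCD => //.
      by rewrite -[X in cvgC _ _ X](hom_start z (y n) (v n).1 (v n).2);
        apply: cvgC_nbhs_right; exact: is_cder_cvg (is_cder_hom _ _ _ _ _).
    rewrite -[(v n).2]add0r; apply: cvgCD => //.
    by rewrite -[X in cvgC _ _ X](hom1_start z (y n) (v n).1 (v n).2);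
      apply: cvgC_nbhs_right; exact: is_cder_cvg (is_cder_hom1 _ _ _ _ _).
  - move=> n; have [_ _ _ _ [e1 e2]] := HP n.
    rewrite (sv n) tmat_hom /vadd /w /=; split.
      rewrite addrC; apply: cvgCD => //.
      by apply: cvgC_nbhs_left; exact: is_cder_cvg (is_cder_hom _ _ _ _ _).
    have -> : hom1 z (y n) (v n).1 (v n).2 (x n.+1) +
       (alpha n.+1)%:C * hom z (y n) (v n).1 (v n).2 (x n.+1) +
       ((P n).2 (x n.+1) + (alpha n.+1)%:C * (P n).1 (x n.+1)) -
       (alpha n.+1)%:C * (hom z (y n) (v n).1 (v n).2 (x n.+1) + (P n).1 (x n.+1)) =
       (P n).2 (x n.+1) + hom1 z (y n) (v n).1 (v n).2 (x n.+1) by ring.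
    apply: cvgCD => //.
    by apply: cvgC_nbhs_left; exact: is_cder_cvg (is_cder_hom1 _ _ _ _ _).
split => //.
have [K' K'0 HK'] := cell_data_inL2 reg z alA.
have [Lf _] := HK' _ _ _ _ S (fine (sqintegral g)) D (fun n => inL2_sq_integrable reg n Lg)
  (fun m => @sum_energy_le R x l L reg g m Lg) vS.
apply: (cell_data_Hamiltonian reg D B0 Lf).
have := inL2_lin reg 1 z Lg Lf; congr inL2.
by apply/funext => t; rewrite mul1r.
Qed.

Lemma defect_sum2 z : exists2 K : R, 0 < K & forall f h v, T (f, h) ->
  cell_data x alpha f (cderive f) h v ->
  sum2_le (defect x alpha z v) (K * fine (sqintegral (shifted f h z))).
Proof.
have [K K0 HK] := cell_data_defect reg z alA; exists K => // f h v Tfh D m.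
have [Lf Lh] := Hamiltonian_inL2 Tfh; have Lg := inL2_shifted reg z Lf Lh.
rewrite (shiftedK f h z) in D.
have [H _] := HK _ _ _ _ D (fun n => inL2_sq_integrable reg n Lg).
apply: (@le_trans _ _ (\sum_(n < m) K * energy (y n) (y n.+1) (shifted f h z))).
  by apply: ler_sum => n _; exact: H.
by rewrite -mulr_sumr ler_pM2l//; exact: (sum_energy_le reg).
Qed.

Lemma apriori z m : hyperbolic (tmat z d a0) m -> exists2 K : R, 0 < K & forall f h v, T (f, h) ->
  cell_data x alpha f (cderive f) h v ->
  l2seq v /\ fine (sqintegral f) <= K * (nrm2 (v 0%N) + fine (sqintegral (shifted f h z))).
Proof.
move=> hM; have TM := transfer_mcvg z gap_d alpha_a0.
have [K1 K10 H1] := l2_apriori hM TM.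
have [K2 K20 H2] := defect_sum2 z.
have [K3 K30 H3] := cell_data_inL2 reg z alA.
have [K4 K40 H4] := cell_data_l2 reg alpha.
pose C := K3 * (K1 * (1 + K2) + 1).
have C1 : 0 < K1 * (1 + K2) + 1 by rewrite ltr_pwDr// mulr_ge0//; lra.
have C0 : 0 < C by rewrite mulr_gt0.
exists C => // f h v Tfh D.
have [Lf Lh] := Hamiltonian_inL2 Tfh; have Lg := inL2_shifted reg z Lf Lh.
have lv : l2seq v by eexists; exact: H4 D Lf Lh.
split => //.
have wW := H2 f h v Tfh D.
set q := fine (sqintegral (shifted f h z)) in wW *.
have q0 : 0 <= q by exact: sqintegral_ge0.
have n0 := nrm2_ge0 (v 0%N).
have vV := H1 v (defect x alpha z v) _ (defect_is_sol x alpha z v) lv wW.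
have D' := D; rewrite (shiftedK f h z) in D'.
have [_ H] := H3 _ _ _ _ _ q D' (fun n => inL2_sq_integrable reg n Lg)
  (fun m => @sum_energy_le R x l L reg _ m Lg) vV.
apply: (le_trans H); rewrite /C -mulrA ler_pM2l//.
have h1 : 0 <= K1 * K2 * nrm2 (v 0%N) by rewrite !mulr_ge0// ltW.
have h2 : 0 <= K1 * q by rewrite mulr_ge0// ltW.
lra.
Qed.

Definition bcv : vec := ((sin kappa)%:C, (cos kappa)%:C).

Lemma bc_scale (v : vec) : bc kappa v ->
  v = vscale (v.1 * (sin kappa)%:C + v.2 * (cos kappa)%:C) bcv.
Proof.
case: v => a b; rewrite /bc /vscale /bcv /= => E.
have cs : (sin kappa)%:C ^+ 2 + (cos kappa)%:C ^+ 2 = 1 :> R[i].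
  by rewrite -!rmorphXn -rmorphD/= addrC cos2Dsin2.
congr (_, _).
  have -> : (a * (sin kappa)%:C + b * (cos kappa)%:C) * (sin kappa)%:C =
    a * (sin kappa)%:C ^+ 2 + (b * (sin kappa)%:C) * (cos kappa)%:C by ring.
  rewrite -E -[LHS]mulr1 -cs; ring.
have -> : (a * (sin kappa)%:C + b * (cos kappa)%:C) * (cos kappa)%:C =
  b * (cos kappa)%:C ^+ 2 + (a * (cos kappa)%:C) * (sin kappa)%:C by ring.
rewrite E -[LHS]mulr1 -cs; ring.
Qed.

Lemma bc_bcv : bc kappa bcv.
Proof. by rewrite /bc /bcv /= mulrC. Qed.

Lemma nrm2_bcv : nrm2 bcv = 1.
Proof. by rewrite /nrm2 /bcv /= !normc_real !real_normK ?num_real// addrC cos2Dsin2. Qed.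

Lemma bc_wedge (v : vec) : wedge bcv v = 0 -> bc kappa v.
Proof.
by rewrite /wedge /bcv /bc /= => /eqP; rewrite subr_eq0 => /eqP; rewrite mulrC => ->; rewrite mulrC.
Qed.

Lemma sum2_eq0 (w : nat -> vec) : sum2_le w 0 -> forall n, w n = (0, 0).
Proof.
move=> H n; apply: nrm2_eq0; apply/eqP; rewrite eq_le nrm2_ge0 andbT.
apply: le_trans (H n.+1); rewrite big_ord_recr/= lerDr.
by apply: sumr_ge0 => i _; exact: nrm2_ge0.
Qed.

Lemma eigenfunction_of_data z (phi : nat -> vec) :
  is_sol (transfer x alpha z) (@vzero R) phi -> l2seq phi -> bc kappa (phi 0%N) ->
  exists f, T (f, fun t => z * f t) /\ cell_data x alpha f (cderive f) (fun t => z * f t) phi.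
Proof.
move=> sp lp B0; have [C C0 H] := solve_with_data z.
have [w [wW Hw]] := H _ inL2_cst0.
rewrite sqintegral_cst0 mulr0 in wW.
have -> : (fun f : R -> R[i] => T (f, fun t => z * f t) /\ cell_data x alpha f (cderive f) (fun t => z * f t) phi)
  = (fun f => T (f, fun t => cst 0 t + z * f t) /\
     cell_data x alpha f (cderive f) (fun t => cst 0 t + z * f t) phi).
  apply/funext => f; have -> // : (fun t => z * f t) = (fun t => cst 0 t + z * f t).
  by apply/funext => t; rewrite add0r.
apply: Hw => // n; rewrite sp; congr vadd; rewrite (sum2_eq0 wW).
by [].
Qed.

Lemma eigenvalue_of_data z (phi : nat -> vec) :
  is_sol (transfer x alpha z) (@vzero R) phi -> l2seq phi -> bc kappa (phi 0%N) ->
  phi 0%N != (0, 0) -> Defs.eigenvalue T z.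
Proof.
move=> sp lp B0 p0; have [f [Tf D]] := eigenfunction_of_data sp lp B0.
have [Lf Lh] := Hamiltonian_inL2 Tf.
exists f; first by exists (fun t => z * f t); split => //; exact: eqL2_all.
move=> f0; have [K K0 HK] := cell_data_l2 reg alpha.
have vV := HK _ _ _ _ D Lf Lh.
have h0 : eqL2 (fun t => z * f t) (cst 0).
  apply: filterS f0; first exact: (ae_filter_ringOfSetsType mu).
  by move=> t H /H ->; rewrite mulr0.
rewrite (fine_sqintegral_eq0 Lf f0) (fine_sqintegral_eq0 Lh h0) addr0 mulr0 in vV.
by move: p0; rewrite (sum2_eq0 vV) eqxx.
Qed.

(** As [z] is not an eigenvalue, the nontrivial l2 solution [phi] violates the boundary condition. A
    multiple of it corrects an l2 solution of the inhomogeneous recursion, which gives surjectivity.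
    The Wronskian with [phi] bounds the datum at 0 of any function in the domain, which turns the a
    priori bound into a bound on the inverse. *)
Lemma hyperbolic_resolvent z m : hyperbolic (tmat z d a0) m -> ~ Defs.eigenvalue T z ->
  resolvent_set T z.
Proof.
move=> hM nE; have TM := transfer_mcvg z gap_d alpha_a0.
have dT := transfer_det x alpha z.
have [part [phi [sp lp p0]]] := l2_solutions hM TM dT.
have nb : ~ bc kappa (phi 0%N) by move=> B0; apply: nE; exact: eigenvalue_of_data sp lp B0 p0.
split.
- move=> g Lg; have [C C0 H] := solve_with_data z; have [w [wW Hw]] := H g Lg.
  have [v sv [S vS]] := part w _ wW.
  pose b (u : vec) : R[i] := u.1 * (cos kappa)%:C - u.2 * (sin kappa)%:C.
  have b0 : b (phi 0%N) != 0.
    by apply/eqP => E; apply: nb; apply/eqP; rewrite -subr_eq0; apply/eqP.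
  pose k := - b (v 0%N) / b (phi 0%N).
  pose u n := vadd (v n) (vscale k (phi n)).
  have su : is_sol (transfer x alpha z) w u.
    move=> n; rewrite /u sv sp /vadd /vscale /mapp /=; congr (_, _); ring.
  have lu : l2seq u.
    case: lp => P pP; exists (2 * S + 2 * (normc k ^+ 2 * P)) => j.
    apply: (@le_trans _ _ (\sum_(n < j) (2 * nrm2 (v n) + 2 * (normc k ^+ 2 * nrm2 (phi n))))).
      by apply: ler_sum => n _; rewrite -nrm2Z; exact: nrm2D.
    rewrite big_split/= -!mulr_sumr; apply: lerD; first by rewrite ler_pM2l//; exact: vS.
    by rewrite ler_pM2l//; apply: ler_wpM2l; [exact: sqr_ge0|exact: pP].
  have Bu : bc kappa (u 0%N).
    apply/eqP; rewrite -subr_eq0; apply/eqP.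
    have -> : (u 0%N).1 * (cos kappa)%:C - (u 0%N).2 * (sin kappa)%:C =
      b (v 0%N) + k * b (phi 0%N) by rewrite /u /b /vadd /vscale /=; ring.
    by rewrite /k mulfVK// subrr.
  have [f [Tf D]] := Hw u su lu Bu.
  exists f, (fun t => g t + z * f t); split => //.
  by apply: eqL2_all => t; rewrite /shifted addrK.
- move=> f h Tfh E; apply: contrapT => nf; apply: nE; exists f => //.
  exists h; split => //; apply: filterS E; first exact: (ae_filter_ringOfSetsType mu).
  by move=> t H /H /eqP; rewrite /shifted subr_eq0 => /eqP.
- have [K K0 HK] := apriori hM; have [K2 K20 H2] := defect_sum2 z.
  case: (lp) => P0 pP0; pose P : R := `|P0| + 1.
  have PP : 0 < P by rewrite /P ltr_pwDr.
  have pP : sum2_le phi P.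
    by move=> j; apply: (le_trans (pP0 j)); rewrite /P; have := ler_norm P0; lra.
  pose W := wedge bcv (phi 0%N).
  have W0 : 0 < normc W ^+ 2.
    by rewrite exprn_gt0// normc_gt0; apply/eqP => E; apply: nb; exact: bc_wedge.
  pose C := K * (P * K2 / normc W ^+ 2 + 1).
  have PK : 0 <= P * K2 / normc W ^+ 2.
    by apply: divr_ge0; [apply: mulr_ge0; exact: ltW|exact: ltW].
  have C0 : 0 <= C by apply: mulr_ge0; [exact: ltW|lra].
  exists (Num.sqrt C) => f h Tfh; apply: L2norm_le => //.
  have [v [D B0]] := Hamiltonian_cell_data reg Tfh.
  have [lv Hf] := HK f h v Tfh D.
  apply: (le_trans Hf); rewrite /C -mulrA ler_pM2l// mulrDl mul1r lerD2r.
  have wr := wronskian_bound dT (defect_is_sol x alpha z v) sp lv pP (H2 f h v Tfh D) PP.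
  rewrite (bc_scale B0) nrm2Z nrm2_bcv mulr1 in wr *.
  set k := _ + _ in wr *.
  have E : wedge (vscale k bcv) (phi 0%N) = k * W by rewrite /W /wedge /vscale /=; ring.
  rewrite E normcM exprMn in wr.
  set q := fine _ in wr *.
  have -> : P * K2 / normc W ^+ 2 * q = (P * (K2 * q)) / normc W ^+ 2 by ring.
  by rewrite ler_pdivlMr.
Qed.

End spectral.
End Resolvent.

(** * Nonreal spectral parameters *)

Section NonReal.
Context {R : realType}.
Implicit Types (f h g psi : R -> R[i]) (z : R[i]) (s e t : R).
Local Notation normc := (@Normc.normc R).
Local Notation mu := (@lebesgue_measure R).
Local Notation vec := (R[i] * R[i])%type.

Lemma mulC_conj (w : R[i]) : w * w^* = (normc w ^+ 2)%:C.
Proof. by rewrite sqr_normcE; case: w => a b /=; apply: complexP => /=; ring. Qed.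

Definition flux (v : vec) : R := complex.Im (v.2 * v.1^*).

Lemma flux_scale k v : flux (vscale k v) = normc k ^+ 2 * flux v.
Proof.
rewrite /flux /vscale /=.
have -> : k * v.2 * (k * v.1)^* = (k * k^*) * (v.2 * v.1^*) by rewrite rmorphM/=; ring.
by rewrite mulC_conj ImM /= mul0r addr0.
Qed.

Lemma flux_le v : `|flux v| <= nrm2 v.
Proof.
apply: (le_trans (Im_le_normc _)); rewrite normcM normc_conj /nrm2.
have := sqr_ge0 (normc v.1 - normc v.2); have := sqr_ge0 (normc v.1 + normc v.2).
rewrite sqrrB sqrrD; have := sqr_ge0 (normc v.1); have := sqr_ge0 (normc v.2); lra.
Qed.

(** The factor - Im z makes the derivative nonnegative for either sign of Im z; the term |f'|^2 is
    real and drops out of the imaginary part. *)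
Lemma flux_derive z s v1 v2 t :
  is_derive t 1 (fun t => - complex.Im z * flux (hom z s v1 v2 t, hom1 z s v1 v2 t))
    (complex.Im z ^+ 2 * normc (hom z s v1 v2 t) ^+ 2).
Proof.
have H := is_cderM (is_cder_hom1 z s v1 v2 t) (is_cder_conj (is_cder_hom z s v1 v2 t)).
have [_ HI] := is_cderZ (- complex.Im z)%:C H.
have E1 : (fun t => - complex.Im z * flux (hom z s v1 v2 t, hom1 z s v1 v2 t)) =
  (fun t => complex.Im ((- complex.Im z)%:C * (hom1 z s v1 v2 t * (hom z s v1 v2 t)^*))).
  by apply/funext => u; rewrite ImM /= mul0r addr0.
rewrite E1; apply: is_derive_eq HI _.
set w := hom _ _ _ _ _; set w1 := hom1 _ _ _ _ _.
have -> : - (z * w) * w^* + w1 * w1^* = - z * (w * w^*) + w1 * w1^* by ring.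
rewrite !mulC_conj; rewrite ImM ImD ImM ReN ImN /=; ring.
Qed.

Lemma hom_inv z s v1 v2 t :
  v1 = Cz z (t - s) * hom z s v1 v2 t - Sz z (t - s) * hom1 z s v1 v2 t /\
  v2 = z * Sz z (t - s) * hom z s v1 v2 t + Cz z (t - s) * hom1 z s v1 v2 t.
Proof.
have det := CSz_sqr z (t - s); rewrite /hom /hom1; split.
  by rewrite -[LHS]mul1r -det; ring.
by rewrite -[LHS]mul1r -det; ring.
Qed.

Lemma hom_eq0 z s e v1 v2 : s < e -> (forall t, s < t -> t < e -> hom z s v1 v2 t = 0) ->
  v1 = 0 /\ v2 = 0.
Proof.
move=> se h0; pose c := (s + e) / 2; pose r := (e - s) / 2.
have r0 : 0 < r by rewrite /r; lra.
have c0 : hom z s v1 v2 c = 0 by apply: h0; rewrite /c; lra.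
have c1 : hom1 z s v1 v2 c = 0.
  apply: (is_cder_unique (is_cder_hom z s v1 v2 c)).
  apply: (@is_cder_near _ (fun=> 0) _ _ _ r r0 _ (is_cder_cst 0 c)).
  by move=> u; rewrite ltr_norml /c /r => /andP[? ?]; rewrite h0//; lra.
by have [e1 e2] := hom_inv z s v1 v2 c; rewrite c0 c1 !mulr0 ?subr0 ?addr0 in e1 e2.
Qed.

(** The jump adds the real number a |f|^2 to f' conj(f) and leaves the flux unchanged. Along the
    cell the monotone quantity could stay constant only if the solution vanished, which nonzero data
    exclude. *)
Lemma flux_increase z t a v : complex.Im z != 0 -> 0 < t -> v != (0, 0) ->
  0 < - complex.Im z * (flux (mapp (tmat z t a) v) - flux v).
Proof.
move=> z0 t0 v0.
pose k s := - complex.Im z * flux (hom z 0 v.1 v.2 s, hom1 z 0 v.1 v.2 s).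
have dk s : is_derive s 1 k (complex.Im z ^+ 2 * normc (hom z 0 v.1 v.2 s) ^+ 2) by exact: flux_derive.
have mono u w : u <= w -> k u <= k w.
  move=> uw; have ck : {within `[u, w], continuous k}.
    by apply: derivable_within_continuous => s _; have [] := dk s.
  have [c _ E] := MVT_segment uw (fun s _ => dk s) ck.
  rewrite -subr_ge0 E mulr_ge0 ?subr_ge0//.
  by apply: mulr_ge0; exact: sqr_ge0.
have k0 : k 0 = - complex.Im z * flux v.
  by rewrite /k hom_start hom1_start; case: v {v0 k dk mono}.
have kt : k t = - complex.Im z * flux (mapp (tmat z t a) v).
  rewrite /k -[in tmat z t a](subr0 t) tmat_hom /flux /=; congr (_ * _).
  set p := hom1 _ _ _ _ _; set w := hom _ _ _ _ _.
  by rewrite (mulrDl p) -(mulrA a%:C) mulC_conj ImD [X in _ + X]ImM /= mul0r mulr0 !addr0.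
rewrite mulrBr -kt -k0 subr_gt0 lt_neqAle mono ?ltW// andbT; apply/negP => /eqP E.
have cst s : 0 <= s -> s <= t -> k s = k 0.
  by move=> s0 st; apply/eqP; rewrite eq_le (mono _ _ s0) andbT E; exact: mono.
have locz (F : R -> R[i]) (w w' : R[i]) s : 0 < s -> s < t ->
    (forall u, 0 <= u -> u <= t -> F u = w) -> is_cder F s w' -> w' = 0.
  move=> s0 st Fw dF; apply: (is_cder_unique dF).
  pose r := Num.min s (t - s).
  have [r1 r2] : r <= s /\ r <= t - s by rewrite /r !ge_min !lexx orbT.
  apply: (@is_cder_near _ (fun=> w) _ _ _ r _ _ (is_cder_cst w s)).
    by rewrite /r lt_min s0 subr_gt0.
  by move=> u; rewrite ltr_norml => /andP[? ?]; rewrite Fw//; lra.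
have hz s : 0 < s -> s < t -> hom z 0 v.1 v.2 s = 0.
  move=> s0 st; have dkC : is_cder (fun u => (k u)%:C) s
     (complex.Im z ^+ 2 * normc (hom z 0 v.1 v.2 s) ^+ 2)%:C.
    by split; [exact: dk|exact: is_derive_cst].
  have := locz _ (k 0)%:C _ s s0 st (fun u u0 ut => congr1 _ (cst u u0 ut)) dkC.
  move=> /(congr1 (@complex.Re R)) /= /eqP.
  by rewrite mulf_eq0 !sqrf_eq0 (negPf z0)/= normc_eq0 => /eqP.
have [v1 v2] := hom_eq0 t0 hz.
by move: v0; rewrite [v]surjective_pairing v1 v2 eqxx.
Qed.

Lemma mapp_minvK M (v : vec) : mdet M = 1 -> mapp (minv M) (mapp M v) = v.
Proof.
move=> dM; case: v => p q; case: M dM => [[a b] [c e]]; rewrite /mdet /mapp /minv /= => dM.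
by congr (_, _); rewrite -[RHS]mul1r -[X in _ = X * _]dM; ring.
Qed.

(** Done by cases, since each of the usual candidates built from the entries of M - m may be the
    zero vector. *)
Lemma eigenvector M (m : R[i]) : mdet M = 1 -> mtr M = m + m^-1 -> m != 0 ->
  exists2 v : vec, v != (0, 0) & mapp M v = vscale m v.
Proof.
move=> dM tM m0; have E : M.2.2 = m + m^-1 - M.1.1 by rewrite -tM /mtr addrC addKr.
have D : M.1.2 * M.2.1 = M.1.1 * (m + m^-1 - M.1.1) - 1 by rewrite -E -dM /mdet; ring.
have [p0|p0] := eqVneq M.1.2 0; last first.
  exists (M.1.2, m - M.1.1); first by apply: contraNneq p0 => -[->].
  rewrite /mapp /vscale /=; congr (_, _); first ring.
  rewrite mulrC D E; have mm : m * m^-1 = 1 by rewrite mulfV.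
  have -> : M.1.1 * (m + m^-1 - M.1.1) - 1 + (m + m^-1 - M.1.1) * (m - M.1.1) =
    m * m + m * m^-1 - m * M.1.1 - 1 by ring.
  rewrite mm; ring.
rewrite p0 mul0r in D.
have : (M.1.1 - m) * (M.1.1 - m^-1) = 0.
  have -> : (M.1.1 - m) * (M.1.1 - m^-1) = m * m^-1 - 1 - (M.1.1 * (m + m^-1 - M.1.1) - 1) by ring.
  by rewrite -D mulfV// subrr subr0.
move/eqP; rewrite mulf_eq0 !subr_eq0 => /orP[]/eqP E1; last first.
  exists (0, 1); first by rewrite xpair_eqE oner_eq0 andbF.
  rewrite /mapp /vscale /= p0; congr (_, _); first ring.
  by rewrite E E1; ring.
have [q0|q0] := eqVneq M.2.1 0.
  exists (1, 0); first by rewrite xpair_eqE oner_eq0.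
  by rewrite /mapp /vscale /= p0 q0 E1; congr (_, _); ring.
exists (m - M.2.2, M.2.1); first by apply: contraNneq q0 => -[_ ->].
by rewrite /mapp /vscale /= p0 E E1; congr (_, _); ring.
Qed.

Lemma sqr_normc_eq1_conj (m : R[i]) : normc m = 1 -> m^-1 = m^*.
Proof.
move=> m1; have m0 : m != 0 by rewrite -normc_gt0 m1.
by apply: (mulfI m0); rewrite mulfV// mulC_conj m1 expr1n.
Qed.

Lemma unit_root (D : R[i]) : -1 <= D <= 1 ->
  exists2 m : R[i], normc m = 1 & m + m^-1 = 2 * D.
Proof.
rewrite !lecE /= => /andP[/andP[/eqP I1 h1] /andP[_ h2]].
pose r := complex.Re D; pose s := Num.sqrt (1 - r ^+ 2).
have rs : r ^+ 2 + s ^+ 2 = 1.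
  rewrite /s sqr_sqrtr; first ring.
  have -> : 1 - r ^+ 2 = (1 - r) * (1 + r) by ring.
  by apply: mulr_ge0; rewrite /r; lra.
have m1 : normc (r +i* s) = 1.
  apply/eqP; rewrite -(@eqrXn2 _ 2) ?normc_ge0// sqr_normcE /= rs expr1n//.
exists (r +i* s) => //; rewrite (sqr_normc_eq1_conj m1).
rewrite mulrDl mul1r.
by apply: complexP; rewrite ?ReD ?ImD /= ?I1 ?oppr0 ?addr0 ?subrr.
Qed.

(** The eigenvalues D + q and D - q have product 1, so one of them has modulus at most 1; modulus
    exactly 1 would make D the real part of a point of the unit circle. *)
Lemma hyperbolic_of_discriminant z d a : ~ (-1 <= discriminant d a (sqrtC z) <= 1) ->
  exists m, hyperbolic (tmat z d a) m.
Proof.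
set D := discriminant _ _ _ => nD.
have S0 : Sz z d != 0.
  apply/eqP => S0; apply: nD.
  have := CSz_sqr z d; rewrite S0 expr0n mulr0 addr0 => /eqP.
  rewrite sqrf_eq1 /D discriminantE S0 mulr0 mul0r addr0 => /orP[]/eqP ->.
    by rewrite lexx andbT lecE /= oppr0 eqxx /=; lra.
  by rewrite lexx /= lecE /= oppr0 eqxx /=; lra.
pose q := sqrtC (D ^+ 2 - 1).
have q2 : q ^+ 2 = D ^+ 2 - 1 by exact: sqrtCK.
have pr : (D + q) * (D - q) = 1.
  have -> : (D + q) * (D - q) = D ^+ 2 - q ^+ 2 by ring.
  by rewrite q2; ring.
have main (m m' : R[i]) : m * m' = 1 -> m + m' = 2 * D -> normc m <= 1 ->
    exists m, hyperbolic (tmat z d a) m.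
  move=> mm sm m1.
  have m0 : m != 0 by apply/eqP => m0; move: mm; rewrite m0 mul0r => /eqP; rewrite eq_sym oner_eq0.
  have mV : m' = m^-1 by apply: (mulfI m0); rewrite mm mulfV.
  have [E|] := eqVneq (normc m) 1.
    exfalso; apply: nD; rewrite mV (sqr_normc_eq1_conj E) in sm.
    have -> : D = (complex.Re m)%:C.
      have two0 : (2 : R[i]) != 0 by rewrite pnatr_eq0.
      apply: (mulfI two0); rewrite -sm.
      by apply: complexP; rewrite ?ReD ?ImD ?ReM ?ImM; case: (m) => u v /=; ring.
    have := Re_le_normc m; rewrite E ler_norml => /andP[h1 h2].
    by rewrite !lecE /= oppr0 !eqxx /= h1 h2.
  move=> ne; exists m; split => //.
  - exact: tmat_det.
  - by rewrite tmat_tr -/D -sm mV.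
  - by rewrite lt_neqAle ne m1.
have [h|h] := leP (normc (D + q)) 1.
  by apply: (main (D + q) (D - q)) => //; ring.
apply: (main (D - q) (D + q)); [by rewrite mulrC|ring|].
have : normc (D + q) * normc (D - q) = 1 by rewrite -normcM pr normc1.
have := normc_ge0 (D - q); nra.
Qed.

(** An eigenvector of the monodromy matrix with an eigenvalue of modulus 1 would have the same flux
    before and after one period. *)
Lemma nonreal_discriminant z d a : 0 < d -> complex.Im z != 0 ->
  ~ (-1 <= discriminant d a (sqrtC z) <= 1).
Proof.
move=> d0 z0 /unit_root[m m1 sm].
have m0 : m != 0 by rewrite -normc_gt0 m1.
have [|v v0 Mv] := @eigenvector (tmat z d a) m (tmat_det z d a) _ m0.
  by rewrite tmat_tr sm.
have := flux_increase a z0 d0 v0; rewrite Mv flux_scale m1 expr1n mul1r subrr mulr0.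
by rewrite ltxx.
Qed.

Section spectral.
Variables (x alpha : nat -> R) (l L A kappa : R).
Hypothesis reg : regular x l L.
Hypothesis alA : forall n, `|alpha n| <= A.
Local Notation y := (node x).
Local Notation T := (Hamiltonian kappa x alpha).

Lemma eigenfunction_shifted z f h : T (f, h) -> eqL2 h (fun t => z * f t) ->
  fine (sqintegral (shifted f h z)) = 0.
Proof.
move=> Tf E; have [Lf Lh] := Hamiltonian_inL2 Tf; apply: fine_sqintegral_eq0.
  exact: (inL2_shifted reg).
apply: filterS E; first exact: (ae_filter_ringOfSetsType mu).
by move=> t /= H Ht; rewrite /shifted (H Ht) subrr.
Qed.

(** The shifted function has zero energy in every cell, so the error bounds for the data and for the
    function vanish. The representation therefore holds at each point, not only almost
    everywhere. *)
Lemma eigenfunction_rep z f h v : T (f, h) -> eqL2 h (fun t => z * f t) ->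
  cell_data x alpha f (cderive f) h v ->
  is_sol (transfer x alpha z) (@vzero R) v /\
  forall n t, y n < t -> t <= y n.+1 -> f t = hom z (y n) (v n).1 (v n).2 t.
Proof.
move=> Tf E D; have [Lf Lh] := Hamiltonian_inL2 Tf.
have g0 := eigenfunction_shifted Tf E.
have [K2 K20 H2] := defect_sum2 kappa reg alA z.
have [K K0 HK] := cell_data_defect reg z alA.
split.
- have W : sum2_le (defect x alpha z v) 0.
    by have := H2 f h v Tf D; rewrite g0 mulr0.
  move=> n; rewrite [LHS](defect_is_sol x alpha z v); congr vadd.
  exact: sum2_eq0 W n.
- move=> n t nt tn; have Lg := inL2_shifted reg z Lf Lh.
  rewrite (shiftedK f h z) in D.
  have [_ H] := HK _ _ _ _ D (fun n => inL2_sq_integrable reg n Lg).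
  have e0 : energy (y n) (y n.+1) (shifted f h z) <= 0.
    rewrite -g0; apply: le_trans (sum_energy_le reg n.+1 Lg).
    rewrite big_ord_recr/= lerDr; apply: sumr_ge0 => i _; exact: energy_ge0.
  have h2 : normc (f t - hom z (y n) (v n).1 (v n).2 t) ^+ 2 <= 0.
    by apply: (le_trans (H n t nt tn)); rewrite pmulr_rle0.
  by apply/eqP; rewrite -subr_eq0 -normc_eq0 -sqrf_eq0 eq_le h2 sqr_ge0.
Qed.

Lemma eigenfunction_data z f : eigenfunction T z f -> exists v : nat -> vec,
  [/\ is_sol (transfer x alpha z) (@vzero R) v, l2seq v, bc kappa (v 0%N) &
      forall n t, y n < t -> t <= y n.+1 -> f t = hom z (y n) (v n).1 (v n).2 t].
Proof.
move=> [h [Tf E]]; have [Lf Lh] := Hamiltonian_inL2 Tf.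
have [v [D B0]] := Hamiltonian_cell_data reg Tf; exists v.
have [K4 K40 H4] := cell_data_l2 reg alpha.
have [sv Hf] := eigenfunction_rep Tf E D.
by split => //; eexists; exact: H4 D Lf Lh.
Qed.

Lemma eigenfunction_zero z f (v : nat -> vec) : is_sol (transfer x alpha z) (@vzero R) v ->
  (forall n t, y n < t -> t <= y n.+1 -> f t = hom z (y n) (v n).1 (v n).2 t) ->
  v 0%N = (0, 0) -> eqL2 f (cst 0).
Proof.
move=> sv Hf v0; have vn n : v n = (0, 0).
  elim: n => [//|n IH]; rewrite sv IH /vadd /mapp /=; congr (_, _); ring.
apply: ae_all => t; rewrite /halfline /= in_itv/= andbT => /(cell_index_oc reg)[n [nt tn]].
by rewrite (Hf n t nt tn) vn /= hom0.
Qed.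

(** The boundary vector has zero flux, so the sequence [k] stays above its positive value at node 1,
    whereas square-summable data make it arbitrarily small. *)
Lemma nonreal_not_eigenvalue z : complex.Im z != 0 -> ~ Defs.eigenvalue T z.
Proof.
move=> z0 [f Ef nf]; have [v [sv [S vS] B0 Hf]] := eigenfunction_data Ef.
have v0 : v 0%N != (0, 0).
  by apply/eqP => v0; apply: nf; exact: eigenfunction_zero sv Hf v0.
have svE n : v n.+1 = mapp (transfer x alpha z n) (v n).
  by rewrite sv; case: (mapp _ _) => p q'; rewrite /vadd /vzero /= !addr0.
have vn n : v n != (0, 0).
  elim: n => [//|n IH]; apply: contraNneq IH => E.
  have : mapp (minv (transfer x alpha z n)) (v n.+1) = v n.
    by rewrite svE; exact: mapp_minvK (transfer_det _ _ _ _).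
  by rewrite E /mapp /= !mulr0 addr0 => <-.
pose k n := - complex.Im z * flux (v n).
have kS n : k n < k n.+1.
  have g0 : 0 < y n.+1 - y n by have := node_ltS reg n; lra.
  have := flux_increase (alpha n.+1) z0 g0 (vn n).
  by rewrite -/(transfer x alpha z n) -svE mulrBr subr_gt0.
have k0 : k 0%N = 0.
  rewrite /k (bc_scale B0) flux_scale /flux /bcv /=.
  by rewrite oppr0 !mulr0 mul0r addr0 !mulr0.
have k1 n : k 1%N <= k n.+1.
  by elim: n => [//|n IH]; apply: (le_trans IH); apply: ltW.
have k1_gt0 : 0 < k 1%N by rewrite -k0.
pose c := `|complex.Im z|; have c0 : 0 < c by rewrite normr_gt0.
have e0 : 0 < k 1%N / (2 * c) by rewrite divr_gt0// mulr_gt0.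
have [[//|n] _ Hn] := sum2_small vS e0 1.
have h1 := k1 n; have h2 : k n.+1 <= c * nrm2 (v n.+1).
  apply: (le_trans (ler_norm _)); rewrite /k normrM normrN -/c ler_pM2l//.
  exact: flux_le.
have h3 : c * nrm2 (v n.+1) <= c * (k 1%N / (2 * c)) by rewrite ler_pM2l.
have h4 : c * (k 1%N / (2 * c)) = k 1%N / 2 by field; lra.
lra.
Qed.

End spectral.
End NonReal.

(** * Isolated eigenvalues *)

Section Isolated.
Context {R : realType}.
Implicit Types (f h g psi : R -> R[i]) (z : R[i]) (s e t : R).
Local Notation normc := (@Normc.normc R).
Local Notation mu := (@lebesgue_measure R).
Local Notation vec := (R[i] * R[i])%type.

(** For real energies the derivative of this bracket along two solutions is z' - z times the real
    part of f conj(g), and the jumps cancel in it. *)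
Definition lagrange (v u : vec) : R := complex.Re (v.1 * u.2^* - v.2 * u.1^*).

Lemma lagrange_le v u : `|lagrange v u| <= nrm2 v + nrm2 u.
Proof.
apply: (le_trans (Re_le_normc _)); apply: (le_trans (normcB _ _)).
rewrite !normcM !normc_conj /nrm2.
have := sqr_ge0 (normc v.1 - normc u.2); have := sqr_ge0 (normc v.2 - normc u.1).
rewrite !sqrrB; have := sqr_ge0 (normc v.1); have := sqr_ge0 (normc v.2).
have := sqr_ge0 (normc u.1); have := sqr_ge0 (normc u.2); lra.
Qed.

Lemma lagrange_bcv (kappa : R) : lagrange (bcv kappa) (bcv kappa) = 0.
Proof. by rewrite /lagrange /bcv ReB !ReM /=; ring. Qed.

Lemma lagrange_derive z' z s (v u : vec) t : complex.Im z' = 0 -> complex.Im z = 0 ->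
  is_derive t 1 (fun t => lagrange (hom z' s v.1 v.2 t, hom1 z' s v.1 v.2 t)
       (hom z s u.1 u.2 t, hom1 z s u.1 u.2 t))
    ((complex.Re z' - complex.Re z) *
       complex.Re (hom z' s v.1 v.2 t * (hom z s u.1 u.2 t)^*)).
Proof.
move=> z'0 z0.
have H := is_cderB (is_cderM (is_cder_hom z' s v.1 v.2 t) (is_cder_conj (is_cder_hom1 z s u.1 u.2 t)))
 (is_cderM (is_cder_hom1 z' s v.1 v.2 t) (is_cder_conj (is_cder_hom z s u.1 u.2 t))).
have [HR _] := H; apply: is_derive_eq HR _.
set F := hom z' _ _ _ _; set F1 := hom1 z' _ _ _ _; set P := hom z _ _ _ _; set P1 := hom1 z _ _ _ _.
clearbody F F1 P P1; clear H; case: z' z'0 => a b /= ->; case: z z0 => a' b' /= ->.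
move: F F1 P P1 => [f0 f1] [g0 g1] [p0 p1] [q0 q1] /=; ring.
Qed.

Lemma lagrange_cell z' z s e (a : R) (v u : vec) :
  lagrange (mapp (tmat z' (e - s) a) v) (mapp (tmat z (e - s) a) u) =
  lagrange (hom z' s v.1 v.2 e, hom1 z' s v.1 v.2 e) (hom z s u.1 u.2 e, hom1 z s u.1 u.2 e).
Proof.
rewrite !tmat_hom /lagrange /=.
set F := hom z' _ _ _ _; set F1 := hom1 z' _ _ _ _; set P := hom z _ _ _ _; set P1 := hom1 z _ _ _ _.
by move: F F1 P P1 => [f0 f1] [g0 g1] [p0 p1] [q0 q1] /=; ring.
Qed.

(** A lower bound for the overlap is integrated by the mean value theorem; the division by z' - z
    makes the result insensitive to the sign of that difference. *)
Lemma lagrange_step z' z s (v u : vec) (a b c : R) :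
  complex.Im z' = 0 -> complex.Im z = 0 -> z' != z -> a <= b ->
  (forall t, a < t -> t < b -> c <= complex.Re (hom z' s v.1 v.2 t * (hom z s u.1 u.2 t)^*)) ->
  c * (b - a) <= (complex.Re z' - complex.Re z)^-1 *
    (lagrange (hom z' s v.1 v.2 b, hom1 z' s v.1 v.2 b) (hom z s u.1 u.2 b, hom1 z s u.1 u.2 b) -
     lagrange (hom z' s v.1 v.2 a, hom1 z' s v.1 v.2 a) (hom z s u.1 u.2 a, hom1 z s u.1 u.2 a)).
Proof.
move=> z'0 z0 zz; rewrite le_eqVlt => /orP[/eqP->|ab] H; first by rewrite !subrr !mulr0.
have k0 : complex.Re z' - complex.Re z != 0.
  apply: contra zz => /eqP E; apply/eqP; apply: complexP; last by rewrite z'0 z0.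
  by apply/eqP; rewrite -subr_eq0 E.
pose G t := lagrange (hom z' s v.1 v.2 t, hom1 z' s v.1 v.2 t) (hom z s u.1 u.2 t, hom1 z s u.1 u.2 t).
have dG t := lagrange_derive s v u t z'0 z0.
have cG : {within `[a, b], continuous G}.
  by apply: derivable_within_continuous => t _; have [] := dG t.
have [t] := MVT ab (fun t _ => dG t) cG.
rewrite in_itv/= => /andP[at_ tb] E; rewrite -/(G b) -/(G a) E -mulrA mulKf//.
by apply: ler_wpM2r; [lra|exact: H].
Qed.

(** Polarization: Re(F conj(P)) is half of |F|^2 + |P|^2 - |F - P|^2, and |F|^2 is dropped. *)
Lemma Re_mul_conj_ge (F P : R[i]) (B : R) : normc (F - P) ^+ 2 <= B ->
  normc P ^+ 2 / 2 - B / 2 <= complex.Re (F * P^*).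
Proof.
rewrite !sqr_normcE; case: F => f0 f1; case: P => p0 p1 /= H.
have := sqr_ge0 f0; have := sqr_ge0 f1; rewrite !sqrrB in H; lra.
Qed.

Lemma sum2_small2 (v u : nat -> vec) (S S' : R) : sum2_le v S -> sum2_le u S' ->
  forall e, 0 < e -> forall m, exists2 n, (m <= n)%N & nrm2 (v n) + nrm2 (u n) <= e.
Proof.
move=> vS uS e e0 m; pose w n : vec := ((Num.sqrt (nrm2 (v n)))%:C, (Num.sqrt (nrm2 (u n)))%:C).
have nw n : nrm2 (w n) = nrm2 (v n) + nrm2 (u n).
  by rewrite {1}/nrm2 /w /= !normc_real !real_normK ?num_real// !sqr_sqrtr ?nrm2_ge0.
have [|n mn wn] := @sum2_small R w (S + S') _ e e0 m; last by exists n => //; rewrite -nw.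
move=> k; under eq_bigr do rewrite nw.
by rewrite big_split/=; apply: lerD; [exact: vS|exact: uS].
Qed.

Lemma inL2Z (x : nat -> R) (l L : R) f (k : R[i]) : regular x l L -> inL2 f ->
  inL2 (fun t => k * f t) /\ fine (sqintegral (fun t => k * f t)) = normc k ^+ 2 * fine (sqintegral f).
Proof.
move=> reg Lf; split.
  have := inL2_lin reg k 0 Lf Lf; congr inL2.
  by apply/funext => t; rewrite mul0r addr0.
have [m1 m2 fin] := Lf; rewrite /sqintegral.
under eq_integral do rewrite normcM exprMn EFinM.
rewrite ge0_integralZl//; last by rewrite lee_fin sqr_ge0.
- by rewrite fineM// ge0_fin_numE//; apply: integral_ge0 => t _; rewrite lee_fin sqr_ge0.
- exact: measurable_itv.
- apply/measurable_EFinP; apply: (normc_sqr_measurable _ m1 m2); exact: measurable_itv.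
- by move=> t _; rewrite lee_fin sqr_ge0.
Qed.

Lemma hom_scale z s k v1 v2 t : hom z s (k * v1) (k * v2) t = k * hom z s v1 v2 t.
Proof. by rewrite /hom; ring. Qed.

(** Supplies a fixed positive amount for the overlap of an eigenfunction with nearby ones. *)
Lemma hom_window z s e v1 v2 : s < e -> v1 != 0 \/ v2 != 0 ->
  exists a b c : R, [/\ s <= a, a < b, b <= e, 0 < c &
    forall t, a < t -> t < b -> c <= normc (hom z s v1 v2 t) ^+ 2].
Proof.
move=> se nv; have [t0 [t1 t2 ht]] : exists t, [/\ s < t, t < e & hom z s v1 v2 t != 0].
  apply: contrapT => nh; have [|v10 v20] := @hom_eq0 R z s e v1 v2 se.
    move=> t st te; apply/eqP; apply: contrapT => /negP h; apply: nh.
    by exists t.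
  by case: nv; rewrite ?v10 ?v20 eqxx.
set w := hom z s v1 v2 t0 in ht; pose c : R := normc w / 2.
have c0 : 0 < c by rewrite /c divr_gt0// normc_gt0.
have /cvgC_nbhsP/(_ c c0)[r r0 Hr] := is_cder_cvg (is_cder_hom z s v1 v2 t0).
pose r' := Num.min r (Num.min (t0 - s) (e - t0)).
have [h1 h2 h3] : [/\ r' <= r, r' <= t0 - s & r' <= e - t0].
  by rewrite /r' !ge_min !lexx !orbT.
have h4 : 0 < r' by rewrite /r' !lt_min r0 !subr_gt0 t1.
exists (t0 - r'), (t0 + r'), (c ^+ 2); split; [lra|lra|lra|exact: exprn_gt0|].
move=> t ta tb; have h5 : normc (hom z s v1 v2 t - w) <= c.
  by apply: Hr; rewrite ltr_norml; lra.
have h6 : normc w <= c + normc (hom z s v1 v2 t).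
  have -> : w = - (hom z s v1 v2 t - w) + hom z s v1 v2 t by ring.
  by apply: (le_trans (normcD _ _)); rewrite normcN lerD2r.
have cE : normc w = 2 * c by rewrite /c; field.
rewrite ler_sqr ?nnegrE ?normc_ge0 ?(ltW c0)//; lra.
Qed.

Section spectral.
Variables (x alpha : nat -> R) (l L A d a0 kappa : R).
Hypothesis reg : regular x l L.
Hypothesis alA : forall n, `|alpha n| <= A.
Hypothesis gap_d : tends (fun n => node x n.+1 - node x n) d.
Hypothesis alpha_a0 : tends (fun n => alpha n.+1) a0.
Local Notation y := (node x).
Local Notation T := (Hamiltonian kappa x alpha).

Lemma eigenvalue_normalized z : Defs.eigenvalue T z -> exists v : nat -> vec,
  [/\ is_sol (transfer x alpha z) (@vzero R) v, l2seq v & v 0%N = bcv kappa].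
Proof.
move=> [f Ef nf]; have [v [sv lv B0 Hf]] := eigenfunction_data reg alA Ef.
have E := bc_scale B0; set k := _ + _ in E.
have k0 : k != 0.
  apply/eqP => k0; apply: nf; apply: (eigenfunction_zero reg sv Hf).
  by rewrite E k0 /vscale !mul0r.
exists (fun n => vscale k^-1 (v n)); split.
- by move=> n; rewrite sv /vadd /mapp /vscale /vzero /=; congr (_, _); ring.
- case: lv => S vS; exists (normc k^-1 ^+ 2 * S) => m.
  under eq_bigr do rewrite nrm2Z.
  by rewrite -mulr_sumr; apply: ler_wpM2l; [exact: sqr_ge0|exact: vS].
- by rewrite E /vscale /bcv /= !mulrA !mulVf// !mul1r.
Qed.

(** The boundary condition fixes the data at 0 up to a factor and the recursion fixes the rest, so
    one function spans all eigenfunctions. *)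
Lemma eigenvalue_finite z : Defs.eigenvalue T z -> finite_multiplicity T z.
Proof.
move=> /eigenvalue_normalized[v [sv lv v0]].
have B0 : bc kappa (v 0%N) by rewrite v0; exact: bc_bcv.
have [e [Te De]] := eigenfunction_of_data reg alA sv lv B0.
have [_ He] := eigenfunction_rep reg alA Te (eqL2_all (fun t => erefl)) De.
exists 1%N, (fun=> e) => f Ef; have [u [su lu Bu Hf]] := eigenfunction_data reg alA Ef.
have E := bc_scale Bu; set k := _ + _ in E.
exists (fun=> k); apply: ae_all => t; rewrite /halfline /= in_itv/= andbT big_ord1.
move=> /(cell_index_oc reg)[n [nt tn]]; rewrite (Hf n)// (He n)//.
have -> : u n = vscale k (v n).
  elim: n {nt tn} => [|n IH]; first by rewrite v0.
  by rewrite su sv IH /vadd /mapp /vscale /vzero /=; congr (_, _); ring.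
exact: hom_scale.
Qed.

(** Divided by z' - z, the bracket at node n + 1 is the overlap of the two solutions up to that
    node. By polarization it is at least half of what the second solution contributes on the window
    from [a] to [b], minus half of the summed deviations [B] weighted by the cell lengths. *)
Lemma lagrange_growth z' z (v p : nat -> vec) (B : nat -> R) (a b c : R) :
  complex.Im z' = 0 -> complex.Im z = 0 -> z' != z ->
  is_sol (transfer x alpha z') (@vzero R) v -> is_sol (transfer x alpha z) (@vzero R) p ->
  v 0%N = bcv kappa -> p 0%N = bcv kappa -> (forall n, 0 <= B n) ->
  (forall n t, y n < t -> t < y n.+1 ->
     normc (hom z' (y n) (v n).1 (v n).2 t - hom z (y n) (p n).1 (p n).2 t) ^+ 2 <= B n) ->
  y 0 <= a -> a < b -> b <= y 1 ->
  (forall t, a < t -> t < b -> c <= normc (hom z (y 0) (p 0%N).1 (p 0%N).2 t) ^+ 2) ->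
  forall n, c * (b - a) / 2 - L / 2 * (\sum_(i < n.+1) B i) <=
    (complex.Re z' - complex.Re z)^-1 * lagrange (v n.+1) (p n.+1).
Proof.
move=> z'0 z0 zz sv sp v0 p0 B_ge0 close ya ab by1 Hc.
set k := (complex.Re z' - complex.Re z)^-1; pose g n := k * lagrange (v n) (p n).
pose G n t := lagrange (hom z' (y n) (v n).1 (v n).2 t, hom1 z' (y n) (v n).1 (v n).2 t)
   (hom z (y n) (p n).1 (p n).2 t, hom1 z (y n) (p n).1 (p n).2 t).
have stepB n s e : y n <= s -> s <= e -> e <= y n.+1 -> - (B n / 2) * (e - s) <= k * G n e - k * G n s.
  move=> ns se en; rewrite -mulrBr; apply: lagrange_step => // t st te.
  apply: le_trans (Re_mul_conj_ge (close n t _ _)); [|lra|lra].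
  have := sqr_ge0 (normc (hom z (y n) (p n).1 (p n).2 t)); lra.
have GE n : k * G n (y n) = g n.
  by rewrite /G /g !hom_start !hom1_start; case: (v n); case: (p n).
have GE1 n : k * G n (y n.+1) = g n.+1.
  by rewrite /G /g -(lagrange_cell _ _ _ _ (alpha n.+1)) sv sp /vadd /vzero /= !addr0.
have g0 : g 0%N = 0 by rewrite /g v0 p0 lagrange_bcv mulr0.
have gS n : g n - L * (B n / 2) <= g n.+1.
  have [g1 g2] := regular_gap reg n.
  have := stepB n _ _ (lexx _) (ltW g1) (lexx _); rewrite GE GE1.
  have : (B n / 2) * (y n.+1 - y n) <= (B n / 2) * L by apply: ler_wpM2l => //; have := B_ge0 n; lra.
  lra.
have g1 : c * (b - a) / 2 - L * (B 0%N / 2) <= g 1%N.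
  have [g1 g2] := regular_gap reg 0.
  have h1 := stepB 0%N _ _ (lexx _) ya (ltW (lt_le_trans ab by1)).
  have h3 := stepB 0%N _ _ (le_trans ya (ltW ab)) by1 (lexx _).
  have h2 : (c / 2 - B 0%N / 2) * (b - a) <= k * G 0%N b - k * G 0%N a.
    rewrite -mulrBr; apply: lagrange_step => //; first exact: ltW.
    move=> t ta tb; apply: le_trans (Re_mul_conj_ge (close 0%N t _ _)); [|lra|lra].
    by have := Hc t ta tb; lra.
  rewrite GE g0 in h1; rewrite GE1 in h3.
  have : (B 0%N / 2) * (y 1 - y 0) <= (B 0%N / 2) * L by apply: ler_wpM2l => //; have := B_ge0 0%N; lra.
  lra.
move=> n; rewrite -/(g n.+1).
elim: n => [|n IH]; first by rewrite big_ord1; lra.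
by rewrite big_ord_recr/=; have := gS n.+1; lra.
Qed.

(** Orthogonality takes the form that the bracket of the two data sequences becomes arbitrarily
    small along the nodes; closeness keeps its quotient by z' - z above [del / 2]. *)
Lemma eigenvalue_gap z m : complex.Im z = 0 -> hyperbolic (tmat z d a0) m ->
  Defs.eigenvalue T z -> exists2 r : R, 0 < r & forall z', complex.Im z' = 0 ->
    z' != z -> normc (z' - z) < r -> ~ Defs.eigenvalue T z'.
Proof.
move=> z0 hM /eigenvalue_normalized[p [sp lp p0]].
have TM := transfer_mcvg z gap_d alpha_a0.
have [K1 K10 H1] := l2_apriori hM TM.
have [K2 K20 H2] := defect_sum2 kappa reg alA z.
have [K3 K30 H3] := cell_data_defect reg z alA.
have [K4 K40 H4] := apriori kappa reg alA gap_d alpha_a0 hM.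
have [K5 K50 H5] := hom_sqr_bound L z.
have L0 := regular_L_gt0 reg.
have [a [b [c [ya ab by1 c0 Hc]]]] : exists a b c : R, [/\ y 0 <= a, a < b, b <= y 1, 0 < c &
    forall t, a < t -> t < b -> c <= normc (hom z (y 0) (p 0%N).1 (p 0%N).2 t) ^+ 2].
  apply: hom_window; first exact: (node_ltS reg 0).
  rewrite p0 /bcv /=.
  have [s0|] := eqVneq (sin kappa) 0; last by left; rewrite fmorph_eq0.
  right; rewrite fmorph_eq0; apply/eqP => k0.
  by have := cos2Dsin2 kappa; rewrite k0 s0 !expr0n addr0 => /eqP; rewrite eq_sym oner_eq0.
pose C := 2 * K3 + 2 * (K5 * (K1 * K2)).
have C0 : 0 < C by rewrite addr_gt0// !mulr_gt0.
pose del : R := c * (b - a) / 2.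
have del0 : 0 < del by rewrite !mulr_gt0// subr_gt0.
(* the two smallness conditions: [K4 r^2 <= 1/2] and [L C r^2 2 K4 / 2 <= del / 2] *)
pose r2 := Num.min ((2 * K4)^-1) (del / (2 * (L * (C * K4)))).
have LCK : 0 < L * (C * K4) by rewrite !mulr_gt0.
have r20 : 0 < r2 by rewrite /r2 lt_min invr_gt0 (mulr_gt0 _ K40)// (divr_gt0 del0)// mulr_gt0.
exists (Num.sqrt r2); first by rewrite sqrtr_gt0.
move=> z' z'0 zz zr /eigenvalue_normalized[v [sv lv v0]].
have B0 : bc kappa (v 0%N) by rewrite v0; exact: bc_bcv.
have [f [Tf D]] := eigenfunction_of_data reg alA sv lv B0.
have [_ Hf] := eigenfunction_rep reg alA Tf (eqL2_all (fun t => erefl)) D.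
have [Lf Lh] := Hamiltonian_inL2 Tf.
pose q := normc (z' - z) ^+ 2; have q0 : 0 <= q by exact: sqr_ge0.
have qr : q <= r2.
  by rewrite /q -[leRHS](sqr_sqrtr (ltW r20)) ler_sqr ?nnegrE ?normc_ge0 ?sqrtr_ge0// ltW.
have qK : q * (2 * K4) <= 1.
  by rewrite -ler_pdivlMr ?mulr_gt0// div1r; apply: (le_trans qr); rewrite /r2 ge_min lexx.
have qC : q * (2 * (L * (C * K4))) <= del.
  rewrite -ler_pdivlMr ?mulr_gt0//; apply: (le_trans qr).
  by rewrite /r2 ge_min lexx orbT.
have gE : shifted f (fun t => z' * f t) z = (fun t => (z' - z) * f t).
  by apply/funext => t; rewrite /shifted -mulrBl.
have [Lg gF] := inL2Z (z' - z) reg Lf; rewrite -gE -/q in Lg gF.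
set F := fine (sqintegral f) in gF.
have F0 : 0 <= F by exact: sqintegral_ge0.
have [_ Fle] := H4 _ _ _ Tf D; rewrite -/F gF v0 nrm2_bcv in Fle.
(* The a priori bound reads F <= K4 (1 + q F), and the first smallness condition absorbs the last
   term. *)
have F2 : F <= 2 * K4 by have := ler_wpM2r F0 qK; lra.
have dW := H2 _ _ _ Tf D; rewrite gF in dW.
(* The difference of the normalized data starts at 0, so the bound for the recursion at z leaves
   only the defect of [v], which is of order q F. *)
pose u n := vadd (v n) (vscale (-1) (p n)).
have su : is_sol (transfer x alpha z) (defect x alpha z v) u.
  move=> n; rewrite /u sp /defect /vadd /vscale /mapp /vzero /=; congr (_, _); ring.
have lu : l2seq u.
  case: lv lp => S vS [S' pS]; exists (2 * S + 2 * S') => k.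
  apply: (@le_trans _ _ (\sum_(n < k) (2 * nrm2 (v n) + 2 * nrm2 (p n)))).
    apply: ler_sum => n _; apply: (le_trans (nrm2D _ _)).
    by rewrite nrm2Z normcN normc1 expr1n mul1r.
  by rewrite big_split/= -!mulr_sumr; apply: lerD; rewrite ler_pM2l ?ltr0n//; [exact: vS|exact: pS].
have uU := H1 _ _ _ su lu dW.
have u0 : nrm2 (u 0%N) = 0.
  by rewrite /u v0 p0 /vadd /vscale /= !mulN1r !subrr /nrm2 /= normc0 expr0n addr0.
rewrite u0 add0r in uU.
pose B n := 2 * (K3 * energy (y n) (y n.+1) (shifted f (fun t => z' * f t) z)) + 2 * (K5 * nrm2 (u n)).
have BS k : \sum_(n < k) B n <= C * (q * F).
  rewrite big_split/= -!mulr_sumr /C.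
  have h1 := ler_wpM2l (ltW K30) (sum_energy_le reg k Lg); rewrite gF in h1.
  have h2 := ler_wpM2l (ltW K50) (uU k); lra.
have D' := D; rewrite (shiftedK f (fun t => z' * f t) z) in D'.
have [_ Hpt] := H3 _ _ _ _ D' (fun n => inL2_sq_integrable reg n Lg).
have close n t : y n < t -> t < y n.+1 ->
   normc (hom z' (y n) (v n).1 (v n).2 t - hom z (y n) (p n).1 (p n).2 t) ^+ 2 <= B n.
  move=> nt tn; have h1 := Hpt n t nt (ltW tn); rewrite (Hf n t nt (ltW tn)) in h1.
  have [g1 g2] := regular_gap reg n.
  have h2 : normc (hom z (y n) (u n).1 (u n).2 t) ^+ 2 <= K5 * nrm2 (u n)
    by apply: H5; [exact: ltW|]; apply: le_trans g2; rewrite lerD2r ltW.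
  have -> : hom z' (y n) (v n).1 (v n).2 t - hom z (y n) (p n).1 (p n).2 t =
    (hom z' (y n) (v n).1 (v n).2 t - hom z (y n) (v n).1 (v n).2 t) + hom z (y n) (u n).1 (u n).2 t.
    by rewrite /u /vadd /vscale /hom /=; ring.
  by apply: (le_trans (sqr_normcD_le _ _)); apply: lerD; rewrite ler_pM2l.
have B_ge0 n : 0 <= B n by apply: addr_ge0; apply: mulr_ge0 => //; apply: mulr_ge0; rewrite ?energy_ge0 ?nrm2_ge0 ?ltW.
set k := (complex.Re z' - complex.Re z)^-1; pose g n := k * lagrange (v n) (p n).
have gn n : del - L / 2 * (\sum_(i < n.+1) B i) <= g n.+1.
  exact: lagrange_growth z'0 z0 zz sv sp v0 p0 B_ge0 close ya ab by1 Hc n.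
have gn2 n : del / 2 <= g n.+1.
  apply: le_trans (gn n).
  have L2 : 0 <= L / 2 by apply: divr_ge0 => //; exact: ltW.
  have h1 : L / 2 * (\sum_(i < n.+1) B i) <= L / 2 * (C * (q * F)) by exact: ler_wpM2l.
  have h2 : L / 2 * (C * (q * F)) <= L / 2 * (C * (q * (2 * K4))).
    by apply: ler_wpM2l => //; apply: ler_wpM2l; [exact: ltW|]; apply: ler_wpM2l.
  lra.
case: lv lp => S vS [S' pS].
have kn : 0 < `|k|.
  rewrite normr_gt0 invr_eq0; apply: contra zz => /eqP E; apply/eqP; apply: complexP; last by rewrite z'0 z0.
  by apply/eqP; rewrite -subr_eq0 E.
have e0 : 0 < del / 4 / `|k| by rewrite divr_gt0// divr_gt0.
have [[//|n] _ Hn] := sum2_small2 vS pS e0 1.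
have h1 := gn2 n; have h2 : g n.+1 <= `|k| * (nrm2 (v n.+1) + nrm2 (p n.+1)).
  by apply: (le_trans (ler_norm _)); rewrite normrM ler_pM2l//; exact: lagrange_le.
have h3 : `|k| * (nrm2 (v n.+1) + nrm2 (p n.+1)) <= del / 4 by rewrite mulrC -ler_pdivlMr.
clear - h1 h2 h3 del0; lra.
Qed.

End spectral.
End Isolated.

(** * Weyl sequences *)

Section Weyl.
Context {R : realType}.
Implicit Types (f h g psi : R -> R[i]) (z : R[i]) (s e t : R).
Local Notation normc := (@Normc.normc R).
Local Notation mu := (@lebesgue_measure R).
Local Notation vec := (R[i] * R[i])%type.

(** The double zeros at both ends make the continuation by 0 continuously differentiable, as
    membership in the domain demands. [cut1], [cut2] and [cut3] are the successive derivatives. *)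
Definition cut s e t : R[i] := ((t%:C - s%:C) * (e%:C - t%:C)) ^+ 2.
Definition cut1 s e t : R[i] :=
  2 * ((t%:C - s%:C) * (e%:C - t%:C)) * (s%:C + e%:C - 2 * t%:C).
Definition cut2 s e t : R[i] :=
  2 * (s%:C + e%:C - 2 * t%:C) ^+ 2 - 4 * ((t%:C - s%:C) * (e%:C - t%:C)).
Definition cut3 s e t : R[i] := - 12 * (s%:C + e%:C - 2 * t%:C).

Lemma is_cder_endpoints s e t :
  is_cder (fun t => (t%:C - s%:C) * (e%:C - t%:C)) t (s%:C + e%:C - 2 * t%:C) /\
  is_cder (fun t => s%:C + e%:C - 2 * t%:C) t (- 2).
Proof.
have i0 := is_cder_id t; split.
  apply: is_cder_eq (is_cderM (is_cderB i0 (is_cder_cst s%:C t)) (is_cderB (is_cder_cst e%:C t) i0)) _.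
  by ring.
by apply: is_cder_eq (is_cderB (is_cder_cst (s%:C + e%:C) t) (is_cderZ 2 i0)) _; ring.
Qed.

Lemma is_cder_cut s e t : is_cder (cut s e) t (cut1 s e t).
Proof.
have [dPQ _] := is_cder_endpoints s e t.
apply: is_cder_eq (is_cder_ext _ (is_cderM dPQ dPQ)) _.
  by move=> u; rewrite /cut expr2.
by rewrite /cut1; ring.
Qed.

Lemma is_cder_cut1 s e t : is_cder (cut1 s e) t (cut2 s e t).
Proof.
have [dPQ dS] := is_cder_endpoints s e t.
by apply: is_cder_eq (is_cderM (is_cderZ 2 dPQ) dS) _; rewrite /cut2; ring.
Qed.

Lemma is_cder_cut2 s e t : is_cder (cut2 s e) t (cut3 s e t).
Proof.
have [dPQ dS] := is_cder_endpoints s e t.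
apply: is_cder_eq (is_cder_ext _ (is_cderB (is_cderZ 2 (is_cderM dS dS))
  (is_cderZ 4 dPQ))) _; first by move=> u; rewrite /cut2 expr2.
by rewrite /cut3; ring.
Qed.

Lemma cut_end s e : [/\ cut s e s = 0, cut s e e = 0, cut1 s e s = 0 & cut1 s e e = 0].
Proof. by rewrite /cut /cut1 !subrr !(mul0r, mulr0) expr0n. Qed.

Lemma cut_lower s e t k : 0 <= k -> k <= t - s -> k <= e - t ->
  (k ^+ 4) ^+ 2 <= normc (cut s e t) ^+ 2.
Proof.
move=> k0 ks ke; have -> : cut s e t = (((t - s) * (e - t)) ^+ 2)%:C.
  by rewrite /cut -!rmorphB -rmorphM -rmorphXn.
rewrite normc_real ger0_norm ?sqr_ge0// ler_sqr ?nnegrE ?sqr_ge0 ?exprn_ge0//.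
have -> : k ^+ 4 = (k * k) ^+ 2 by ring.
rewrite ler_sqr ?nnegrE; [by apply: ler_pM|exact: mulr_ge0|apply: mulr_ge0; lra].
Qed.

Lemma cut_upper s e t V : s <= t -> t <= e -> e - s <= V ->
  [/\ normc (cut s e t) <= V ^+ 4, normc (cut1 s e t) <= 2 * V ^+ 3 &
    normc (cut2 s e t) <= 6 * V ^+ 2].
Proof.
move=> st te eV; pose p := t - s; pose q := e - t.
have [p0 pV] : 0 <= p /\ p <= V by rewrite /p; lra.
have [q0 qV] : 0 <= q /\ q <= V by rewrite /q; lra.
have V0 : 0 <= V by lra.
have pq : p * q <= V * V by apply: ler_pM.
have pq0 : 0 <= p * q by exact: mulr_ge0.
have ab : `|q - p| <= V by rewrite ler_norml; lra.
have -> : cut s e t = ((p * q) ^+ 2)%:C.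
  by rewrite /cut /p /q !(rmorphM, rmorphB, rmorphXn).
have -> : cut1 s e t = (2 * (p * q) * (q - p))%:C.
  by rewrite /cut1 /p /q !(rmorphM, rmorphB, rmorph_nat)/=; ring.
have -> : cut2 s e t = (2 * (q - p) ^+ 2 - 4 * (p * q))%:C.
  by rewrite /cut2 /p /q !(rmorphM, rmorphB, rmorph_nat, rmorphXn)/=; ring.
have V2 : (q - p) ^+ 2 <= V * V.
  by rewrite -real_normK ?num_real// expr2; apply: ler_pM.
have := sqr_ge0 (q - p); have -> : V ^+ 2 = V * V by ring.
rewrite !normc_real; split; last by rewrite ler_norml; lra.
  have -> : V ^+ 4 = (V * V) ^+ 2 by ring.
  by rewrite ger0_norm ?sqr_ge0// ler_sqr// nnegrE; exact: mulr_ge0.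
rewrite !normrM (ger0_norm p0) (ger0_norm q0) ger0_norm//.
have -> : 2 * V ^+ 3 = 2 * (V * V) * V by ring.
by apply: ler_pM => //; lra.
Qed.

Lemma cell_measurable s e (F f : R -> R[i]) : (forall t, exists w, is_cder F t w) ->
  (forall t, s < t -> t <= e -> f t = F t) ->
  measurable_fun (`]s, e] : set R) (fun t => complex.Re (f t)) /\
  measurable_fun (`]s, e] : set R) (fun t => complex.Im (f t)).
Proof.
move=> dF fF; split.
  apply: (@eq_measurable_fun _ _ _ _ _ (fun t => complex.Re (F t))).
    by move=> t /set_mem /=; rewrite in_itv/= => /andP[st te]; rewrite fF.
  by apply: continuous_measurable_itv => t; have [w /is_cder_cvg[]] := dF t.
apply: (@eq_measurable_fun _ _ _ _ _ (fun t => complex.Im (F t))).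
  by move=> t /set_mem /=; rewrite in_itv/= => /andP[st te]; rewrite fF.
by apply: continuous_measurable_itv => t; have [w /is_cder_cvg[]] := dF t.
Qed.

Lemma hom1_sqr_bound (L : R) z : exists2 K : R, 0 < K & forall s t v1 v2, s <= t -> t - s <= L ->
  normc (hom1 z s v1 v2 t) ^+ 2 <= K * (normc v1 ^+ 2 + normc v2 ^+ 2).
Proof.
have [K K1 HK] := CSz_bounded z L; pose C : R := (1 + normc z) * K.
have nz := normc_ge0 z; have CK : K <= C by rewrite /C ler_peMl//; lra.
have C2 : 0 < C ^+ 2 by rewrite exprn_gt0//; lra.
exists (2 * C ^+ 2); first lra.
move=> s t v1 v2 st tL; have [||h1 h2] := HK (t - s); [lra|lra|].
apply: (@lin_bound R (- z * Sz z (t - s)) (Cz z (t - s)) (v1, v2) C); last exact: le_trans CK.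
rewrite normcM normcN /C mulrDl mul1r.
by have := ler_wpM2l nz h2; lra.
Qed.

Lemma sum_window (N J m : nat) (b : R) : 0 <= b ->
  \sum_(n < m) (if (N <= n < N + J)%N then b else 0) <= J%:R * b.
Proof.
move=> b0; have -> : \sum_(n < m) (if (N <= n < N + J)%N then b else 0) = (minn (m - N) J)%:R * b.
  elim: m => [|m IH]; first by rewrite big_ord0 sub0n min0n mul0r.
  rewrite big_ord_recr/= IH; case: ifPn => h.
    have -> : minn (m.+1 - N) J = (minn (m - N) J).+1 by lia.
    by rewrite -natr1 mulrDl mul1r.
  by rewrite addr0; congr (_%:R * _); lia.
by apply: ler_wpM2r => //; rewrite ler_nat geq_minr.
Qed.

Lemma window_edge (N M n : nat) : (N <= M)%N -> (N <= n < M)%N != (N <= n.+1 < M)%N ->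
  n.+1 = N \/ n.+1 = M.
Proof. by lia. Qed.

(** The number J of steps is fixed before the starting time, so the finitely many errors made in
    replacing [T] by [M] are all small for late starts. *)
Lemma eigenvector_tracking (T : nat -> (R[i] * R[i]) * (R[i] * R[i])) M (m : R[i]) (e : vec) :
  mcvg T M -> normc m = 1 -> mapp M e = vscale m e -> forall J (eta : R), 0 < eta ->
  exists N0, forall N, (N0 <= N)%N -> forall j, (j <= J)%N ->
    nrm2 (vadd (sol (fun n => T (N + n)%N) (@vzero R) e j) (vscale (-1) (vscale (m ^+ j) e))) <= eta.
Proof.
move=> TM m1 Me; pose E := nrm2 e; have E0 : 0 <= E by exact: nrm2_ge0.
pose Kb : R := normc M.1.1 + normc M.1.2 + (normc M.2.1 + normc M.2.2).
have [n1 n2] := (normc_ge0 M.1.1, normc_ge0 M.1.2).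
have [n3 n4] := (normc_ge0 M.2.1, normc_ge0 M.2.2).
have MK : mbound M Kb by split; rewrite /Kb; lra.
have K0 : 0 <= Kb by rewrite /Kb; lra.
have K2 : 0 <= Kb ^+ 2 by exact: sqr_ge0.
elim=> [|J IH] eta eta0.
  exists 0%N => N _ j; rewrite leqn0 => /eqP ->.
  rewrite /= expr0 /nrm2 /vadd /vscale /= !mul1r !mulN1r !subrr normc0 expr0n addr0.
  exact: ltW.
(* One more step multiplies the old deviation by at most 8 Kb^2 and adds 8 de^2 times the square
   norm of the current vector; [eta'] and [de] make each part at most [eta / 2]. *)
pose eta' := Num.min eta (eta / (16 * Kb ^+ 2 + 16)).
have D0 : 0 < 16 * Kb ^+ 2 + 16 by lra.
have eta'0 : 0 < eta' by rewrite /eta' lt_min eta0 divr_gt0.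
have [h1 h2] : eta' <= eta /\ eta' * (16 * Kb ^+ 2 + 16) <= eta.
  by rewrite -ler_pdivlMr// /eta' !ge_min !lexx orbT.
have [N1 H1] := IH eta' eta'0.
pose de := Num.sqrt (eta / (32 * (eta + E))).
have D1 : 0 < 32 * (eta + E) by lra.
have D2 : 0 < eta / (32 * (eta + E)) by exact: divr_gt0.
have de0 : 0 < de by rewrite sqrtr_gt0.
have de2 : de ^+ 2 * (32 * (eta + E)) = eta.
  by rewrite sqr_sqrtr ?ltW// divfK// gt_eqF.
have [N2 H2] := TM de de0.
exists (maxn N1 N2) => N; rewrite geq_max => /andP[NN1 NN2] j jJ.
have := H1 N NN1 j; case: (leqP j J) => [jJ' /(_ isT) h|Jj _]; first exact: le_trans h1.
have -> : j = J.+1 by apply/eqP; rewrite eqn_leq jJ Jj.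
have := H1 N NN1 J (leqnn J).
rewrite [sol _ _ _ J.+1]/=; set S := sol _ _ _ _ => HS.
have eqS : vadd (vadd (mapp (T (N + J)%N) S) (@vzero R J)) (vscale (-1) (vscale (m ^+ J.+1) e)) =
   vadd (mapp M (vadd S (vscale (-1) (vscale (m ^+ J) e)))) (mapp (msub (T (N + J)%N) M) S).
  have E1 := congr1 fst Me; have E2 := congr1 snd Me; rewrite /mapp /vscale /= in E1 E2.
  rewrite /vadd /mapp /vscale /msub /vzero /= exprS; congr (_, _).
    have -> : m * m ^+ J * e.1 = m ^+ J * (m * e.1) by ring.
    by rewrite -E1; ring.
  have -> : m * m ^+ J * e.2 = m ^+ J * (m * e.2) by ring.
  by rewrite -E2; ring.
rewrite eqS; apply: (le_trans (nrm2D _ _)).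
have h3 := mapp_bound (vadd S (vscale (-1) (vscale (m ^+ J) e))) MK.
have h4 := mapp_bound S (H2 (N + J)%N (leq_trans NN2 (leq_addr _ _))).
have h5 : nrm2 S <= 2 * eta' + 2 * E.
  have -> : S = vadd (vadd S (vscale (-1) (vscale (m ^+ J) e))) (vscale (m ^+ J) e).
    by rewrite /vadd /vscale /=; case: (S) => p q /=; congr (_, _); ring.
  apply: (le_trans (nrm2D _ _)); rewrite [X in _ + 2 * X]nrm2Z normcXn m1 !expr1n mul1r.
  by rewrite lerD2r ler_pM2l.
have h6 : 4 * Kb ^+ 2 * nrm2 (vadd S (vscale (-1) (vscale (m ^+ J) e))) <= 4 * Kb ^+ 2 * eta'.
  by apply: ler_wpM2l => //; lra.
have d2 := sqr_ge0 de.
have h7 : de ^+ 2 * nrm2 S <= de ^+ 2 * (2 * eta + 2 * E) by apply: ler_wpM2l => //; lra.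
clear - h3 h4 h6 h7 de2 h2 eta'0 D0.
lra.
Qed.

Section spectral.
Variables (x alpha : nat -> R) (l L A d a0 kappa : R).
Hypothesis reg : regular x l L.
Hypothesis alA : forall n, `|alpha n| <= A.
Hypothesis gap_d : tends (fun n => node x n.+1 - node x n) d.
Hypothesis alpha_a0 : tends (fun n => alpha n.+1) a0.
Local Notation y := (node x).
Local Notation T := (Hamiltonian kappa x alpha).

Lemma node_span n k : k%:R * l <= y (n + k)%N - y n <= k%:R * L.
Proof.
have [l0 H] := reg; elim: k => [|k IH]; first by rewrite addn0 subrr !mul0r lexx.
rewrite addnS -natr1 !mulrDl !mul1r; have := H (n + k)%N; move: IH => /andP[? ?] /andP[? ?].
by apply/andP; split; lra.
Qed.

(** The variant for [h], which may jump at the nodes and is integrated over cells closed on the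
    right; [f] itself is continuous there and fits both conventions. *)
Lemma glue_oc (F : nat -> R -> R[i]) : exists f, forall n t, y n < t -> t <= y n.+1 -> f t = F n t.
Proof.
have H t : exists n, 0 < t -> y n < t /\ t <= y n.+1.
  have [t0|t0] := ltP 0 t; last by exists 0%N.
  by have [n Hn] := cell_index_oc reg t0; exists n.
have [idx Hidx] := choice H; exists (fun t => F (idx t) t) => n t nt tn.
have [h1 h2] := Hidx t (le_lt_trans (node_ge0 reg n) nt).
congr (F _ t); apply/eqP; rewrite eqn_leq; apply/andP; split.
  by rewrite leqNgt; apply/negP => h; have := node_le reg h; lra.
by rewrite leqNgt; apply/negP => h; have := node_le reg h; lra.
Qed.

(** For a product of a cut-off and a solution, the terms with the undifferentiated cut-off cancel in
    h - z f. Since [X] and [X1] match at the nodes, the product inherits the jump condition of the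
    solution. *)
Lemma cutoff_data z (u : nat -> vec) (X X1 X2 X3 : nat -> R -> R[i]) :
  is_sol (transfer x alpha z) (@vzero R) u ->
  (forall n t, is_cder (X n) t (X1 n t)) -> (forall n t, is_cder (X1 n) t (X2 n t)) ->
  (forall n t, is_cder (X2 n) t (X3 n t)) ->
  (forall n, X n (y n.+1) = X n.+1 (y n.+1)) -> (forall n, X1 n (y n.+1) = X1 n.+1 (y n.+1)) ->
  exists f h, cell_data x alpha f (cderive f) h (fun n =>
      (X n (y n) * (u n).1, X n (y n) * (u n).2 + X1 n (y n) * (u n).1)) /\
    forall n t, y n < t -> t <= y n.+1 ->
      f t = X n t * hom z (y n) (u n).1 (u n).2 t /\
      shifted f h z t = - (2 * (X1 n t * hom1 z (y n) (u n).1 (u n).2 t) +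
        X2 n t * hom z (y n) (u n).1 (u n).2 t).
Proof.
move=> su dX dX1 dX2 XE X1E.
pose w n := hom z (y n) (u n).1 (u n).2; pose w1 n := hom1 z (y n) (u n).1 (u n).2.
have dw n t : is_cder (w n) t (w1 n t) by exact: is_cder_hom.
have dw1 n t : is_cder (w1 n) t (- (z * w n t)) by exact: is_cder_hom1.
pose F n t := X n t * w n t; pose F1 n t := X1 n t * w n t + X n t * w1 n t.
pose F2 n t := X2 n t * w n t + 2 * (X1 n t * w1 n t) - X n t * (z * w n t).
have dF n t : is_cder (F n) t (F1 n t) by exact: is_cderM.
have dF1 n t : is_cder (F1 n) t (F2 n t).
  apply: is_cder_eq (is_cderD (is_cderM (dX1 n t) (dw n t)) (is_cderM (dX n t) (dw1 n t))) _.
  by rewrite /F2; ring.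
have dF2 n t : exists l', is_cder (F2 n) t l'.
  eexists; apply: is_cderB.
    apply: is_cderD; first exact: is_cderM (dX2 n t) (dw n t).
    apply: is_cderZ; exact: is_cderM (dX1 n t) (dw1 n t).
  apply: is_cderM (dX n t) _; apply: is_cderZ; exact: dw.
have [f fF] := glue reg F; have [h hF] := glue_oc (fun n t => - F2 n t).
have wS n : w n (y n.+1) = (u n.+1).1 /\ w1 n (y n.+1) = (u n.+1).2 - (alpha n.+1)%:C * (u n.+1).1.
  by rewrite su tmat_hom /vadd /vzero /= !addr0 addrK.
exists f, h; have D : cell_data x alpha f (cderive f) h (fun n =>
      (X n (y n) * (u n).1, X n (y n) * (u n).2 + X1 n (y n) * (u n).1)).
  apply: (glued_cell_data reg fF (F1 := F1)).
  - move=> n; apply: (cellsol_congr (h := fun t => - F2 n t)).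
      by move=> t nt tn; rewrite (hF n)// ltW.
    apply: cellsol_smooth => //; have [f3 Hf3] := choice (dF2 n); by exists f3.
  - by move=> n; rewrite /F /w hom_start.
  - move=> n; have c0 := cvgC_nbhs_right (is_cder_cvg (dF n (y n))).
    have c1 := cvgC_nbhs_right (is_cder_cvg (dF1 n (y n))).
    by move: c0 c1; rewrite {2}/F {2}/F1 /w /w1 hom_start hom1_start /= addrC.
  - move=> n; have c0 := cvgC_nbhs_left (is_cder_cvg (dF n (y n.+1))).
    have c1 := cvgC_nbhs_left (is_cder_cvg (dF1 n (y n.+1))).
    have [e0 e1] := wS n; split => /=.
      by move: c0; rewrite {2}/F e0 XE.
    move: c1; rewrite {2}/F1 e0 e1 XE X1E; congr (cvgC _ _ _).
    by rewrite /=; ring.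
split => // n t nt tn; have fE : f t = F n t.
  have [E|ne] := eqVneq t (y n.+1).
    have [e0 _] := wS n; have [_ _ _ fv] := D.
    by rewrite E fv /F e0 XE.
  by rewrite (fF n) ?(ltW nt)// lt_neqAle ne tn.
split => //; rewrite /shifted (hF n)// fE /F /F2 -/(w n) -/(w1 n); ring.
Qed.

(** The bound of data by energies, for a homogeneous solution, where the second energy is |z|^2
    times the first. *)
Lemma hom_energy_lower z : exists2 c : R, 0 < c & forall n (v : vec),
  sq_integrable (y n) (y n.+1) (hom z (y n) v.1 v.2) /\
  c * nrm2 v <= energy (y n) (y n.+1) (hom z (y n) v.1 v.2).
Proof.
have [l0 Hl] := reg; have [K K0 HK] := cell_data_bound L l0.
pose q : R := 1 + normc z ^+ 2.
have q0 : 0 < q by have := sqr_ge0 (normc z); rewrite /q; lra.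
have C0 : 0 < 2 * K * q by rewrite !mulr_gt0.
exists (2 * K * q)^-1; first by rewrite invr_gt0.
move=> n v.
have /andP[g1 g2] := Hl n; have [g3 g4] := regular_gap reg n.
pose w := hom z (y n) v.1 v.2; have dw t := is_cder_hom z (y n) v.1 v.2 t.
have [m1 m2] := cell_measurable (s := y n) (e := y n.+1) (fun t => ex_intro _ _ (dw t)) (fun t _ _ => erefl (w t)).
have [K' K'0 HK'] := is_cder_bounded (y n) (y n.+1) dw.
have [sw _] : sq_integrable (y n) (y n.+1) w /\ energy (y n) (y n.+1) w <= K' ^+ 2 * (y n.+1 - y n).
  apply: sq_integrable_bounded => //; first exact: ltW.
  by move=> t nt tn; rewrite ler_sqr ?nnegrE ?normc_ge0//; apply: HK' => //; exact: ltW.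
have [szw ew] := sq_integrable_lin z 0 sw sw.
have zE : (fun t => z * w t + 0 * w t) = (fun t => z * w t).
  by apply/funext => t; rewrite mul0r addr0.
rewrite zE in szw ew.
have e0 := energy_ge0 (y n) (y n.+1) w.
have eE : energy (y n) (y n.+1) (fun t => z * w t) = normc z ^+ 2 * energy (y n) (y n.+1) w.
  rewrite -Rintegral_energyZ//; congr Rintegral; apply/funext => t.
  by rewrite normcM exprMn.
have c1 : cvgC (y n)^'+ w v.1.
  rewrite -[X in cvgC _ _ X](hom_start z (y n) v.1 v.2).
  by apply: cvgC_nbhs_right; exact: is_cder_cvg (dw _).
have c2 : cvgC (y n)^'+ (hom1 z (y n) v.1 v.2) v.2.
  rewrite -[X in cvgC _ _ X](hom1_start z (y n) v.1 v.2).
  by apply: cvgC_nbhs_right; exact: is_cder_cvg (is_cder_hom1 _ _ _ _ _).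
have [h1 h2] := HK _ _ _ _ _ _ _ g1 g2 (cellsol_hom z _ _ _ _ _) sw szw c1 c2.
by split => //; rewrite mulrC ler_pdivrMr// /nrm2 /q; rewrite eE in h1 h2; lra.
Qed.

Lemma piecewise_inL2 f (F : nat -> R -> R[i]) (N J : nat) (b : R) :
  (forall n t, exists w, is_cder (F n) t w) ->
  (forall n t, y n < t -> t <= y n.+1 -> f t = F n t) -> 0 <= b ->
  (forall n t, y n < t -> t <= y n.+1 ->
    normc (f t) ^+ 2 <= if (N <= n < N + J)%N then b else 0) ->
  inL2 f /\ fine (sqintegral f) <= J%:R * (b * L).
Proof.
move=> dF fF b0 fb; have L0 := regular_L_gt0 reg.
have cm n := cell_measurable (dF n) (fF n).
pose B n : R := if (N <= n < N + J)%N then b else 0.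
have B_ge0 n : 0 <= B n by rewrite /B; case: ifP.
have bd n : sq_integrable (y n) (y n.+1) f /\ energy (y n) (y n.+1) f <= B n * (y n.+1 - y n).
  have [m1 m2] := cm n; apply: sq_integrable_bounded => //.
    by have [g1 _] := regular_gap reg n; exact: ltW.
  exact: fb.
have m0 (p : R -> R) : (forall n, measurable_fun (`]y n, y n.+1] : set R) p) -> measurable_fun (@halfline R) p.
  move=> H; rewrite (halfline_cells reg).
  by apply/measurable_fun_bigcup => // n; exact: measurable_itv.
apply: (inL2_of_energy reg).
- by apply: m0 => n; have [] := cm n.
- by apply: m0 => n; have [] := cm n.
- by move=> n; have [] := bd n.
move=> k; apply: le_trans (sum_window N J k (mulr_ge0 b0 (ltW L0))).
apply: ler_sum => n _; have [_ h] := bd n; apply: (le_trans h).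
have [g1 g2] := regular_gap reg n; rewrite /B; case: ifP => _; last by rewrite mul0r.
by apply: ler_wpM2l.
Qed.

(** With a window of order K cells the cut-off is of order K^4 and its first derivative of order
    K^3: the square norm of the shifted function is of order K^7, that of the function itself of
    order K^9. *)
Lemma window_scale (c1 c2 : R) : 0 <= c1 -> 0 < c2 ->
  exists K : nat, [/\ (0 < K)%N & c1 * K%:R ^+ 7 <= c2 * K%:R ^+ 9].
Proof.
move=> c10 c20; exists (Num.bound (c1 / c2)).+1; split => //.
set k : R := _%:R; have k1 : 1 <= k by rewrite /k ler1n.
have h1 : c1 <= c2 * k.
  rewrite mulrC -ler_pdivrMr// /k -natr1.
  have := archi_boundP (divr_ge0 c10 (ltW c20)); lra.
have -> : k ^+ 9 = k * k * k ^+ 7 by ring.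
have -> : c2 * (k * k * k ^+ 7) = c2 * k * k * k ^+ 7 by ring.
apply: ler_wpM2r; first by apply: exprn_ge0; lra.
apply: (le_trans h1); rewrite ler_peMr//; lra.
Qed.

(** The window has 3 K cells. On its middle third both ends are at distance at least K l, which
    bounds the cut-off from below, while the data of the solution stay comparable to the eigenvector
    on the whole window. *)
Lemma weyl_function z m : normc m = 1 -> mtr (tmat z d a0) = m + m^-1 -> forall eps, 0 < eps ->
  exists f h v, [/\ T (f, h), cell_data x alpha f (cderive f) h v, v 0%N = (0, 0),
    0 < fine (sqintegral f) &
    fine (sqintegral (shifted f h z)) <= eps * fine (sqintegral f)].
Proof.
move=> m1 trm eps eps0.
have m0 : m != 0 by rewrite -normc_gt0 m1.
have [e e0 Me] := eigenvector (tmat_det z d a0) trm m0.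
pose E := nrm2 e; have E0 : 0 < E.
  rewrite lt_def nrm2_ge0 andbT; apply: contra e0 => /eqP/nrm2_eq0 ->.
  exact: eqxx.
have TM := transfer_mcvg z gap_d alpha_a0.
have [K1 K10 H1] := hom_sqr_bound L z; have [K2 K20 H2] := hom1_sqr_bound L z.
have [c c0 Hc] := hom_energy_lower z.
have [l0 _] := reg; have L0 := regular_L_gt0 reg.
(* The constants of the estimates [gle] and [fge] below, with the powers of K removed. *)
pose c1 : R := 3 * L * ((8 * (2 * (3 * L) ^+ 3) ^+ 2 * K2 + 2 * (6 * (3 * L) ^+ 2) ^+ 2 * K1) * (4 * E)).
pose c2 : R := eps * (l ^+ 8 * (c * (E / 4))).
have c10 : 0 <= c1.
  apply: mulr_ge0; first by lra.
  apply: mulr_ge0; last by lra.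
  by apply: addr_ge0; apply: mulr_ge0; rewrite ?(ltW K10) ?(ltW K20)//; apply: mulr_ge0; rewrite ?sqr_ge0 ?ler0n.
have c20 : 0 < c2 by rewrite /c2 !mulr_gt0 ?exprn_gt0// invr_gt0.
have [K [Kpos HK]] := window_scale c10 c20.
pose k : R := K%:R; rewrite -/k in HK; have k1 : 1 <= k by rewrite /k ler1n.
have k0 : 0 <= k := le_trans ler01 k1; have E40 : 0 <= 4 * E by lra.
have E4 : 0 < E / 4 by lra.
have [N0 HN] := eigenvector_tracking TM m1 Me (3 * K) E4.
(* The window avoids cell 0, so the function vanishes near 0 and satisfies every boundary condition.
   [w0] is the datum at 0 whose solution reaches the eigenvector at node [N]. *)
pose N := maxn N0 1; pose M := (N + 3 * K)%N.
have [w0 Hw0] := sol_reaches (@vzero R) N e (transfer_det x alpha z).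
pose u := sol (transfer x alpha z) (@vzero R) w0.
have nu n : (N <= n <= M)%N -> E / 4 <= nrm2 (u n) /\ nrm2 (u n) <= 4 * E.
  move=> /andP[Nn nM]; have uE : u n = sol (fun n => transfer x alpha z (N + n)%N) (@vzero R) e (n - N).
    by rewrite /u -{1}(subnKC Nn) sol_split Hw0.
  have nN : (n - N <= 3 * K)%N by rewrite leq_subLR.
  have := HN N (leq_maxl _ _) _ nN; rewrite -uE.
  set em := vscale (m ^+ _) e; have emE : nrm2 em = E.
    by rewrite /em nrm2Z normcXn m1 !expr1n mul1r.
  move=> h; have h3 := nrm2D (vadd (u n) (vscale (-1) em)) em.
  have h4 := nrm2D (vscale (-1) (vadd (u n) (vscale (-1) em))) (u n).
  have e3 : vadd (vadd (u n) (vscale (-1) em)) em = u n.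
    by rewrite /vadd /vscale /=; case: (u n) => p q /=; congr (_, _); ring.
  have e4 : vadd (vscale (-1) (vadd (u n) (vscale (-1) em))) (u n) = em.
    by rewrite [RHS]surjective_pairing /vadd /vscale /=; congr (_, _); ring.
  rewrite e3 emE in h3; rewrite e4 emE nrm2Z normcN normc1 expr1n mul1r in h4.
  by clear - h h3 h4 E0; lra.
pose inw n := (N <= n < M)%N.
pose X n := if inw n then cut (y N) (y M) else cst 0.
pose X1 n := if inw n then cut1 (y N) (y M) else cst 0.
pose X2 n := if inw n then cut2 (y N) (y M) else cst 0.
pose X3 n := if inw n then cut3 (y N) (y M) else cst 0.
have dX n t : is_cder (X n) t (X1 n t).
  by rewrite /X /X1; case: ifP => _; [exact: is_cder_cut|exact: is_cder_cst].
have dX1 n t : is_cder (X1 n) t (X2 n t).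
  by rewrite /X1 /X2; case: ifP => _; [exact: is_cder_cut1|exact: is_cder_cst].
have dX2 n t : is_cder (X2 n) t (X3 n t).
  by rewrite /X2 /X3; case: ifP => _; [exact: is_cder_cut2|exact: is_cder_cst].
have edge n : inw n != inw n.+1 -> n.+1 = N \/ n.+1 = M by exact: window_edge (leq_addr _ _).
have [z1 z2 z3 z4] := cut_end (y N) (y M).
have XE n : X n (y n.+1) = X n.+1 (y n.+1).
  rewrite /X; have [->//|/edge[]->] := eqVneq (inw n) (inw n.+1); by do 2 case: ifP.
have X1E n : X1 n (y n.+1) = X1 n.+1 (y n.+1).
  rewrite /X1; have [->//|/edge[]->] := eqVneq (inw n) (inw n.+1); by do 2 case: ifP.
have [f [h [D Hfh]]] := cutoff_data (sol_is_sol _ _ _ : is_sol _ _ u) dX dX1 dX2 XE X1E.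
set v := fun n => _ in D.
have inw0 : inw 0%N = false by rewrite /inw /N; clear; lia.
have v0 : v 0%N = (0, 0) by rewrite /v /X /X1 inw0 /= !mul0r addr0.
pose w n := hom z (y n) (u n).1 (u n).2; pose w1 n := hom1 z (y n) (u n).1 (u n).2.
pose V : R := 3 * k * L.
have yMN : y M - y N <= V.
  have /andP[_] := node_span N (3 * K); rewrite natrM -/k /M /V; lra.
have inwP n t : inw n -> y n < t -> t <= y n.+1 -> y N <= t /\ t <= y M.
  move=> /andP[Nn nM] nt tn; have := node_le reg Nn; have := node_le reg nM.
  by move=> h1 h2; split; [exact: le_trans h2 (ltW nt)|exact: le_trans tn h1].
have cutP n t : inw n -> y n < t -> t <= y n.+1 -> [/\ normc (X n t) ^+ 2 <= (V ^+ 4) ^+ 2,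
    normc (X1 n t) ^+ 2 <= (2 * V ^+ 3) ^+ 2, normc (X2 n t) ^+ 2 <= (6 * V ^+ 2) ^+ 2,
    normc (w n t) ^+ 2 <= K1 * (4 * E) & normc (w1 n t) ^+ 2 <= K2 * (4 * E)].
  move=> nw nt tn; have [t1 t2] := inwP n t nw nt tn.
  rewrite /X /X1 /X2 nw; have [h1 h2 h3] := cut_upper t1 t2 yMN.
  have [|_ un] := nu n; first by move: nw => /andP[-> /ltnW].
  have [g1 g2] := regular_gap reg n.
  have V0 : 0 <= V by rewrite /V !mulr_ge0// ltW.
  have tL : t - y n <= L by apply: le_trans g2; rewrite lerD2r.
  have V4 : 0 <= V ^+ 4 by exact: exprn_ge0.
  have V3 : 0 <= 2 * V ^+ 3 by apply: mulr_ge0 => //; exact: exprn_ge0.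
  have V2 : 0 <= 6 * V ^+ 2 by apply: mulr_ge0 => //; exact: exprn_ge0.
  split; rewrite ?ler_sqr ?nnegrE ?normc_ge0 ?V4 ?V3 ?V2//.
    by apply: le_trans (H1 _ _ _ _ (ltW nt) tL) _; rewrite ler_pM2l.
  by apply: le_trans (H2 _ _ _ _ (ltW nt) tL) _; rewrite ler_pM2l.
have dw n t : is_cder (w n) t (w1 n t) by exact: is_cder_hom.
have dw1 n t : is_cder (w1 n) t (- (z * w n t)) by exact: is_cder_hom1.
have out n t : inw n = false -> [/\ X n t = 0, X1 n t = 0 & X2 n t = 0].
  by rewrite /X /X1 /X2 => ->.
have [Lf _] : inL2 f /\ fine (sqintegral f) <= (3 * K)%:R * ((V ^+ 4) ^+ 2 * (K1 * (4 * E)) * L).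
  apply: (piecewise_inL2 (F := fun n t => X n t * w n t) (N := N)).
  - by move=> n t; eexists; exact: is_cderM (dX n t) (dw n t).
  - by move=> n t nt tn; have [] := Hfh n t nt tn.
  - by apply: mulr_ge0; [exact: sqr_ge0|apply: mulr_ge0 => //; exact: ltW].
  move=> n t nt tn; have [-> _] := Hfh n t nt tn; rewrite -/M -/(inw n) -/(w n t).
  rewrite normcM exprMn; case: ifPn => [nw|/negbTE nw]; last first.
    by have [-> _ _] := out n t nw; rewrite normc0 expr0n mul0r.
  by have [b1 _ _ b2 _] := cutP n t nw nt tn; apply: ler_pM => //; exact: sqr_ge0.
have [Lg gle] : inL2 (shifted f h z) /\ fine (sqintegral (shifted f h z)) <=
    (3 * K)%:R * ((8 * (2 * V ^+ 3) ^+ 2 * K2 + 2 * (6 * V ^+ 2) ^+ 2 * K1) * (4 * E) * L).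
  apply: (piecewise_inL2 (F := fun n t => - (2 * (X1 n t * w1 n t) + X2 n t * w n t)) (N := N)).
  - move=> n t; eexists; apply: is_cderN; apply: is_cderD.
      apply: is_cderZ; exact: is_cderM (dX1 n t) (dw1 n t).
    exact: is_cderM (dX2 n t) (dw n t).
  - by move=> n t nt tn; have [] := Hfh n t nt tn.
  - apply: mulr_ge0; last by lra.
    by apply: addr_ge0; apply: mulr_ge0; rewrite ?(ltW K10) ?(ltW K20)//; apply: mulr_ge0; rewrite ?sqr_ge0 ?ler0n.
  move=> n t nt tn; have [_ ->] := Hfh n t nt tn; rewrite -/M -/(inw n) -/(w n t) -/(w1 n t) normcN.
  case: ifPn => [nw|/negbTE nw]; last first.
    by have [_ -> ->] := out n t nw; rewrite !mul0r mulr0 addr0 normc0 expr0n.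
  have [_ b1 b2 b3 b4] := cutP n t nw nt tn.
  apply: (le_trans (sqr_normcD_le _ _)); set B := leRHS; rewrite !normcM !exprMn {}/B.
  have -> : normc (2 : R[i]) ^+ 2 = 4 by rewrite -(rmorph_nat (real_complex R)) normc_real ger0_norm//; ring.
  have b5 : normc (X1 n t) ^+ 2 * normc (w1 n t) ^+ 2 <= (2 * V ^+ 3) ^+ 2 * (K2 * (4 * E)).
    by apply: ler_pM => //; exact: sqr_ge0.
  have b6 : normc (X2 n t) ^+ 2 * normc (w n t) ^+ 2 <= (6 * V ^+ 2) ^+ 2 * (K1 * (4 * E)).
    by apply: ler_pM => //; exact: sqr_ge0.
  by clear - b5 b6; lra.
have fge : k * ((k * l) ^+ 8 * (c * (E / 4))) <= fine (sqintegral f).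
  apply: le_trans (sum_energy_le reg (N + K + K) Lf).
  rewrite big_split_ord/=.
  apply: (@le_trans _ _ (\sum_(i < K) (k * l) ^+ 8 * (c * (E / 4)))).
    by rewrite sumr_const card_ord -[leRHS]mulr_natl.
  apply: le_trans (_ : _ <= 0 + _) _; first by rewrite add0r.
  apply: lerD; first by apply: sumr_ge0 => i _; exact: energy_ge0.
  apply: ler_sum => i _; set n := (N + K + i)%N.
  have iK : (i < K)%N by exact: ltn_ord.
  have nw : inw n by rewrite /inw /n /M; clear - iK; lia.
  have [un _] : E / 4 <= nrm2 (u n) /\ nrm2 (u n) <= 4 * E by apply: nu; rewrite /n /M; clear - iK; lia.
  have [sw Hw] := Hc n (u n).
  have kl : 0 <= k * l by apply: mulr_ge0 => //; exact: ltW.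
  have kl8 : 0 <= (k * l) ^+ 8 by exact: exprn_ge0.
  apply: (@le_trans _ _ ((k * l) ^+ 8 * energy (y n) (y n.+1) (w n))).
    apply: ler_wpM2l => //; apply: le_trans Hw; rewrite ler_pM2l//.
  rewrite -Rintegral_energyZ//; have sf := inL2_sq_integrable reg n Lf.
  apply: le_Rintegral => //; [exact: integrable_energyZ|by have [] := sf|].
  move=> t /=; rewrite in_itv/= => /andP[nt tn]; have [-> _] := Hfh n t nt tn.
  rewrite -/(w n t) normcM [leRHS]exprMn; apply: ler_wpM2r; first exact: sqr_ge0.
  rewrite /X nw; have -> : (k * l) ^+ 8 = ((k * l) ^+ 4) ^+ 2 by ring.
  have /andP[s1 _] := node_span N K.
  have /andP[s2 _] := node_span (N + K + K) K.
  have s3 : y (N + K) <= y n by apply: (node_le reg); rewrite /n leq_addr.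
  have s4 : y n.+1 <= y (N + K + K) by apply: (node_le reg); rewrite /n; clear - iK; lia.
  have s5 : (N + K + K + K = M)%N by rewrite /M; clear; lia.
  rewrite s5 in s2; rewrite -/k in s1 s2.
  have s6 : t <= y n.+1 := tn; apply: cut_lower => //.
    by apply: le_trans s1 _; rewrite lerD2r; exact: le_trans s3 (ltW nt).
  by apply: le_trans s2 _; rewrite lerD2l lerN2; exact: le_trans s6 s4.
have f0 : 0 < fine (sqintegral f).
  apply: lt_le_trans fge; have kpos : 0 < k := lt_le_trans ltr01 k1.
  by rewrite !mulr_gt0// exprn_gt0// mulr_gt0.
exists f, h, v; split => //.
- have Lh : inL2 h.
    have := inL2_lin reg 1 z Lg Lf; congr inL2.
    by apply/funext => t; rewrite mul1r [RHS](congr1 (fun p => p t) (shiftedK f h z)).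
  by apply: (cell_data_Hamiltonian reg D _ Lf Lh); rewrite v0 /bc /= !mul0r.
- apply: (le_trans gle); apply: le_trans (ler_wpM2l (ltW eps0) fge).
  have -> : eps * (k * ((k * l) ^+ 8 * (c * (E / 4)))) = c2 * k ^+ 9 by rewrite /c2; ring.
  apply: le_trans HK; rewrite natrM -/k /c1 /V.
  have k4 : k ^+ 4 <= k ^+ 6 by apply: ler_weXn2l.
  set P : R := 3 * L; have P0 : 0 <= P by rewrite /P mulr_ge0// ltW.
  have -> : 3 * k * L = k * P by rewrite /P; ring.
  have -> : 3%:R * k * ((8 * (2 * (k * P) ^+ 3) ^+ 2 * K2 + 2 * (6 * (k * P) ^+ 2) ^+ 2 * K1) * (4 * E) * L) =
    k * P * (4 * E) * (8 * (2 * P ^+ 3) ^+ 2 * K2) * k ^+ 6 + k * P * (4 * E) * (2 * (6 * P ^+ 2) ^+ 2 * K1) * k ^+ 4.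
    by rewrite /P; ring.
  have -> : P * ((8 * (2 * P ^+ 3) ^+ 2 * K2 + 2 * (6 * P ^+ 2) ^+ 2 * K1) * (4 * E)) * k ^+ 7 =
    k * P * (4 * E) * (8 * (2 * P ^+ 3) ^+ 2 * K2) * k ^+ 6 + k * P * (4 * E) * (2 * (6 * P ^+ 2) ^+ 2 * K1) * k ^+ 6.
    by ring.
  rewrite lerD2l; apply: ler_wpM2l => //.
  have h8 : 0 <= k * P * (4 * E) by apply: mulr_ge0 => //; exact: mulr_ge0.
  apply: mulr_ge0 => //; apply: mulr_ge0; last exact: ltW.
  by apply: mulr_ge0 => //; exact: sqr_ge0.
Qed.

End spectral.
End Weyl.

(** * The spectrum *)

Section Spectrum.
Context {R : realType}.
Implicit Types (f h g psi : R -> R[i]) (z : R[i]) (s e t : R).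
Local Notation normc := (@Normc.normc R).
Local Notation vec := (R[i] * R[i])%type.
Variables (x alpha : nat -> R) (l L A d a0 kappa : R).
Hypothesis d0 : 0 < d.
Hypothesis reg : regular x l L.
Hypothesis alA : forall n, `|alpha n| <= A.
Hypothesis gap_d : tends (fun n => node x n.+1 - node x n) d.
Hypothesis alpha_a0 : tends (fun n => alpha n.+1) a0.
Local Notation y := (node x).
Local Notation T := (Hamiltonian kappa x alpha).
Local Notation band z := (-1 <= discriminant d a0 (sqrtC z) <= 1).

Lemma band_weyl z : band z -> forall eps, 0 < eps ->
  exists f h v, [/\ T (f, h), cell_data x alpha f (cderive f) h v, v 0%N = (0, 0),
    0 < fine (sqintegral f) &
    fine (sqintegral (shifted f h z)) <= eps * fine (sqintegral f)].
Proof.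
move=> /unit_root[m m1 sm]; apply: (weyl_function kappa reg gap_d alpha_a0 m1).
by rewrite tmat_tr sm.
Qed.

Lemma band_spectrum z : band z -> spectrum T z.
Proof.
move=> Bz [_ _ [M HM]]; pose c : R := (2 * (`|M| + 1))^-1.
have M0 := normr_ge0 M; have c0 : 0 < c by rewrite invr_gt0 mulr_gt0//; lra.
have c1 : c * (2 * (`|M| + 1)) = 1 by rewrite mulVf// gt_eqF// mulr_gt0//; lra.
have [f [h [v [Tf D v0 f0 Hf]]]] := band_weyl Bz (exprn_gt0 2 c0).
have := HM f h Tf; rewrite /L2norm.
set p := fine (sqintegral f) in f0 Hf *; set q := fine _ in Hf * => h0.
have sq : Num.sqrt q <= c * Num.sqrt p.
  by apply: (le_trans (ler_wsqrtr Hf)); rewrite sqrtrM ?sqr_ge0// sqrtr_sqr ger0_norm// ltW.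
have p0 : 0 < Num.sqrt p by rewrite sqrtr_gt0.
have h1 : M * Num.sqrt q <= `|M| * (c * Num.sqrt p).
  apply: (@le_trans _ _ (`|M| * Num.sqrt q)); first by apply: ler_wpM2r; [exact: sqrtr_ge0|exact: ler_norm].
  exact: ler_wpM2l.
have h2 : c * Num.sqrt p > 0 by exact: mulr_gt0.
have h3 : 2 * (`|M| * (c * Num.sqrt p)) + 2 * (c * Num.sqrt p) = Num.sqrt p.
  have -> : 2 * (`|M| * (c * Num.sqrt p)) + 2 * (c * Num.sqrt p) = c * (2 * (`|M| + 1)) * Num.sqrt p by ring.
  by rewrite c1 mul1r.
by clear - h0 h1 h2 h3 p0; lra.
Qed.

(** An approximate eigenfunction for z' is one for z up to (z' - z) f. Its data at 0 vanish, so the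
    a priori bound at z involves the shifted function alone and fails when z' is too close. *)
Lemma band_separated z m : hyperbolic (tmat z d a0) m ->
  exists2 r : R, 0 < r & forall z', band z' -> r <= normc (z' - z).
Proof.
move=> hM; have [K K0 HK] := apriori kappa reg alA gap_d alpha_a0 hM.
(* [c] bounds both the relative error at z' and the square of |z' - z|; doubling each and
   multiplying by [K] gives at most half of the square norm of [f]. *)
pose c : R := (4 * (2 * K))^-1; have c0 : 0 < c by rewrite invr_gt0 !mulr_gt0.
have cE : c * (8 * K) = 1 by rewrite /c; field; rewrite gt_eqF.
exists (Num.sqrt c) => [|z' Bz]; first by rewrite sqrtr_gt0.
rewrite leNgt; apply/negP => zr.
have [f [h [v [Tf D v0 f0 Hf]]]] := band_weyl Bz c0.
have [Lf Lh] := Hamiltonian_inL2 Tf; have Lg := inL2_shifted reg z' Lf Lh.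
have [_ H1] := sqintegral_lin reg 1 (z' - z) Lg Lf.
have gE : (fun t => 1 * shifted f h z' t + (z' - z) * f t) = shifted f h z.
  by apply/funext => t; rewrite /shifted; ring.
rewrite gE normc1 expr1n in H1.
have [_ H2] := HK f h v Tf D.
rewrite v0 /nrm2 /= normc0 expr0n !add0r in H2.
have zc : normc (z' - z) ^+ 2 <= c.
  by rewrite -(sqr_sqrtr (ltW c0)) ler_sqr ?nnegrE ?normc_ge0 ?sqrtr_ge0// ltW.
set F := fine (sqintegral f) in f0 Hf H1 H2; set q := fine _ in H1 H2; set q' := fine _ in Hf H1.
have h3 : normc (z' - z) ^+ 2 * F <= c * F by apply: ler_wpM2r => //; exact: ltW.
have h4 : q <= 4 * (c * F) by lra.
have h5 : K * q <= K * (4 * (c * F)) by rewrite ler_pM2l.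
have h6 : 2 * (K * (4 * (c * F))) = F.
  have -> : 2 * (K * (4 * (c * F))) = c * (8 * K) * F by ring.
  by rewrite cE mul1r.
lra.
Qed.

Lemma not_band_resolvent z : ~ band z -> ~ Defs.eigenvalue T z -> resolvent_set T z.
Proof.
move=> /hyperbolic_of_discriminant[m hM].
exact: (hyperbolic_resolvent reg alA gap_d alpha_a0 hM).
Qed.

Lemma nonreal_resolvent z : complex.Im z != 0 -> resolvent_set T z.
Proof.
move=> z0; apply: not_band_resolvent; first exact: nonreal_discriminant.
exact: (nonreal_not_eigenvalue reg alA).
Qed.

Lemma not_band_discrete z : ~ band z -> spectrum T z -> discrete_spectrum T z.
Proof.
move=> nB sz; have E : Defs.eigenvalue T z.
  by apply: contrapT => nE; apply: sz; exact: not_band_resolvent.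
have z0 : complex.Im z = 0.
  by apply/eqP; apply: contrapT => /negP zn; apply: sz; exact: nonreal_resolvent.
split => //; last exact: (eigenvalue_finite reg alA).
have [m hM] := hyperbolic_of_discriminant nB.
have [r1 r10 H1] := eigenvalue_gap reg alA gap_d alpha_a0 z0 hM E.
have [r2 r20 H2] := band_separated hM.
pose r := Num.min r1 r2; have r0 : 0 < r by rewrite lt_min r10.
split; first exact: mem_set.
exists (ball (z : (R[i] : numFieldType)) (r%:C : R[i])).
  by apply: nbhsx_ballx; rewrite ltcR.
apply/seteqP; split => [w [Bw sw]|w ->]; last first.
  by split => //; apply: ballxx; rewrite ltcR.
apply: contrapT => /eqP wz.
have wr : normc (w - z) < r.
  by move: Bw; rewrite -ball_normE /ball_ /= normc_abs ltcR normcBC.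
have [wr1 wr2] : normc (w - z) < r1 /\ normc (w - z) < r2.
  by move: wr; rewrite /r lt_min => /andP[].
apply: sw; have [w0|w0] := eqVneq (complex.Im w) 0; last exact: nonreal_resolvent.
apply: not_band_resolvent; last exact: H1.
by move=> /H2; rewrite leNgt wr2.
Qed.

(** The premise keeps an energy in the bands from being isolated in the spectrum, even if it is an
    eigenvalue. *)
Lemma spectral_description :
  (forall lam : R, bands d a0 lam -> forall r, 0 < r ->
     exists2 lam', bands d a0 lam' & lam' != lam /\ `|lam' - lam| < r) ->
  essential_spectrum T = [set lam%:C | lam in bands d a0] /\
  discrete_in T [set lam%:C | lam in ~` bands d a0].
Proof.
move=> perfect; split; last first.
  by move=> z [sz [lam nB zl]]; apply: not_band_discrete => //; rewrite -zl.
apply/seteqP; split => [z [sz nd]|_ [lam Bl <-]].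
  have Bz : band z by apply: contrapT => nB; apply: nd; exact: not_band_discrete.
  have z0 : complex.Im z = 0.
    by apply/eqP; apply: contrapT => /negP zn; apply: (nonreal_discriminant d0 zn Bz).
  have zE : z = (complex.Re z)%:C by apply: complexP.
  by exists (complex.Re z) => //; rewrite /bands /= -zE.
split; first exact: band_spectrum.
move=> [[_ [V /nbhs_ballP[e /= e0 eV] VS]] _ _].
move: e0; rewrite ltcE /= => /andP[/eqP e1 e2].
have [lam' Bl' [ne lr]] := perfect lam Bl _ e2.
have : [set (lam%:C : R[i])] lam'%:C.
  rewrite -VS; split; last exact: band_spectrum.
  apply: eV; rewrite -ball_normE /ball_ /= normc_abs -rmorphB normc_real distrC.
  by rewrite ltcE /= -e1 eqxx.
by move=> /= [E]; rewrite E eqxx in ne.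
Qed.

End Spectrum.

(** * The bands *)

Section Bands.
Context {R : realType}.
Implicit Types (z w k : R[i]) (t d a lam r : R).
Local Notation normc := (@Normc.normc R).

Lemma ccosN w : ccos (- w) = ccos w.
Proof. by rewrite /ccos mulrN opprK addrC. Qed.

Lemma csinN w : csin (- w) = - csin w.
Proof. by rewrite /csin mulrN opprK -[RHS]mulNr opprB. Qed.

Local Notation cj := (@conjc R).

Lemma ccsin_conj w : cj (ccos w) = ccos (cj w) /\ cj (csin w) = csin (cj w).
Proof.
have cexp_conj (u : R[i]) : cj (cexp u) = cexp (cj u).
  by case: u => a b /=; rewrite cosN sinN mulrN.
have cM (u v : R[i]) : cj (u * v) = cj u * cj v by exact: rmorphM.
have cD (u v : R[i]) : cj (u + v) = cj u + cj v by exact: rmorphD.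
have cN (u : R[i]) : cj (- u) = - cj u by exact: rmorphN.
have c2 : cj 2 = 2 by exact: conjc_nat 2.
have ii : cj 'i = - 'i by apply: complexP => /=; rewrite ?oppr0.
have two0 : (2 : R[i]) != 0 by rewrite pnatr_eq0.
have two0i : (2 * 'i : R[i]) != 0 by rewrite mulf_neq0// i_neq0.
have eN (u : R[i]) : cj (cexp (- ('i * u))) = cexp ('i * cj u).
  by rewrite cexp_conj cN cM ii mulNr opprK.
have eP (u : R[i]) : cj (cexp ('i * u)) = cexp (- ('i * cj u)).
  by rewrite cexp_conj cM ii mulNr.
split.
  by apply: (mulIf two0); rewrite -[X in _ * X = _]c2 -cM /ccos !mulfVK// cD eN eP addrC.
apply: (mulIf two0i).
have -> : cj (csin w) * (2 * 'i) = - cj (csin w * (2 * 'i)) by rewrite !cM c2 ii; ring.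
by rewrite /csin !mulfVK// cD cN eN eP opprD opprK addrC.
Qed.

(** Both functions are even in the root, so any root may replace [sqrtC z]. *)
Lemma CSz_root k z t : k ^+ 2 = z -> k != 0 ->
  Cz z t = ccos (k * t%:C) /\ Sz z t = csin (k * t%:C) / k.
Proof.
move=> kz k0; have : sqrtC z ^+ 2 == k ^+ 2 by rewrite sqrtCK kz.
rewrite eqf_sqr /Cz /Sz => /orP[]/eqP ->; first by rewrite (negPf k0).
by rewrite oppr_eq0 (negPf k0) mulNr ccosN csinN invrN mulrNN.
Qed.

(** For a real energy the conjugate of a root is again a root, so both functions are invariant under
    conjugation. *)
Lemma CSz_real lam t : complex.Im (Cz lam%:C t) = 0 /\ complex.Im (Sz lam%:C t) = 0.
Proof.
have real w : cj w = w -> complex.Im w = 0.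
  by case: w => p q /= [h]; lra.
pose k := sqrtC (lam%:C : R[i]); have [k0|k0] := eqVneq k 0.
  by rewrite /Cz /Sz -/k k0 mul0r ccos0 eqxx.
have kz : k ^+ 2 = lam%:C by exact: sqrtCK.
have kcz : cj k ^+ 2 = lam%:C by rewrite -rmorphXn kz; exact: conjc_real.
have kc0 : cj k != 0 by rewrite conjc_eq0.
have [h1 h2] := CSz_root t kz k0; have [h3 h4] := CSz_root t kcz kc0.
have [c1 c2] := ccsin_conj (k * t%:C).
have kt : cj (k * t%:C) = cj k * t%:C by rewrite rmorphM; congr (_ * _); exact: conjc_real.
split; apply: real; first by rewrite {1}h1 c1 kt -h3.
by rewrite {1}h2 rmorphM/= [X in _ * X]conjc_inv c2 kt -h4.
Qed.

(** Dilation turns a change of the energy into a change of the length, so that derivatives in the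
    energy come from the known derivatives in t. *)
Lemma CSz_scale lam (s : R) t : lam != 0 -> s != 0 ->
  Cz (lam * s ^+ 2)%:C t = Cz lam%:C (s * t) /\
  Sz (lam * s ^+ 2)%:C t = Sz lam%:C (s * t) / s%:C.
Proof.
move=> l0 s0; pose k := sqrtC (lam%:C : R[i]); have kz : k ^+ 2 = lam%:C by exact: sqrtCK.
have k0 : k != 0 by rewrite -sqrf_eq0 kz fmorph_eq0.
have sC : s%:C != 0 :> R[i] by rewrite fmorph_eq0.
have skz : (k * s%:C) ^+ 2 = (lam * s ^+ 2)%:C by rewrite exprMn kz rmorphM rmorphXn.
have [h1 h2] := CSz_root t skz (mulf_neq0 k0 sC); have [h3 h4] := CSz_root (s * t) kz k0.
by rewrite h1 h2 h3 h4 rmorphM mulrA invfM mulrA.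
Qed.

Definition rC lam t : R := complex.Re (Cz lam%:C t).
Definition rS lam t : R := complex.Re (Sz lam%:C t).

Lemma rCE lam t : Cz lam%:C t = (rC lam t)%:C.
Proof. by apply: complexP => //=; have [] := CSz_real lam t. Qed.

Lemma rSE lam t : Sz lam%:C t = (rS lam t)%:C.
Proof. by apply: complexP => //=; have [] := CSz_real lam t. Qed.

Lemma rCS_sqr lam t : rC lam t ^+ 2 + lam * rS lam t ^+ 2 = 1.
Proof.
have := CSz_sqr lam%:C t; rewrite rCE rSE -!rmorphXn -rmorphM -rmorphD.
by move=> /(congr1 (@complex.Re R)).
Qed.

Lemma is_derive_rC lam t : is_derive t 1 (rC lam) (- lam * rS lam t).
Proof.
have [H _] := is_cder_Cz lam%:C t; apply: is_derive_eq H _.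
by rewrite mulNr ReN ReM /= mul0r subr0 mulNr.
Qed.

Lemma is_derive_rS lam t : is_derive t 1 (rS lam) (rC lam t).
Proof. by have [H _] := is_cder_Sz lam%:C t. Qed.

Lemma rC0 lam : rC lam 0 = 1.
Proof. by rewrite /rC Cz0. Qed.

Lemma rS0 lam : rS lam 0 = 0.
Proof. by rewrite /rS Sz0. Qed.

Lemma rS_MVT lam (s e : R) : s < e -> exists2 u, s < u < e & rS lam e - rS lam s = rC lam u * (e - s).
Proof.
move=> se; have [u uI E] := @MVT R (rS lam) (rC lam) s e se (fun t _ => is_derive_rS lam t)
  (derivable_within_continuous (fun t _ => @ex_derive _ _ _ _ _ _ _ (is_derive_rS lam t))).
by exists u; rewrite ?E//; move: uI; rewrite in_itv.
Qed.

Lemma bandsE d a lam : bands d a lam <-> -1 <= rC lam d + a * rS lam d / 2 <= 1.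
Proof.
rewrite /bands /= discriminantE rCE rSE.
have -> : (rC lam d)%:C + a%:C * (rS lam d)%:C / 2 = (rC lam d + a * rS lam d / 2)%:C.
  by rewrite rmorphD !rmorphM/= fmorphV rmorph_nat.
by rewrite !lecE /= oppr0 eqxx.
Qed.

(** Equality would give C(u)^2 = 1, hence S(u) = 0, at an intermediate u. For positive energies |C|
    <= 1 then makes |S(d)| at most d - u; for negative ones Rolle's theorem between 0 and u gives a
    zero of C, against C^2 >= 1. *)
Lemma rS_neq lam d : 0 < d -> lam != 0 -> rS lam d ^+ 2 != d ^+ 2.
Proof.
move=> d0 l0; apply/eqP => E.
have [u /andP[u0 ud]] := rS_MVT lam d0; rewrite rS0 !subr0 => Su.
have Cu : rC lam u ^+ 2 = 1.
  apply: (mulIf (lt0r_neq0 (exprn_gt0 2 d0))); rewrite mul1r -[RHS]E Su; ring.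
have /eqP Su0 : rS lam u == 0.
  have := rCS_sqr lam u; rewrite Cu => /eqP; rewrite -subr_eq0.
  have -> : 1 + lam * rS lam u ^+ 2 - 1 = lam * rS lam u ^+ 2 by ring.
  by rewrite mulf_eq0 (negPf l0) sqrf_eq0.
have [lp|lp] := ltP 0 lam.
  have [w /andP[uw wd]] := rS_MVT lam ud; rewrite Su0 subr0 => Sw.
  have := rCS_sqr lam w; have := mulr_ge0 (ltW lp) (sqr_ge0 (rS lam w)) => h1 h2.
  have h3 : rC lam w ^+ 2 * (d - u) ^+ 2 <= 1 * (d - u) ^+ 2.
    by apply: ler_wpM2r; [exact: sqr_ge0|lra].
  have : (d - u) ^+ 2 < d ^+ 2 by rewrite ltr_pXn2r ?nnegrE//; lra.
  by rewrite -E Sw exprMn; lra.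
have [w /andP[w0 wu]] := rS_MVT lam u0; rewrite Su0 rS0 subrr subr0 => /esym/eqP.
rewrite mulf_eq0 (gt_eqF u0) orbF => /eqP Cw.
have := rCS_sqr lam w; rewrite Cw expr0n /= add0r.
have : 0 <= (- lam) * rS lam w ^+ 2 by apply: mulr_ge0; [lra|exact: sqr_ge0].
lra.
Qed.

(** Where |g| < 1, continuity suffices. Where |g| = 1, the step [s] goes against the sign of g g',
    into the set. *)
Lemma level_perfect (g : R -> R) t g1 : is_derive t 1 g g1 -> `|g t| <= 1 ->
  (`|g t| = 1 -> g1 != 0) -> forall r, 0 < r ->
  exists u, [/\ u != t, `|u - t| < r & `|g u| <= 1].
Proof.
move=> dg gt1 ng r r0; have [g1t|g1t] := eqVneq `|g t| 1; last first.
  have [r1 r10 H] := (is_derive_epsP _ _ _).1 dg _ ltr01.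
  pose b : R := 1 - `|g t|; have b0 : 0 < b by rewrite subr_gt0 lt_neqAle g1t.
  have n0 := normr_ge0 g1.
  pose h := Num.min (r / 2) (Num.min (r1 / 2) (b / (`|g1| + 1))).
  have D0 : 0 < `|g1| + 1 by lra.
  have h0 : 0 < h by rewrite /h !lt_min !divr_gt0.
  have [h1 h2 h3] : [/\ h <= r / 2, h <= r1 / 2 & h * (`|g1| + 1) <= b].
    by rewrite -ler_pdivlMr// /h !ge_min !lexx !orbT.
  exists (t + h); have -> : t + h - t = h by ring.
  split; [by rewrite -subr_eq0 addrC addKr gt_eqF|by rewrite gtr0_norm//; lra|].
  have := H (t + h); have -> : t + h - t = h by ring.
  rewrite gtr0_norm// mul1r => /(_ ltac:(lra)) h4.
  have -> : g (t + h) = g t + (g (t + h) - g t - g1 * h) + g1 * h by ring.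
  apply: (le_trans (ler_normD _ _)); apply: (le_trans (lerD (ler_normD _ _) (lexx _))).
  by rewrite normrM (gtr0_norm h0); rewrite /b in h3; lra.
have g10 := ng g1t.
pose c : R := `|g1| / 2; have c0 : 0 < c by rewrite divr_gt0// normr_gt0.
have [r1 r10 H] := (is_derive_epsP _ _ _).1 dg _ c0.
pose h := Num.min (r / 2) (Num.min (r1 / 2) (c^-1 / 2)).
have h0 : 0 < h by rewrite /h !lt_min !divr_gt0 ?invr_gt0.
have [h1 h2 h3] : [/\ h <= r / 2, h <= r1 / 2 & h * c <= 1 / 2].
  have E : (c^-1 / 2) * c = 1 / 2 by rewrite mulrAC mulVf ?gt_eqF.
  by rewrite -[X in _ * c <= X]E ler_pM2r// /h !ge_min !lexx !orbT.
pose s : R := - g t * (g1 / `|g1|).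
have n1 : `|g1| != 0 by rewrite normr_eq0.
have s1 : `|s| = 1 by rewrite normrM normrN g1t normrM normfV normr_id mul1r mulfV.
have hE : `|s * h| = h by rewrite normrM s1 mul1r gtr0_norm.
exists (t + s * h); have -> : t + s * h - t = s * h by ring.
split; first by rewrite -subr_eq0 addrC addKr -normr_eq0 hE gt_eqF.
  by rewrite hE; lra.
have := H (t + s * h); have -> : t + s * h - t = s * h by ring.
rewrite hE => /(_ ltac:(lra)) h4.
have g1s : g1 * (s * h) = - g t * (2 * c * h).
  have -> : 2 * c = `|g1| by rewrite /c; field.
  have g12 : g1 * g1 = `|g1| * `|g1| by rewrite -!expr2 real_normK// num_real.
  have -> : g1 * (s * h) = - g t * (g1 * g1 / `|g1|) * h by rewrite /s; ring.
  by rewrite g12 mulfK// mulrA.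
rewrite g1s in h4; set k := g (t + s * h) in h4 *.
have hc : 0 < h * c by exact: mulr_gt0.
move: h4; rewrite !ler_norml.
have /eqP := g1t; rewrite eqr_norml => /andP[+ _].
by move=> /orP[]/eqP ->; lra.
Qed.

(** The expression is the derivative of L at the energy lam s^2 with respect to s at s = 1. With D
    for the value 1 or -1 of L and C eliminated, criticality gives S = - d D when a and S are
    nonzero, and S^2 = d^2 is excluded by [rS_neq]. *)
Lemma bands_noncritical a lam d : 0 < d -> lam != 0 -> a != 0 \/ lam < 0 ->
  `|rC lam d + a * rS lam d / 2| = 1 ->
  - lam * rS lam d * d + a / 2 * (rC lam d * d - rS lam d) != 0.
Proof.
move=> d0 l0 al; set C := rC lam d; set S := rS lam d => D1.
have SC : C ^+ 2 + lam * S ^+ 2 = 1 := rCS_sqr lam d.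
have Sd : S ^+ 2 != d ^+ 2 := rS_neq d0 l0.
pose D : R := C + a * S / 2; have D2 : D ^+ 2 = 1 by rewrite -real_normK ?num_real// D1 expr1n.
apply/eqP => E.
have EC : C = D - a * S / 2 by rewrite /D; ring.
have h1 : S * ((a ^+ 2 / 4 + lam) * S - D * a) = 0.
  have -> : S * ((a ^+ 2 / 4 + lam) * S - D * a) = (C ^+ 2 + lam * S ^+ 2) - D ^+ 2.
    by rewrite EC; field.
  by rewrite SC D2 subrr.
have [S0|S0] := eqVneq S 0.
  have C2 : C ^+ 2 = 1 by rewrite -SC S0 expr0n mulr0 addr0.
  have aC : a * C * d = 0.
    by move: E; rewrite S0 mulr0 mul0r add0r subr0 => E; lra.
  have C0 : C != 0 by rewrite -sqrf_eq0 C2 oner_eq0.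
  case: al => [a0|lneg]; first by move/eqP: aC; rewrite !mulf_eq0 (negPf a0) (negPf C0) (gt_eqF d0).
  have [u /andP[u0 ud]] := rS_MVT lam d0; rewrite -/S S0 rS0 subrr => /esym/eqP.
  rewrite subr0 mulf_eq0 (gt_eqF d0) orbF => /eqP Cu.
  have := rCS_sqr lam u; rewrite Cu expr0n /= add0r.
  have : 0 <= (- lam) * rS lam u ^+ 2 by apply: mulr_ge0; [lra|exact: sqr_ge0].
  by clear; lra.
have h2 : (a ^+ 2 / 4 + lam) * S = D * a.
  by move/eqP: h1; rewrite mulf_eq0 (negPf S0) /= subr_eq0 => /eqP.
have h3 : a * (d * D + S) = 0.
  have -> : a * (d * D + S) = 2 * d * ((a ^+ 2 / 4 + lam) * S) - d * (D * a) + a * S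
     - 2 * d * ((a ^+ 2 / 4 + lam) * S - D * a) by ring.
  rewrite h2 subrr mulr0 subr0.
  have -> : 2 * d * (D * a) - d * (D * a) + a * S = d * (D * a) + a * S by ring.
  have E2 : - lam * S * d + a / 2 * ((D - a * S / 2) * d - S) = 0 by rewrite -EC.
  have -> : d * (D * a) + a * S = - 2 * (- lam * S * d + a / 2 * ((D - a * S / 2) * d - S))
    - 2 * d * ((a ^+ 2 / 4 + lam) * S - D * a) by field.
  by rewrite E2 h2 subrr !mulr0 subr0.
move/eqP: h3; rewrite mulf_eq0 => /orP[/eqP a0|/eqP h3].
  move: h2; rewrite a0 expr0n /= mul0r add0r mulr0 => /eqP.
  by rewrite mulf_eq0 (negPf l0) (negPf S0).
have SD : S = - (d * D) by lra.
by move/eqP: Sd; apply; rewrite SD sqrrN exprMn D2 mulr1.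
Qed.

Lemma is_derive_scale (f : R -> R) (f1 d t : R) : is_derive (t * d) 1 f f1 ->
  is_derive t 1 (fun s => f (s * d)) (f1 * d).
Proof.
move=> H; have H' : is_derive t 1 (fun x : R => x * d) d.
  have -> : (fun x : R => x * d) = d \*: (id : R -> R) by apply/funext => x; rewrite /= mulrC.
  by apply: is_derive_eq; rewrite /GRing.scale /= mulr1.
exact: (is_derive1_comp (f := f)).
Qed.

Lemma rCS_scale lam (s d : R) : lam != 0 -> s != 0 ->
  rC (lam * s ^+ 2) d = rC lam (s * d) /\ rS (lam * s ^+ 2) d = rS lam (s * d) / s.
Proof.
move=> l0 s0; have [h1 h2] := CSz_scale d l0 s0; rewrite /rC /rS h1 h2; split => //.
by rewrite rSE -fmorphV -rmorphM.
Qed.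

Lemma bands_perfect_nonzero d a lam : 0 < d -> lam != 0 -> bands d a lam -> forall r, 0 < r ->
  exists2 lam', bands d a lam' & lam' != lam /\ `|lam' - lam| < r.
Proof.
move=> d0 l0 /bandsE Bl r r0.
have [/andP[/eqP a0 lp]|nal] := boolP ((a == 0) && (0 < lam)).
  exists (lam + r / 2).
    apply/bandsE; rewrite a0 !mul0r addr0 -ler_norml -(@ler_pXn2r _ 2) ?nnegrE// expr1n.
    rewrite real_normK ?num_real//; have := rCS_sqr (lam + r / 2) d.
    have : 0 <= (lam + r / 2) * rS (lam + r / 2) d ^+ 2 by apply: mulr_ge0; [lra|exact: sqr_ge0].
    lra.
  have -> : lam + r / 2 - lam = r / 2 by ring.
  split; last by rewrite gtr0_norm; lra.
  by rewrite -subr_eq0 addrC addKr; apply: lt0r_neq0; lra.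
have al : a != 0 \/ lam < 0.
  have [a0|] := eqVneq a 0; last by left.
  by right; move: nal; rewrite a0 eqxx /= -leNgt le_eqVlt (negPf l0).
pose g s := rC lam (s * d) + a / 2 * (rS lam (s * d) * s^-1).
have dg : is_derive (1 : R) 1 g (- lam * rS lam d * d + a / 2 * (rC lam d * d - rS lam d)).
  have dC : is_derive (1 : R) 1 (fun s => rC lam (s * d)) (- lam * rS lam d * d).
    by apply: is_derive_scale; rewrite mul1r; exact: is_derive_rC.
  have dS : is_derive (1 : R) 1 (fun s => rS lam (s * d)) (rC lam d * d).
    by apply: is_derive_scale; rewrite mul1r; exact: is_derive_rS.
  have dV := is_deriveV (oner_neq0 R) (is_derive_id (1 : R) 1).
  have dM := is_deriveM dS dV.
  have dZ := is_deriveD dC (is_deriveZ (a / 2) dM).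
  apply: is_derive_eq dZ _.
  by rewrite /GRing.scale /= !mul1r !invr1 !expr1n !invr1 !mulr1 !mul1r; ring.
have g1 : g 1 = rC lam d + a * rS lam d / 2 by rewrite /g mul1r invr1; ring.
have ll : 0 < `|lam| by rewrite normr_gt0.
(* Within 1/2 of 1 the factor u is nonzero and u + 1 <= 3, which converts closeness of u to 1 into
   closeness of the energies. *)
pose del := Num.min (1 / 2) (r / (3 * `|lam|)).
have del0 : 0 < del by rewrite /del lt_min !divr_gt0// mulr_gt0.
have [del1 del2] : del <= 1 / 2 /\ del * (3 * `|lam|) <= r.
  by rewrite -ler_pdivlMr ?mulr_gt0// /del !ge_min !lexx orbT.
have [||u [u1 ud gu]] := level_perfect dg _ _ del0.
- by rewrite g1 ler_norml.
- by rewrite g1 => h; exact: bands_noncritical.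
have /andP[um up] : - (1 / 2) < u - 1 < 1 / 2 by rewrite -ltr_norml; apply: lt_le_trans ud del1.
have u0 : u != 0 by apply: lt0r_neq0; lra.
exists (lam * u ^+ 2).
  have [h1 h2] := rCS_scale d l0 u0; apply/bandsE; rewrite h1 h2 -ler_norml.
  by move: gu; rewrite /g; congr (`|_ + _| <= _); ring.
have E : lam * u ^+ 2 - lam = lam * (u - 1) * (u + 1) by ring.
split; first by rewrite -subr_eq0 E !mulf_neq0// ?subr_eq0//; apply: lt0r_neq0; lra.
rewrite E !normrM (@gtr0_norm _ (u + 1)); last by lra.
have h : `|lam| * `|u - 1| < `|lam| * del by rewrite ltr_pM2l.
have h0 : 0 <= `|lam| * `|u - 1| by exact: mulr_ge0.
have h1 : `|lam| * `|u - 1| * (u + 1) <= `|lam| * `|u - 1| * 3 by apply: ler_wpM2l => //; lra.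
by apply: le_lt_trans h1 _; lra.
Qed.

(** * The energy 0 *)

Lemma rC_at0 d : rC 0 d = 1.
Proof. by rewrite /rC /Cz (_ : sqrtC _ = 0) ?sqrtC0// mul0r ccos0. Qed.

Lemma rS_at0 d : rS 0 d = d.
Proof. by rewrite /rS /Sz (_ : sqrtC _ = 0) ?sqrtC0// eqxx. Qed.

Lemma rCS_small lam (e : R) : 0 < e -> exists2 r, 0 < r & forall u, 0 < u -> u < r ->
  `|rC lam u - 1| <= e /\ `|rS lam u - u| <= e * u.
Proof.
move=> e0; have [r1 r10 H1] := (is_derive_epsP _ _ _).1 (is_derive_rC lam 0) _ ltr01.
have [r2 r20 H2] := (is_derive_epsP _ _ _).1 (is_derive_rS lam 0) _ e0.
exists (Num.min e (Num.min r1 r2)); first by rewrite !lt_min e0 r10.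
move=> u u0; rewrite !lt_min => /andP[ue /andP[u1 u2]].
have := H1 u; have := H2 u; rewrite rC0 rS0 mulr0 mul0r !subr0 mul1r mul1r gtr0_norm//.
by move=> /(_ u2) h2 /(_ u1) h1; split => //; lra.
Qed.

(* The inequality [sinh v / v <= cosh v] at half the argument. *)
Lemma rCS_lower (u : R) : 0 < u -> (forall v : R, 0 < v -> v < u -> 0 <= rC (-1) v) ->
  2 * rS (-1) u <= u * rC (-1) u + u.
Proof.
move=> u0 HC; pose F v := v * rC (-1) v - 2 * rS (-1) v + v.
pose F1 v := v * rS (-1) v - rC (-1) v + 1.
have dC (v : R) : is_derive v 1 (rC (-1)) (rS (-1) v).
  by apply: is_derive_eq (is_derive_rC (-1) v) _; rewrite opprK mul1r.
have dS (v : R) := is_derive_rS (-1) v.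
have dF (v : R) : is_derive v 1 F (F1 v).
  apply: is_derive_eq (is_deriveD (is_deriveB (is_deriveM (is_derive_id v 1) (dC v))
    (is_deriveZ 2 (dS v))) (is_derive_id v 1)) _.
  by rewrite /GRing.scale /= /F1; ring.
have dF1 (v : R) : is_derive v 1 F1 (v * rC (-1) v).
  apply: is_derive_eq (is_deriveD (is_deriveB (is_deriveM (is_derive_id v 1) (dS v)) (dC v))
    (is_derive_cst (1 : R) v 1)) _.
  by rewrite /GRing.scale /=; ring.
have F0 : F 0 = 0 by rewrite /F rS0; ring.
have F10 : F1 0 = 0 by rewrite /F1 rC0; ring.
have cF (f f1 : R -> R) (a b : R) : (forall v : R, is_derive v 1 f (f1 v)) -> {within `[a, b], continuous f}.
  by move=> H; apply: derivable_within_continuous => v _; have [] := H v.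
have [v] := MVT u0 (fun v _ => dF v) (cF _ _ _ _ dF).
rewrite in_itv/= => /andP[v0 vu]; rewrite F0 !subr0 => Fu.
have [w] := MVT v0 (fun v _ => dF1 v) (cF _ _ _ _ dF1).
rewrite in_itv/= => /andP[w0 wv]; rewrite F10 !subr0 => F1v.
have h : 0 <= F u.
  rewrite Fu F1v; apply: mulr_ge0; last exact: ltW.
  apply: mulr_ge0; last exact: ltW.
  by apply: mulr_ge0; [exact: ltW|apply: HC => //; exact: lt_trans vu].
by rewrite /F in h; lra.
Qed.

(** By dilation the energy becomes 1 or -1 and the length u tends to 0, where C - 1 and S / u - 1
    are small. The value at the energy 0 is 1 + b, so b lies between -2 and 0; its two extreme
    values need their own arguments. *)
Lemma bands_perfect_at0 d a : 0 < d -> bands d a 0 -> forall r, 0 < r ->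
  exists2 lam, bands d a lam & lam != 0 /\ `|lam| < r.
Proof.
move=> d0 /bandsE; rewrite rC_at0 rS_at0 => /andP[b1 b2] r r0.
pose b : R := a * d / 2; have [b3 b4] : -2 <= b /\ b <= 0 by rewrite /b; lra.
have main (lam : R) (e : R) : lam != 0 -> `|lam| = 1 -> 0 < e ->
   (forall u, 0 < u -> `|rC lam u - 1| <= e -> `|rS lam u - u| <= e * u ->
     (forall v, 0 < v -> v < u -> `|rC lam v - 1| <= e) ->
     -1 <= rC lam u + b * (rS lam u / u) <= 1) ->
   exists2 lam', bands d a lam' & lam' != 0 /\ `|lam'| < r.
  move=> l0 l1 e0 H; have [r1 r10 Hr] := rCS_small lam e0.
  pose s := Num.min (r1 / (2 * d)) (Num.min (1 / 2) (r / 2)).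
  have s0 : 0 < s by rewrite /s !lt_min !divr_gt0// mulr_gt0.
  have [s1 s2 s3] : [/\ s * (2 * d) <= r1, s <= 1 / 2 & s <= r / 2].
    by rewrite -ler_pdivlMr ?mulr_gt0// /s !ge_min !lexx !orbT.
  have sd : 0 < s * d by exact: mulr_gt0.
  have sn : s != 0 by rewrite gt_eqF.
  exists (lam * s ^+ 2).
    have [h1 h2] := rCS_scale d l0 sn; apply/bandsE; rewrite h1 h2.
    have [|k1 k2] := Hr (s * d) sd; first by lra.
    have := H _ sd k1 k2; have -> : b * (rS lam (s * d) / (s * d)) = a * (rS lam (s * d) / s) / 2.
      by rewrite /b; field; rewrite sn gt_eqF.
    apply => v v0 vs; have [|//] := Hr v v0; lra.
  split; first by rewrite mulf_neq0// expf_neq0.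
  rewrite normrM l1 mul1r ger0_norm ?sqr_ge0// expr2.
  have : s * s <= 1 / 2 * s by apply: ler_wpM2r => //; exact: ltW.
  lra.
have quot (lam e u : R) : 0 < u -> `|rS lam u - u| <= e * u -> `|rS lam u / u - 1| <= e.
  move=> u0 h; have -> : rS lam u / u - 1 = (rS lam u - u) / u by field; rewrite gt_eqF.
  by rewrite normrM normfV (gtr0_norm u0) ler_pdivrMr.
(* Here L = -1 at the energy 0. For positive energies cos u - 2 sin u / u starts with -1 - u^2 / 6,
   so the band is found at negative energies. *)
have [bE|b5] := eqVneq b (-2).
  apply: (main (-1) (1 / 2)); rewrite ?oppr_eq0 ?oner_eq0 ?normrN1 ?divr_gt0//.
  move=> u u0 h1 h2 h3; have /ler_normlP[q1 q2] := quot _ _ _ u0 h2.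
  have /ler_normlP[q3 q4] := h1; rewrite bE; apply/andP; split; last by lra.
  have h4 : 2 * rS (-1) u <= u * rC (-1) u + u.
    by apply: rCS_lower => // v v0 vu; have /ler_normlP[] := h3 v v0 vu; lra.
  have h5 : 2 * (rS (-1) u / u) <= rC (-1) u + 1.
    rewrite mulrA ler_pdivrMr//; lra.
  lra.
have [bE|b6] := eqVneq b 0.
  apply: (main 1 1); rewrite ?oner_eq0 ?normr1//.
  move=> u u0 _ _ _; rewrite bE mul0r addr0 -ler_norml -(@ler_pXn2r _ 2) ?nnegrE// expr1n.
  rewrite real_normK ?num_real//; have := rCS_sqr 1 u; have := sqr_ge0 (rS 1 u); lra.
(* A third of the distance of b from 0 and -2, because |b| <= 2 makes the deviation of L at most e +
   2 e. *)
pose e : R := Num.min (- b) (2 + b) / 3.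
have b7 : -2 < b by rewrite lt_neqAle eq_sym b5.
have b8 : b < 0 by rewrite lt_neqAle b6.
have [e1 e2] : 3 * e <= - b /\ 3 * e <= 2 + b.
  by rewrite /e mulrC divfK// !ge_min !lexx orbT.
have e0 : 0 < e by rewrite divr_gt0// lt_min; apply/andP; split; lra.
apply: (main 1 e); rewrite ?oner_eq0 ?normr1//.
move=> u u0 h1 h2 _; have h3 := quot _ _ _ u0 h2.
have h4 : `|rC 1 u - 1 + b * (rS 1 u / u - 1)| <= 3 * e.
  apply: (le_trans (ler_normD _ _)); rewrite normrM.
  have : `|b| * `|rS 1 u / u - 1| <= 2 * e by apply: ler_pM => //; rewrite ler_norml; lra.
  lra.
by move: h4; rewrite ler_norml; lra.
Qed.

Lemma bands_perfect d a lam : 0 < d -> bands d a lam -> forall r, 0 < r ->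
  exists2 lam', bands d a lam' & lam' != lam /\ `|lam' - lam| < r.
Proof.
move=> d0; have [->|l0] := eqVneq lam 0; last exact: bands_perfect_nonzero.
by move=> B0 r r0; have [u Bu Hu] := bands_perfect_at0 d0 B0 r0; exists u; rewrite ?subr0.
Qed.

End Bands.

(** * The perturbations *)

Section Perturbation.
Context {R : realType}.
Implicit Types (x u : nat -> R) (l L a d : R).

(** [gaps] starts with the distance from x 1 to x 2, so the length x 1 of the first cell is added to
    both bounds. *)
Lemma admissible_regular x : admissible x -> exists l L, regular x l L.
Proof.
move=> [x1 xS i0 ub]; exists (Num.min (x 1%N) (inf (gaps x))), (Num.max (x 1%N) (sup (gaps x))).
split; first by rewrite lt_min x1.
case=> [|n] /=; first by rewrite subr0 ge_min le_max !lexx.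
have G : gaps x (x n.+2 - x n.+1).
  by exists n.+1 => //; rewrite gtr0_norm// subr_gt0 xS.
rewrite ge_min le_max; apply/andP; split; apply/orP; right.
  by apply: ge_inf => //; exists 0 => _ [m _ <-].
exact: ub_le_sup.
Qed.

Lemma tends_cst a : tends (fun=> a) a.
Proof. by move=> e e0; exists 0%N => n _; rewrite subrr normr0 ltW. Qed.

Lemma tendsN u a : tends u a -> tends (fun n => - u n) (- a).
Proof. by move=> H e /H[N HN]; exists N => n /HN; rewrite -opprD normrN. Qed.

Lemma tends_shift u a : tends u a -> tends (fun n => u n.+1) a.
Proof. by move=> H e /H[N HN]; exists N => n Nn; apply: HN; exact: leqW. Qed.

Lemma tends_bounded u a : tends u a -> exists A : R, forall n, `|u n| <= A.
Proof.
move=> /(_ 1 ltr01)[N HN].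
have [B HB] : exists B : R, forall n, (n < N)%N -> `|u n| <= B.
  elim: N {HN} => [|N [B HB]]; first by exists 0.
  exists (Num.max B `|u N|) => n; rewrite ltnS leq_eqVlt le_max => /orP[/eqP->|/HB ->//].
  by rewrite lexx orbT.
exists (Num.max B (`|a| + 1)) => n; rewrite le_max; have [/HN h|/HB ->//] := leqP N n.
apply/orP; right; have -> : u n = a + (u n - a) by ring.
by apply: (le_trans (ler_normD _ _)); rewrite lerD2l.
Qed.

Lemma summable_tends0 (q : nat -> R) : (\sum_(1 <= n <oo) `|q n|%:E < +oo)%E -> tends q 0.
Proof.
move=> q1; pose S := fine (\sum_(1 <= n <oo) `|q n|%:E)%E.
have q0 : (0 <= \sum_(1 <= n <oo) `|q n|%:E)%E by apply: nneseries_ge0 => n _ _; rewrite lee_fin.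
have bd m : \sum_(1 <= n < m) `|q n| <= S.
  rewrite -lee_fin /S fineK ?ge0_fin_numE// -sumEFin.
  by apply: nneseries_lim_ge => n _ _; rewrite lee_fin.
have cv : cvgn (series (fun n => `|q n|)).
  apply: nondecreasing_is_cvgn.
    by apply/nondecreasing_seqP => n; rewrite /series /= big_nat_recr//= lerDl.
  (* [series] also counts the index 0, hence the extra term. *)
  exists (`|q 0%N| + S) => _ [[|m] _ <-]; rewrite /series /=.
    by rewrite big_geq// addr_ge0// (le_trans _ (bd 0%N))// big_geq.
  by rewrite big_ltn// lerD2l.
have /cvgrPdist_le H := cvg_series_cvg_0 cv.
move=> e /H[N _ HN]; exists N => n Nn.
by have := HN n Nn; rewrite /= sub0r normrN normr_id subr0.
Qed.

(** The power of n dominates its square root, which reaches |c| / e as soon as n reaches the square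
    of that number. *)
Lemma oscillation_tends0 (c gamma : R) (s : nat -> R) : 1 / 2 < gamma -> (forall n, `|s n| <= 1) ->
  tends (fun n => c * s n / n%:R `^ gamma) 0.
Proof.
move=> g2 s1 e e0; pose b : R := `|c| / e; have b0 : 0 <= b by rewrite divr_ge0// ltW.
exists (Num.bound (b ^+ 2)).+1 => n Nn; rewrite subr0.
have n1 : 1 <= n%:R :> R by rewrite ler1n; exact: leq_trans Nn.
have bn : b ^+ 2 <= n%:R.
  apply: (@le_trans _ _ (Num.bound (b ^+ 2))%:R); last by rewrite ler_nat; exact: ltnW.
  by apply: ltW; apply: archi_boundP; exact: sqr_ge0.
have p0 : 0 < n%:R `^ gamma :> R by apply: powR_gt0; lra.
have bp : b <= n%:R `^ gamma.
  apply: (@le_trans _ _ (n%:R `^ (1 / 2))); last by apply: ler_powR => //; exact: ltW.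
  rewrite div1r powR12_sqrt; last by lra.
  by rewrite -(ger0_norm b0) -sqrtr_sqr; exact: ler_wsqrtr.
rewrite normrM normfV (gtr0_norm p0) ler_pdivrMr// normrM.
apply: (@le_trans _ _ (`|c| * 1)); first exact: ler_wpM2l.
by rewrite mulr1 mulrC -ler_pdivrMr.
Qed.

End Perturbation.

Theorem corollary3p6 (R : realType) (d alpha0 c omega phi gamma kappa : R)
    (q : nat -> R)
    (d_gt0 : 0 < d)
    (c_neq0 : c != 0)
    (omega_itv : 0 < omega < pi) (omega_neq : omega != pi / 2)
    (phi_itv : 0 <= phi < 2 * pi)
    (gamma_itv : 1 / 2 < gamma <= 1)
    (q_l1 : (\sum_(1 <= n <oo) `|q n|%:E < +oo)%E)
    (kappa_itv : 0 <= kappa < pi) :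
  let pert := fun n : nat =>
    c * sin (2 * omega * n%:R + phi) / n%:R `^ gamma + q n in
  let xt := fun n : nat => n%:R * d in
  let alphat := fun n : nat => alpha0 + pert n in
  let xh := fun n : nat => n%:R * d + pert n in
  let alphah := fun _ : nat => alpha0 in
  let Ht := Hamiltonian kappa xt alphat in
  let Hh := Hamiltonian kappa xh alphah in
  let B := bands d alpha0 in
  admissible xh ->
  [/\ essential_spectrum Ht = [set lam%:C | lam in B],
      essential_spectrum Hh = [set lam%:C | lam in B],
      discrete_in Ht [set lam%:C | lam in ~` B]
    & discrete_in Hh [set lam%:C | lam in ~` B]].
Proof.
move=> pert xt alphat xh alphah Ht Hh B adm.
have [g2 _] := andP gamma_itv.
have pert0 : tends pert 0.
  rewrite -[0]addr0; apply: tendsD; last exact: summable_tends0.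
  apply: oscillation_tends0 => // n; rewrite ler_norml.
  by rewrite sin_geN1 sin_le1.
have perfect lam : B lam -> forall r, 0 < r ->
  exists2 lam', B lam' & lam' != lam /\ `|lam' - lam| < r by exact: bands_perfect.
have regt : regular xt d d.
  split => // -[|n]; rewrite /xt /=; first by rewrite mul1r subr0 lexx.
  by rewrite -(natr1 n.+1) mulrDl mul1r addrAC subrr add0r lexx.
have [l [L regh]] := admissible_regular adm.
have gapt : tends (fun n => node xt n.+1 - node xt n) d.
  move=> e e0; exists 0%N => n _; have [_ /(_ n)/andP[h1 h2]] := regt.
  by have -> : node xt n.+1 - node xt n - d = 0 by [lra|]; rewrite normr0 ltW.
have gaph : tends (fun n => node xh n.+1 - node xh n) d.
  have H : tends (fun n => d + (pert n.+1 - pert n)) d.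
    rewrite -[X in tends _ X]addr0; apply: tendsD; first exact: tends_cst.
    rewrite -[X in tends _ X](subrr 0); apply: tendsD; first exact: tends_shift.
    exact: tendsN.
  (* Index 0 is left out: node 0 is 0, not [xh 0], so the formula for the gaps starts with the
     second cell. *)
  move=> e /H[N HN]; exists N.+1 => -[//|n] Nn.
  have := HN n.+1 (ltnW Nn); rewrite /xh /=; congr (`|_ - _| <= _).
  by rewrite -(natr1 n.+1); ring.
have alt : tends (fun n => alphat n.+1) alpha0.
  rewrite -[X in tends _ X]addr0; apply: tendsD; first exact: tends_cst.
  exact: tends_shift.
have [A HA] : exists A : R, forall n, `|alphat n| <= A.
  apply: (@tends_bounded R _ (alpha0 + 0)); apply: tendsD; first exact: tends_cst.
  by [].
have [h1 h2] := spectral_description kappa d_gt0 regt HA gapt alt perfect.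
have alh : tends (fun n => alphah n.+1) alpha0 by exact: tends_cst.
have Ah n : `|alphah n| <= `|alpha0| by [].
have [h3 h4] := spectral_description kappa d_gt0 regh Ah gaph alh perfect.
by split.
Qed.
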